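(* Let $\Gamma$ be a finite group acting faithfully (by complex-linear maps) on a finite-dimensional complex vector space $V$. Regard $V$ as a real vector space with linear $\Gamma$-action. Then any (real) linear Poisson structure on $S(V^* )\rtimes\Gamma$ is quantizable.
   Context: Here $V^*$ is the real dual of the underlying real vector space of $V$, and all algebras are over $\mathbb{R}$. Fix a $\Gamma$-invariant inner product on $V$. For $\gamma\in\Gamma$, let $V^\gamma$ be the fixed subspace, $N^\gamma=(V^\gamma)^\perp\subset V$, and $l(\gamma)=\dim_{\mathbb R} N^\gamma$. Thus $V=V^\gamma\oplus N^\gamma$ and $V^*=(V^\gamma)^*\oplus (N^\gamma)^*$, where $(V^\gamma)^*$ is identified with the functionals vanishing on $N^\gamma$. $A=S(V^* )\rtimes\Gamma$ is the crossed product of the polynomial algebra $S(V^* )$ with $\Gamma$, with $\gamma x={}^\gamma x\,\gamma$ for $x\in V^*$. The group $\Gamma$ acts on families $(f_\gamma)_{\gamma\in\Gamma}$, $f_\gamma\in S(V^* )\otimes\wedge^\bullet V$, by $(g\cdot f)_{g\gamma g^{-1}}=g(f_\gamma)$, and $(\cdot)^\Gamma$ denotes invariants. Let $\mathsf{pr}_\gamma: S(V^* )\otimes\wedge^n V\to S((V^\gamma)^* )\otimes\wedge^{n-l(\gamma)}V^\gamma\otimes\wedge^{l(\gamma)}N^\gamma$ be the projection determined by $V=V^\gamma\oplus N^\gamma$ (restrict polynomials to $V^\gamma$, project polyvectors). It is known that $H^n(A,A)\cong\big(\bigoplus_{\gamma\in\Gamma}S((V^\gamma)^* )\otimes\wedge^{n-l(\gamma)}V^\gamma\otimes\wedge^{l(\gamma)}N^\gamma\big)^\Gamma$.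 For $n=2$ the isomorphism is as follows. Every class is represented by an $\mathbb{R}\Gamma$-bilinear cocycle $m$ (that is, $m(\gamma a,b)=\gamma m(a,b)$, $m(a\gamma,b)=m(a,\gamma b)$, $m(a,b\gamma)=m(a,b)\gamma$); writing $m(x,y)-m(y,x)=\sum_\gamma f_\gamma(x,y)\gamma$ for $x,y\in V^*$, with $f_\gamma\in S(V^* )\otimes\wedge^2V$, the class goes to $(\mathsf{pr}_\gamma f_\gamma)_\gamma$. A linear Poisson structure on $A$ is an element $\pi=(\pi_\gamma)_\gamma$ of $(V^*\otimes\wedge^2V)^\Gamma\oplus\big(\bigoplus_{l(\gamma)=2}(V^\gamma)^*\otimes\wedge^2N^\gamma\big)^\Gamma\subset H^2(A,A)$ (each $\pi_\gamma$ viewed as an antisymmetric bilinear map $V^*\times V^*\to V^*$) whose Gerstenhaber bracket with itself vanishes, i.e. $\mathsf{pr}_\gamma\big([\![\pi,\pi]\!]_\gamma\big)=0$ for all $\gamma\in\Gamma$, where for $x,y,z\in V^*$ $$[\![\pi,\pi]\!]_\gamma(x,y,z)=\sum_{\alpha\beta=\gamma}\pi_\alpha(\pi_\beta(x,y),z+{}^\beta z)+\pi_\alpha(\pi_\beta(y,z),x+{}^\beta x)+\pi_\alpha(\pi_\beta(z,x),y+{}^\beta y).$$ A Poisson structure $\pi\in H^2(A,A)$ is quantizable if there is an associative $\mathbb{R}[[\hbar]]$-bilinear product $a\star b=ab+\sum_{k\ge1}\hbar^k m_k(a,b)$ ($a,b\in A$) on $A[[\hbar]]$ such that the Hochschild 2-cocycle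 $m_1$ has class $\pi$ in $H^2(A,A)$. *)

(* Defs.v *)
From HB Require Import structures.
From mathcomp Require Import all_boot all_order all_algebra all_fingroup.
From mathcomp Require Import mxrepresentation complex reals.
From mathcomp Require Import mpoly.

Set Implicit Arguments.
Unset Strict Implicit.
Unset Printing Implicit Defensive.

Import Order.TTheory GRing.Theory Num.Theory.

Local Open Scope ring_scope.

Definition is_bilinear (K : pzRingType) (U V W : lmodType K)
    (f : U -> V -> W) : Prop :=
  (forall v, linear (fun u => f u v)) /\ (forall u, linear (f u)).

(* Formal power series in hbar are sequences of coefficients; [fps K] is the
   ring K[[hbar]], which acts on [fps A] by convolution. *)

Definition fps (M : Type) : Type := nat -> M.

Definition fps_const (M : nmodType) (a : M) : fps M :=
  fun k => if k is 0%N then a else 0.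

Definition fps_add (M : nmodType) (a b : fps M) : fps M :=
  fun k => a k + b k.

Definition fps_scale (K : pzRingType) (M : lmodType K)
    (s : fps K) (a : fps M) : fps M :=
  fun k => \sum_(i < k.+1) s i *: a (k - i)%N.

Definition fps_bilinear (K : pzRingType) (M : lmodType K)
    (op : fps M -> fps M -> fps M) : Prop :=
  (forall (s : fps K) a b c,
     op (fps_add (fps_scale s a) b) c = fps_add (fps_scale s (op a c)) (op b c))
  /\
  (forall (s : fps K) a b c,
     op c (fps_add (fps_scale s a) b) = fps_add (fps_scale s (op c a)) (op c b)).

Definition star_product (K : pzRingType) (A : algType K)
    (star : fps A -> fps A -> fps A) : Prop :=
  [/\ fps_bilinear star,
      associative star &
      forall a b : A, star (fps_const a) (fps_const b) 0%N = a * b].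

(* m_k of  star a b = ab + \sum_(k >= 1) hbar^k m_k(a, b). *)
Definition star_coef (K : pzRingType) (A : algType K)
    (star : fps A -> fps A -> fps A) (k : nat) (a b : A) : A :=
  star (fps_const a) (fps_const b) k.

Definition hochschild_cocycle2 (K : pzRingType) (A : algType K)
    (m : A -> A -> A) : Prop :=
  is_bilinear m /\
  forall a b c, a * m b c - m (a * b) c + m a (b * c) - m a b * c = 0.

Definition hochschild_cohomologous2 (K : pzRingType) (A : algType K)
    (m m' : A -> A -> A) : Prop :=
  exists2 u : A -> A, linear u &
    forall a b, m a b - m' a b = a * u b - u (a * b) + u a * b.

(* V = K^d is a space of column vectors, on which g acts by v |-> rho g *m v.
   Elements of the dual V^* are row vectors x, with x(v) = x *m v, and S(V^* )
   is {mpoly K[d]}, where 'X_i is the i-th coordinate function on V. *)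

Section Polynomials.
Variables (K : comNzRingType) (d : nat).

Definition linear_form (x : 'rV[K]_d) : {mpoly K[d]} :=
  \sum_(i < d) x 0 i *: 'X_i.

(* The polynomial function p \o M, for M seen as an endomorphism of V. *)
Definition poly_precomp (M : 'M[K]_d) (p : {mpoly K[d]}) : {mpoly K[d]} :=
  p \mPo [tuple linear_form (row i M) | i < d].

Lemma linear_form_is_linear : linear linear_form.
Proof.
move=> a x y; rewrite /linear_form scaler_sumr -big_split /=.
by apply: eq_bigr => i _; rewrite !mxE scalerDl scalerA.
Qed.

Lemma poly_precompX (M : 'M[K]_d) i :
  poly_precomp M 'X_i = linear_form (row i M).
Proof. by rewrite /poly_precomp comp_mpolyXU -tnth_nth tnth_mktuple. Qed.

Lemma poly_precomp_linear_form (M : 'M[K]_d) x :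
  poly_precomp M (linear_form x) = linear_form (x *m M).
Proof.
rewrite {1}/linear_form /poly_precomp raddf_sum /=.
rewrite /linear_form.
transitivity (\sum_i \sum_j (x 0 i * M i j) *: ('X_j : {mpoly K[d]})).
  apply: eq_bigr => i _; rewrite comp_mpolyZ.
  rewrite -[_ \mPo _]/(poly_precomp M 'X_i) poly_precompX scaler_sumr.
  by apply: eq_bigr => j _; rewrite mxE scalerA.
rewrite exchange_big /=; apply: eq_bigr => j _.
by rewrite mxE scaler_suml.
Qed.

Lemma poly_precompM (M N : 'M[K]_d) p :
  poly_precomp N (poly_precomp M p) = poly_precomp (M *m N) p.
Proof.
rewrite /poly_precomp (comp_mpolyEX p) raddf_sum /= [RHS]comp_mpolyEX.
apply: eq_bigr => m _; rewrite comp_mpolyZ; congr (_ *: _).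
rewrite !comp_mpolyX rmorph_prod /=; apply: eq_bigr => i _.
rewrite rmorphXn /=; congr (_ ^+ _); rewrite !tnth_mktuple.
by rewrite -/(poly_precomp N _) poly_precomp_linear_form row_mul.
Qed.

Lemma poly_precomp1 p : poly_precomp 1%:M p = p.
Proof.
rewrite -[RHS]comp_mpoly_id /poly_precomp; congr (_ \mPo _).
apply: eq_from_tnth => i; rewrite !tnth_mktuple /linear_form.
rewrite (bigD1 i) //= !mxE eqxx scale1r big1 ?addr0 // => j /negbTE ji.
by rewrite !mxE eq_sym ji scale0r.
Qed.

End Polynomials.

(* S(V^* ) >< Gamma, where a stands for \sum_g a(g) g. The product depends on the
   representation, which is therefore a (phantom) parameter of the type. *)
Definition crossed (K : fieldType) (Gamma : finGroupType) (d : nat)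
    (rho : mx_representation K [set: Gamma] d) : Type :=
  {ffun Gamma -> {mpoly K[d]}}.

Section CrossedProduct.
Variables (K : fieldType) (Gamma : finGroupType) (d : nat).
Variable rho : mx_representation K [set: Gamma] d.

Definition dual_act (g : Gamma) (x : 'rV[K]_d) : 'rV[K]_d := x *m rho g^-1%g.

Definition sym_act (g : Gamma) (p : {mpoly K[d]}) : {mpoly K[d]} :=
  poly_precomp (rho g^-1%g) p.

Local Notation crossed := (crossed rho).

HB.instance Definition _ := GRing.Lmodule.on crossed.

Definition crossed_one : crossed := [ffun g => if g == 1%g then 1 else 0].

(* (p h)(q k) = p (h . q) (h k) *)
Definition crossed_mul (a b : crossed) : crossed :=
  [ffun g => \sum_(h : Gamma) a h * sym_act h (b (h^-1 * g)%g)].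

Lemma sym_act1 p : sym_act 1%g p = p.
Proof. by rewrite /sym_act invg1 repr_mx1 poly_precomp1. Qed.

Lemma sym_actM g h p : sym_act (g * h)%g p = sym_act g (sym_act h p).
Proof. by rewrite /sym_act poly_precompM invMg repr_mxM ?inE. Qed.

Lemma sym_act_rmorph g p q : sym_act g (p * q) = sym_act g p * sym_act g q.
Proof. exact: rmorphM. Qed.

Lemma sym_act_one g : sym_act g 1 = 1.
Proof. exact: rmorph1. Qed.

Lemma sym_act_zero g : sym_act g 0 = 0.
Proof. exact: raddf0. Qed.

Lemma sym_act_add g p q : sym_act g (p + q) = sym_act g p + sym_act g q.
Proof. exact: raddfD. Qed.

Lemma sym_act_scale g c p : sym_act g (c *: p) = c *: sym_act g p.
Proof. exact: comp_mpolyZ. Qed.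

Lemma sym_act_sum g (I : finType) (F : I -> {mpoly K[d]}) :
  sym_act g (\sum_i F i) = \sum_i sym_act g (F i).
Proof. exact: raddf_sum. Qed.

Lemma crossed_mul_coef (a b : crossed) g :
  crossed_mul a b g = \sum_(h : Gamma) a h * sym_act h (b (h^-1 * g)%g).
Proof. exact: ffunE. Qed.

Lemma crossed_one_coef g : crossed_one g = if g == 1%g then 1 else 0.
Proof. exact: ffunE. Qed.

Lemma crossed_add_coef (a b : crossed) g : (a + b) g = a g + b g.
Proof. exact: ffunE. Qed.

Lemma crossed_scale_coef c (a : crossed) g : (c *: a) g = c *: a g.
Proof. exact: ffunE. Qed.

Lemma sum_mulVg (V : nmodType) (h : Gamma) (F : Gamma -> V) :
  \sum_k F k = \sum_k F (h^-1 * k)%g.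
Proof. exact: (reindex_inj (mulgI h^-1%g)). Qed.

Lemma sum_single (V : nmodType) (g : Gamma) (F : Gamma -> V) :
  (forall h, h != g -> F h = 0) -> \sum_h F h = F g.
Proof. by move=> F0; rewrite (bigD1 g) //= big1 ?addr0. Qed.

Lemma crossed_mulA : associative crossed_mul.
Proof.
move=> a b c; apply/ffunP => g.
rewrite [LHS]crossed_mul_coef [RHS]crossed_mul_coef.
transitivity (\sum_h \sum_k
   a h * sym_act h (b (h^-1 * k)%g) * sym_act k (c (k^-1 * g)%g)).
  apply: eq_bigr => h _; rewrite crossed_mul_coef sym_act_sum mulr_sumr.
  rewrite [LHS](sum_mulVg h); apply: eq_bigr => k _ /=.
  have -> : ((h^-1 * k)^-1 * (h^-1 * g) = k^-1 * g)%g.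
    by rewrite invMg invgK -mulgA mulKVg.
  by rewrite sym_act_rmorph -sym_actM mulKVg mulrA.
rewrite [LHS]exchange_big; apply: eq_bigr => k _ /=.
by rewrite [crossed_mul a b k]crossed_mul_coef mulr_suml.
Qed.

Lemma crossed_mul1 : left_id crossed_one crossed_mul.
Proof.
move=> a; apply/ffunP => g; rewrite crossed_mul_coef.
rewrite (bigD1 1%g) //= crossed_one_coef eqxx mul1r sym_act1 invg1 mul1g.
rewrite big1 ?addr0 // => h /negbTE h1.
by rewrite crossed_one_coef h1 mul0r.
Qed.

Lemma crossed_1mul : right_id crossed_one crossed_mul.
Proof.
move=> a; apply/ffunP => g; rewrite crossed_mul_coef.
rewrite (bigD1 g) //= crossed_one_coef mulVg eqxx sym_act_one mulr1.
rewrite big1 ?addr0 // => h /negbTE hg.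
by rewrite crossed_one_coef -eq_mulVg1 hg sym_act_zero mulr0.
Qed.

Lemma crossed_mulDl : left_distributive crossed_mul +%R.
Proof.
move=> a b c; apply/ffunP => g.
rewrite [RHS]crossed_add_coef [LHS]crossed_mul_coef.
rewrite [X in _ = X + _]crossed_mul_coef [X in _ = _ + X]crossed_mul_coef.
rewrite -big_split /=.
by apply: eq_bigr => h _; rewrite crossed_add_coef mulrDl.
Qed.

Lemma crossed_mulDr : right_distributive crossed_mul +%R.
Proof.
move=> a b c; apply/ffunP => g.
rewrite [RHS]crossed_add_coef [LHS]crossed_mul_coef.
rewrite [X in _ = X + _]crossed_mul_coef [X in _ = _ + X]crossed_mul_coef.
rewrite -big_split /=.
by apply: eq_bigr => h _; rewrite crossed_add_coef sym_act_add mulrDr.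
Qed.

Lemma crossed_one_neq0 : crossed_one != 0.
Proof.
apply/eqP => /(congr1 (fun a : crossed => a 1%g)).
by rewrite crossed_one_coef eqxx [RHS]ffunE => /eqP; rewrite oner_eq0.
Qed.

HB.instance Definition _ := GRing.Zmodule_isNzRing.Build crossed
  crossed_mulA crossed_mul1 crossed_1mul crossed_mulDl crossed_mulDr
  crossed_one_neq0.

Lemma crossed_mulE (a b : crossed) : a * b = crossed_mul a b.
Proof. by []. Qed.

Lemma crossed_scaleAl (c : K) (a b : crossed) : c *: (a * b) = (c *: a) * b.
Proof.
apply/ffunP => g; rewrite crossed_scale_coef !crossed_mulE.
rewrite [X in _ *: X]crossed_mul_coef [RHS]crossed_mul_coef.
rewrite scaler_sumr; apply: eq_bigr => h _.
by rewrite crossed_scale_coef scalerAl.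
Qed.

HB.instance Definition _ :=
  GRing.Lmodule_isLalgebra.Build K crossed crossed_scaleAl.

Lemma crossed_scaleAr (c : K) (a b : crossed) : c *: (a * b) = a * (c *: b).
Proof.
apply/ffunP => g; rewrite crossed_scale_coef !crossed_mulE.
rewrite [X in _ *: X]crossed_mul_coef [RHS]crossed_mul_coef.
rewrite scaler_sumr; apply: eq_bigr => h _.
by rewrite crossed_scale_coef sym_act_scale scalerAr.
Qed.

HB.instance Definition _ :=
  GRing.Lalgebra_isAlgebra.Build K crossed crossed_scaleAr.

Definition crossed_group (g : Gamma) : crossed :=
  [ffun h => if h == g then 1 else 0].

Definition crossed_poly (p : {mpoly K[d]}) : crossed :=
  [ffun h => if h == 1%g then p else 0].

Definition crossed_dual (x : 'rV[K]_d) : crossed :=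
  crossed_poly (linear_form x).

Lemma crossed_group_coef g h : crossed_group g h = if h == g then 1 else 0.
Proof. exact: ffunE. Qed.

Lemma crossed_poly_coef p h : crossed_poly p h = if h == 1%g then p else 0.
Proof. exact: ffunE. Qed.

Lemma crossed_group_poly g p :
  crossed_group g * crossed_poly p
    = crossed_poly (sym_act g p) * crossed_group g.
Proof.
apply/ffunP => k; rewrite !crossed_mulE.
rewrite [LHS]crossed_mul_coef [RHS]crossed_mul_coef.
rewrite [LHS](sum_single (g := g)) => [|h /negbTE hg]; last first.
  by rewrite crossed_group_coef hg mul0r.
rewrite [RHS](sum_single (g := 1%g)) => [|h /negbTE hg]; last first.
  by rewrite crossed_poly_coef hg mul0r.
rewrite invg1 mul1g sym_act1 !crossed_group_coef !crossed_poly_coef.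
rewrite !eqxx mul1r -eq_mulVg1 [g == k]eq_sym.
by case: ifP => _; rewrite ?mulr1 // mulr0 sym_act_zero.
Qed.

Lemma crossed_group_dual g x :
  crossed_group g * crossed_dual x
    = crossed_dual (dual_act g x) * crossed_group g.
Proof. by rewrite crossed_group_poly /sym_act poly_precomp_linear_form. Qed.

Definition group_bilinear (m : crossed -> crossed -> crossed) : Prop :=
  forall (g : Gamma) (a b : crossed),
    [/\ m (crossed_group g * a) b = crossed_group g * m a b,
        m (a * crossed_group g) b = m a (crossed_group g * b) &
        m a (b * crossed_group g) = m a b * crossed_group g].

(* B is the Gram matrix of the inner product on V. A subspace of V is encoded by
   the row space of a matrix, whose rows are the transposes of its vectors. *)
Section FixedSpaces.
Variable B : 'M[K]_d.

Definition fixed_space (g : Gamma) : 'M[K]_d := eigenspace (rho g)^T 1.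

Definition normal_space (g : Gamma) : 'M[K]_d := kermx (B *m (fixed_space g)^T).

Definition normal_dim (g : Gamma) : nat := \rank (normal_space g).

Definition fixed_proj (g : Gamma) : 'M[K]_d :=
  (proj_mx (fixed_space g) (normal_space g))^T.

Definition normal_proj (g : Gamma) : 'M[K]_d :=
  (proj_mx (normal_space g) (fixed_space g))^T.

(* (V^g)^*, identified with the functionals vanishing on N^g. *)
Definition in_fixed_dual (g : Gamma) (x : 'rV[K]_d) : Prop :=
  forall v : 'cV[K]_d, (v^T <= normal_space g)%MS -> x *m v = 0.

(* An element of S(V^* ) (x) \wedge^n V is an alternating n-linear map from V^*
   to S(V^* ). Its component in \wedge^(n-l) V^g (x) \wedge^l N^g is obtained by
   summing over the l-element sets S of arguments which are projected to
   (N^g)^*, the other ones being projected to (V^g)^*. S((V^g)^* ) is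
   identified with a subalgebra of S(V^* ) through p |-> p \o fixed_proj g. *)
Definition pr (g : Gamma) (n : nat)
    (w : ('I_n -> 'rV[K]_d) -> {mpoly K[d]}) (x : 'I_n -> 'rV[K]_d) :
    {mpoly K[d]} :=
  poly_precomp (fixed_proj g)
    (\sum_(S : {set 'I_n} | #|S| == normal_dim g)
        w (fun i => x i *m (if i \in S then normal_proj g else fixed_proj g))).

(* Every class in H^2(A, A) has a representative m' which is bilinear over the
   group algebra; writing  m'(x, y) - m'(y, x) = \sum_g f_g(x, y) g,  the
   isomorphism with the space of families (pi_g)_g maps it to (pr_g f_g)_g. *)
Definition has_class (m : crossed -> crossed -> crossed)
    (pi : Gamma -> 'rV[K]_d -> 'rV[K]_d -> {mpoly K[d]}) : Prop :=
  exists m' : crossed -> crossed -> crossed,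
    [/\ hochschild_cocycle2 m',
        group_bilinear m',
        hochschild_cohomologous2 m m' &
        forall (g : Gamma) (x : 'I_2 -> 'rV[K]_d),
          pr g (fun y : 'I_2 -> 'rV[K]_d =>
                  (m' (crossed_dual (y 0)) (crossed_dual (y 1))
                   - m' (crossed_dual (y 1)) (crossed_dual (y 0))) g) x
          = pi g (x 0) (x 1)].

Definition quantizable
    (pi : Gamma -> 'rV[K]_d -> 'rV[K]_d -> {mpoly K[d]}) : Prop :=
  exists star : fps crossed -> fps crossed -> fps crossed,
    [/\ star_product star,
        hochschild_cocycle2 (star_coef star 1%N) &
        has_class (star_coef star 1%N) pi].

Definition poisson_bracket (pi : Gamma -> 'rV[K]_d -> 'rV[K]_d -> 'rV[K]_d)
    (g : Gamma) (x y z : 'rV[K]_d) : 'rV[K]_d :=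
  \sum_(a : Gamma) \sum_(b : Gamma | (a * b)%g == g)
     (pi a (pi b x y) (z + dual_act b z)
      + pi a (pi b y z) (x + dual_act b x)
      + pi a (pi b z x) (y + dual_act b y)).

Record linear_poisson
    (pi : Gamma -> 'rV[K]_d -> 'rV[K]_d -> 'rV[K]_d) : Prop := LinearPoisson {
  lp_bilinear : forall g, is_bilinear (pi g);
  lp_antisym : forall g x y, pi g x y = - pi g y x;
  lp_support : forall g, g != 1%g -> normal_dim g != 2%N ->
    forall x y, pi g x y = 0;
  (* pi_g lies in (V^g)^* (x) \wedge^2 N^g when l(g) = 2 *)
  lp_values : forall g, normal_dim g = 2%N ->
    forall x y, in_fixed_dual g (pi g x y);
  lp_normal : forall g, normal_dim g = 2%N ->
    forall x y, in_fixed_dual g x -> pi g x y = 0;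
  lp_invariant : forall g h x y,
    pi (g * h * g^-1)%g (dual_act g x) (dual_act g y) = dual_act g (pi h x y);
  lp_jacobi : forall (g : Gamma) (x : 'I_3 -> 'rV[K]_d),
    pr g (fun y : 'I_3 -> 'rV[K]_d =>
            linear_form (poisson_bracket pi g (y 0) (y 1) (y 2))) x = 0
}.

End FixedSpaces.
End CrossedProduct.

Definition invariant_inner_product (R : realFieldType) (Gamma : finGroupType)
    (d : nat) (rho : mx_representation R [set: Gamma] d) (B : 'M[R]_d) : Prop :=
  [/\ B^T = B,
      forall v : 'cV[R]_d, v != 0 -> 0 < (v^T *m B *m v) 0 0 &
      forall g, (rho g)^T *m B *m rho g = B].

(* The real vector space underlying C^n is R^(n + n), with v |-> (Re v, Im v). *)

Section Realification.
Variables (R : rcfType) (Gamma : finGroupType) (n : nat).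

Definition realify_mx (M : 'M[R[i]]_n) : 'M[R]_(n + n) :=
  block_mx (map_mx (@complex.Re R) M) (- map_mx (@complex.Im R) M)
           (map_mx (@complex.Im R) M) (map_mx (@complex.Re R) M).

Definition realify_cV (v : 'cV[R[i]]_n) : 'cV[R]_(n + n) :=
  col_mx (map_mx (@complex.Re R) v) (map_mx (@complex.Im R) v).

Lemma map_ReM m p q (M : 'M[R[i]]_(m, p)) (N : 'M[R[i]]_(p, q)) :
  map_mx (@complex.Re R) (M *m N) =
    map_mx (@complex.Re R) M *m map_mx (@complex.Re R) N
    - map_mx (@complex.Im R) M *m map_mx (@complex.Im R) N.
Proof.
apply/matrixP => i j; rewrite !mxE raddf_sum -sumrB; apply: eq_bigr => k _.
by rewrite !mxE; case: (M i k) => a b; case: (N k j) => c e.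
Qed.

Lemma map_ImM m p q (M : 'M[R[i]]_(m, p)) (N : 'M[R[i]]_(p, q)) :
  map_mx (@complex.Im R) (M *m N) =
    map_mx (@complex.Re R) M *m map_mx (@complex.Im R) N
    + map_mx (@complex.Im R) M *m map_mx (@complex.Re R) N.
Proof.
apply/matrixP => i j; rewrite !mxE raddf_sum -big_split; apply: eq_bigr => k _.
by rewrite !mxE; case: (M i k) => a b; case: (N k j) => c e.
Qed.

Lemma realify_mxM M N : realify_mx (M *m N) = realify_mx M *m realify_mx N.
Proof.
rewrite /realify_mx mulmx_block map_ReM map_ImM !(mulNmx, mulmxN) opprD.
by congr block_mx; rewrite addrC.
Qed.

Lemma realify_mx_cV M v : realify_cV (M *m v) = realify_mx M *m realify_cV v.
Proof.
rewrite /realify_cV /realify_mx mul_block_col map_ReM map_ImM mulNmx.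
by rewrite [X in col_mx _ X]addrC.
Qed.

Lemma realify_mx1 : realify_mx 1%:M = 1%:M.
Proof.
rewrite /realify_mx scalar_mx_block.
suff [-> ->] : map_mx (@complex.Re R) (1%:M : 'M[R[i]]_n) = 1%:M /\
               map_mx (@complex.Im R) (1%:M : 'M[R[i]]_n) = 0 by rewrite oppr0.
by split; apply/matrixP => i j; rewrite !mxE; case: eqP.
Qed.

Variable rC : mx_representation R[i] [set: Gamma] n.

Lemma realify_mx_repr : mx_repr [set: Gamma] (fun g => realify_mx (rC g)).
Proof.
split=> [|g h _ _]; first by rewrite repr_mx1 realify_mx1.
by rewrite repr_mxM ?inE // realify_mxM.
Qed.

Definition realify : mx_representation R [set: Gamma] (n + n) :=
  MxRepresentation realify_mx_repr.

End Realification.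

(* Main.v *)
From Stdlib Require Import FunctionalExtensionality ClassicalEpsilon.
Require Import Defs.
From HB Require Import structures.
From mathcomp Require Import all_boot all_order all_algebra all_fingroup.
From mathcomp Require Import mxrepresentation complex reals.
From mathcomp Require Import mpoly.
From mathcomp Require Import zify ring.

(** A linear Poisson structure pi is quantized by deforming the relation
    x y = y x of the crossed product into
        x y - y x = sum_g (hbar pi_g(x, y) + hbar^2 kappa_g(x, y)) g
    for x, y in V^*, with suitable scalar forms kappa_g. The product obtained on
    the crossed product is filtered, and its homogeneous components are the
    coefficients of the star product.

    The deformed relations define an algebra of the right size as soon as three
    identities hold, one for each degree of the Jacobi identity: a quadratic one,
    saying that the pi_g with g <> 1 are of the form omega (x) lambda, where the
    cyclic sum of omega(y, z) (g x - x) vanishes; a linear one,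
        [[pi, pi]]_g(x, y, z) = 2 sum_cyc kappa_g(y, z) (x - g x);
    and the vanishing of the constants const_bracket_g(x, y, z). The last one
    holds automatically when g - 1 has rank at least four
    (const_bracket_eq0). This is PBW_coefficients and quantizable_of_PBW.
    The product is not obtained from a presentation: left multiplication by x
    is constructed directly as an operator mult_op x on the undeformed algebra,
    by a recursion on the degree based on the Euler identity
    n a = sum_i e_i D_i a, and the Jacobi identity shows that the commutators of
    these operators are the prescribed ones (defect_eq0).

    It remains to find kappa. Since Gamma acts by complex-linear maps, pi_g is
    nonzero only for g = 1 and for complex reflections g, and the hypothesis
    on pi says exactly that [[pi, pi]]_g = 0 when g = 1 (bracket_one) or g is a
    reflection (bracket_reflection). If the fixed space of g has complex
    codimension at least three, then g is not a product of two
    reflections and [[pi, pi]]_g = 0 for trivial reasons. In codimension two, the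
    projection pr kills all trilinear maps and [[pi, pi]]_g need not vanish. It
    can be nonzero only if g = s t for reflections s, t such that the value lambda of
    pi_t is moved by g. As lambda is fixed by the centralizer of t
    (pi_centralised), this forces t to generate, together with the elements of
    determinant one in the pointwise stabilizer of the fixed space of g, a
    dihedral group of order 2 m with m odd, g being one of its rotations
    (pair_dihedral_reflection, gam_pstab1). The bracket is then an explicit
    sum over the rotations, and the relations sum cos = sum sin = 0,
    applied to the angles and to their doubles, show that it has the required
    form for an explicit kappa_g (bracket_dihedral). A form kappa_g solving
    the linear equation is unique in codimension two (kappa_unique), so
    that kappa is Gamma-invariant. *)

Set Implicit Arguments.
Unset Strict Implicit.
Unset Printing Implicit Defensive.
Import Order.TTheory GRing.Theory Num.Theory.
Local Open Scope ring_scope.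

(** * Equations between integer combinations *)

Inductive zexpr := ZVar of nat | ZZero | ZAdd of zexpr & zexpr | ZOpp of zexpr
  | ZMuln of zexpr & nat.

Fixpoint zeval (V : zmodType) (env : seq V) (e : zexpr) : V :=
  match e with
  | ZVar i => env`_i
  | ZZero => 0
  | ZAdd a b => zeval env a + zeval env b
  | ZOpp a => - zeval env a
  | ZMuln a n => zeval env a *+ n
  end.

Fixpoint zcoef (e : zexpr) (i : nat) : int :=
  match e with
  | ZVar j => (i == j)%:Z
  | ZZero => 0
  | ZAdd a b => zcoef a i + zcoef b i
  | ZOpp a => - zcoef a i
  | ZMuln a n => zcoef a i * n%:Z
  end.

Lemma zevalE (V : zmodType) (env : seq V) e :
  zeval env e = \sum_(i < size env) env`_i *~ zcoef e i.
Proof.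
elim: e => /= [j||a -> b ->|a ->|a -> n].
- case: (ltnP j (size env)) => [lt|ge].
    rewrite (bigD1 (Ordinal lt)) //= eqxx mulr1z big1 ?addr0 // => i /eqP ne.
    case: eqP => [e|]; last by rewrite mulr0z.
    by case: ne; apply: val_inj.
  rewrite nth_default // big1 // => i _; case: eqP => [e|]; last by rewrite mulr0z.
  by move: (ltn_ord i); rewrite e ltnNge ge.
- by rewrite big1 // => i _; rewrite mulr0z.
- by rewrite -big_split; apply: eq_bigr => i _; rewrite mulrzDr.
- by rewrite -sumrN; apply: eq_bigr => i _; rewrite mulrNz.
- by rewrite -sumrMnl; apply: eq_bigr => i _; rewrite pmulrn mulrzA.
Qed.

(** Two formal combinations of the same atoms are equal in every abelian group
    once their integer coefficients agree; this justifies the tactic below. *)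
Lemma zmod_eq (V : zmodType) (env : seq V) e1 e2 :
  all (fun i => zcoef e1 i == zcoef e2 i) (iota 0 (size env)) ->
  zeval env e1 = zeval env e2.
Proof.
move=> /allP h; rewrite !zevalE; apply: eq_bigr => i _.
by rewrite (eqP (h _ _)) // mem_iota ltn_ord.
Qed.

(* Atoms are first looked up syntactically, which is fast, and only then up to
   conversion. *)
Ltac zindex_syn x l :=
  lazymatch l with
  | x :: _ => constr:(0%N)
  | _ :: ?l' => let n := zindex_syn x l' in constr:(S n)
  end.
Ltac zindex_conv x l :=
  lazymatch l with
  | ?y :: ?l' =>
    match goal with
    | _ => let _ := match goal with _ => unify x y end in constr:(0%N)
    | _ => let n := zindex_conv x l' in constr:(S n)
    end
  end.
Ltac zindex x l :=
  match goal with
  | _ => zindex_syn x l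
  | _ => zindex_conv x l
  end.
Ltac zmem x l :=
  match goal with
  | _ => let n := zindex x l in constr:(true)
  | _ => constr:(false)
  end.
Ltac zatoms t l :=
  lazymatch t with
  | GRing.add ?a ?b => let l1 := zatoms a l in zatoms b l1
  | GRing.opp ?a => zatoms a l
  | GRing.natmul ?a _ => zatoms a l
  | GRing.zero => l
  | _ => let b := zmem t l in
         lazymatch b with true => l | false => constr:(t :: l) end
  end.
Ltac zreify t l :=
  lazymatch t with
  | GRing.add ?a ?b => let x := zreify a l in let y := zreify b l in constr:(ZAdd x y)
  | GRing.opp ?a => let x := zreify a l in constr:(ZOpp x)
  | GRing.natmul ?a ?n => let x := zreify a l in constr:(ZMuln x n)
  | GRing.zero => constr:(ZZero)
  | _ => let n := zindex t l in constr:(ZVar n)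
  end.
Ltac zmod := cbv beta;
  lazymatch goal with
  | |- @eq ?V ?a ?b =>
    let l := zatoms a (@nil V) in
    let l := zatoms b l in
    let x := zreify a l in let y := zreify b l in
    refine (@zmod_eq _ l x y _); vm_compute; reflexivity
  end.

(** * Functions that are linear *)

(* The operators of the deformation are built as bare functions, by recursions
   in which they are not yet known to be linear; so linearity is a statement
   about functions, with closure properties, and not a bundled structure. *)
Section LinearMaps.
Variables (K : pzRingType) (U V W : lmodType K).
Implicit Types (f g : U -> V).

Lemma linear_D f : linear f -> {morph f : x y / x + y}.
Proof. by move=> h x y; move: (h 1 x y); rewrite !scale1r. Qed.

Lemma linear_0 f : linear f -> f 0 = 0.
Proof. by move=> h; move: (h (-1) 0 0); rewrite scaler0 addr0 scaleN1r addNr. Qed.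

Lemma linear_Z f : linear f -> forall c x, f (c *: x) = c *: f x.
Proof. by move=> h c x; move: (h c x 0); rewrite !addr0 linear_0 // addr0. Qed.

Lemma linear_N f : linear f -> {morph f : x / - x}.
Proof. by move=> h x; rewrite -!scaleN1r linear_Z. Qed.

Lemma linear_B f : linear f -> {morph f : x y / x - y}.
Proof. by move=> h x y; rewrite linear_D // linear_N. Qed.

Lemma linear_big f (I : Type) (s : seq I) (P : pred I) F : linear f ->
  f (\sum_(i <- s | P i) F i) = \sum_(i <- s | P i) f (F i).
Proof.
by move=> h; apply: (big_morph f (linear_D h) (linear_0 h)).
Qed.

Lemma linear_muln f : linear f -> forall n, {morph f : x / x *+ n}.
Proof.
move=> h n x; elim: n => [|n IH]; first by rewrite !mulr0n linear_0.
by rewrite !mulrS linear_D // IH.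
Qed.

Lemma linearDf f g : linear f -> linear g -> linear (fun x => f x + g x).
Proof. by move=> hf hg c x y; rewrite hf hg scalerDr addrACA. Qed.

Lemma linearNf f : linear f -> linear (fun x => - f x).
Proof. by move=> hf c x y; rewrite hf opprD scalerN. Qed.

Lemma linear_sumf (I : Type) (s : seq I) (P : pred I) (F : I -> U -> V) :
  (forall i, linear (F i)) -> linear (fun x => \sum_(i <- s | P i) F i x).
Proof.
move=> h c x y; rewrite scaler_sumr -big_split /=.
by apply: eq_bigr => i _; rewrite h.
Qed.

Lemma linear_compf (h : V -> W) f : linear h -> linear f -> linear (fun x => h (f x)).
Proof. by move=> hh hf c x y; rewrite hf hh. Qed.

Lemma linear_zerof : linear (fun _ : U => 0 : V).
Proof. by move=> c x y; rewrite scaler0 addr0. Qed.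

End LinearMaps.

Lemma linearBf (K : pzRingType) (U V : lmodType K) (f g : U -> V) :
  linear f -> linear g -> linear (fun x => f x - g x).
Proof. by move=> hf hg; apply: linearDf => //; apply: linearNf. Qed.

Lemma linearZf (K : comPzRingType) (U V : lmodType K) (f : U -> V) k :
  linear f -> linear (fun x => k *: f x).
Proof. by move=> hf c x y; rewrite hf scalerDr !scalerA mulrC. Qed.

Lemma linear_row (K : pzRingType) (V : lmodType K) d (f : 'rV[K]_d -> V) x :
  linear f -> f x = \sum_i x 0 i *: f (delta_mx 0 i).
Proof.
move=> h; rewrite {1}(row_sum_delta x) linear_big //.
by apply: eq_bigr => i _; rewrite linear_Z.
Qed.

Lemma linear_mull (K : pzRingType) (A : algType K) (a : A) : linear (fun b => a * b).
Proof. by move=> c x y; rewrite mulrDr scalerAr. Qed.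

Lemma linear_mulr (K : pzRingType) (A : algType K) (a : A) : linear (fun b => b * a).
Proof. by move=> c x y; rewrite mulrDl scalerAl. Qed.

(** * Deformation of a crossed product by lower order terms *)

Section PBW.
Variables (K : numFieldType) (A : algType K) (G : finGroupType) (d : nat).
(* The crossed product is described by what the construction uses: the linear
   forms v x, the group elements t g, the partial derivatives D i, the
   homogeneous components cp n a, and a bound sz a for the degree of a. *)
Variables (r : G -> 'M[K]_d) (v : 'rV[K]_d -> A) (t : G -> A).
Variables (D : 'I_d -> A -> A) (cp : nat -> A -> A) (sz : A -> nat).
Implicit Types (a b : A) (x y z w : 'rV[K]_d) (g h : G) (i j : 'I_d).

Local Notation act g x := (x *m r g).
Local Notation e := (@delta_mx K 1 d 0).

Hypotheses (v_lin : linear v) (vC : forall x y, v x * v y = v y * v x).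
Hypotheses (tM : forall g h, t (g * h)%g = t g * t h) (t1 : t 1%g = 1).
Hypotheses (r1 : r 1%g = 1%:M).
Hypothesis tv : forall g x, t g * v x = v (act g x) * t g.
Hypotheses (D_lin : forall i, linear (D i)).
Hypothesis DC : forall i j a, D i (D j a) = D j (D i a).
Hypothesis Dv : forall i x a, D i (v x * a) = x 0 i *: a + v x * D i a.
Hypothesis Dtr : forall i a g, D i (a * t g) = D i a * t g.
Hypothesis Dtl : forall j g a, D j (t g * a) = \sum_i r g i j *: (t g * D i a).
Hypothesis cp_lin : forall n, linear (cp n).
Hypothesis cp_cp : forall m n a, cp m (cp n a) = if m == n then cp n a else 0.
Hypothesis cp_sum : forall N a, (sz a <= N)%N -> a = \sum_(n < N) cp n a.
Hypothesis cpv : forall n x a, cp n.+1 (v x * a) = v x * cp n a.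
Hypothesis cpv0 : forall x a, cp 0 (v x * a) = 0.
Hypothesis cpD : forall n i a, cp n (D i a) = D i (cp n.+1 a).
Hypothesis cpD0 : forall i a, D i (cp 0 a) = 0.
Hypothesis cptl : forall n g a, cp n (t g * a) = t g * cp n a.
Hypothesis cptr : forall n g a, cp n (a * t g) = cp n a * t g.
Hypothesis euler : forall n a, \sum_i v (e i) * D i (cp n a) = n%:R *: cp n a.

Definition homogeneous n a := cp n a = a.
Local Notation hom := homogeneous.
Definition degree_lt N a := forall n, (N <= n)%N -> cp n a = 0.
Local Notation ldeg := degree_lt.

Lemma hom_cp n a : hom n (cp n a).
Proof. by rewrite /hom cp_cp eqxx. Qed.

Lemma ldeg_sz a : ldeg (sz a) a.
Proof.
move=> n le; rewrite (cp_sum (leqnn (sz a))) linear_big // big1 // => i _.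
by rewrite cp_cp; case: eqP => // e; move: (ltn_ord i); rewrite -e ltnNge le.
Qed.

Lemma ldegW M N a : (M <= N)%N -> ldeg M a -> ldeg N a.
Proof. by move=> le h n le'; apply: h; apply: leq_trans le'. Qed.

Lemma cp_sum_ldeg N a : ldeg N a -> a = \sum_(n < N) cp n a.
Proof.
move=> h; have [le|/ltnW le] := leqP (sz a) N; first exact: cp_sum.
rewrite {1}(cp_sum (leqnn (sz a))) -!(big_mkord xpredT (cp^~ a)).
by rewrite (big_cat_nat (leq0n N) le) /= [X in _ + X]big_nat [X in _ + X]big1 ?addr0 // => i /andP[/h].
Qed.

Lemma ldeg0 a : ldeg 0 a -> a = 0.
Proof. by move/cp_sum_ldeg => ->; rewrite big_ord0. Qed.

Lemma hom_cpE m n a : hom n a -> cp m a = if m == n then a else 0.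
Proof. by move=> h; rewrite -{1}h cp_cp h. Qed.

Lemma hom_ldeg n a : hom n a -> ldeg n.+1 a.
Proof. by move=> h m lt; rewrite (hom_cpE _ h) gtn_eqF. Qed.

Lemma hom0_ldeg a : ldeg 1 a -> hom 0 a.
Proof. by move=> /cp_sum_ldeg; rewrite big_ord1 /hom => <-. Qed.

Lemma ldegD N a b : ldeg N a -> ldeg N b -> ldeg N (a + b).
Proof. by move=> ha hb n le; rewrite linear_D // ha // hb // addr0. Qed.

Lemma ldegZ N c a : ldeg N a -> ldeg N (c *: a).
Proof. by move=> ha n le; rewrite linear_Z // ha // scaler0. Qed.

Lemma ldegN N a : ldeg N a -> ldeg N (- a).
Proof. by move=> ha n le; rewrite linear_N // ha // oppr0. Qed.

Lemma ldeg_zero N : ldeg N 0.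
Proof. by move=> n _; rewrite linear_0. Qed.

Lemma ldeg_big N (I : Type) (s : seq I) (P : pred I) (F : I -> A) :
  (forall k, P k -> ldeg N (F k)) -> ldeg N (\sum_(k <- s | P k) F k).
Proof. by move=> h n le; rewrite linear_big // big1 // => i Pi; rewrite h. Qed.

Lemma ldegv N x a : ldeg N a -> ldeg N.+1 (v x * a).
Proof. by move=> h [//|n] le; rewrite cpv h // mulr0. Qed.

Lemma ldegt N g a : ldeg N a -> ldeg N (t g * a).
Proof. by move=> h n le; rewrite cptl h // mulr0. Qed.

Lemma ldegDi N i a : ldeg N.+1 a -> ldeg N (D i a).
Proof. by move=> h n le; rewrite cpD h // linear_0. Qed.

Lemma homD n i a : hom n.+1 a -> hom n (D i a).
Proof. by rewrite /hom => h; rewrite cpD h. Qed.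

Lemma homD0 i a : hom 0 a -> D i a = 0.
Proof. by rewrite /hom => <-; exact: cpD0. Qed.

Lemma homv n x a : hom n a -> hom n.+1 (v x * a).
Proof. by rewrite /hom cpv => ->. Qed.

Lemma homt n g a : hom n a -> hom n (t g * a).
Proof. by rewrite /hom cptl => ->. Qed.

Lemma homtr n g a : hom n a -> hom n (a * t g).
Proof. by rewrite /hom cptr => ->. Qed.

Lemma ldeg_homD n i a : hom n a -> ldeg n (D i a).
Proof. by move=> h; apply: ldegDi; exact: hom_ldeg. Qed.

Lemma hom_euler n a : hom n a -> \sum_i v (e i) * D i a = n%:R *: a.
Proof. by move=> h; rewrite -{1}h -{2}h; exact: euler. Qed.

(** Induction on the degree: an additive property holds everywhere if, on an
    element homogeneous of degree n, it follows from its truth in degrees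
    smaller than n. *)
Lemma hom_ind (Q : A -> Prop) : Q 0 -> (forall a b, Q a -> Q b -> Q (a + b)) ->
  (forall n a, hom n a -> (forall b, ldeg n b -> Q b) -> Q a) -> forall a, Q a.
Proof.
move=> Q0 QD Qh; suff Q' N a : ldeg N a -> Q a by move=> a; exact: (Q' (sz a) a (@ldeg_sz a)).
elim: N a => [|N IH] a h; first by rewrite (ldeg0 h).
rewrite -(subrK (cp N a) a); apply: QD; last by apply: Qh IH; exact: hom_cp.
apply: IH => n le; rewrite linear_B // cp_cp.
by case: eqP => [->|/eqP ne]; rewrite ?subrr // h ?subr0 // ltn_neqAle eq_sym ne.
Qed.

Lemma hom_lin_ind (f1 f2 : A -> A) : linear f1 -> linear f2 ->
  (forall n a, hom n a -> (forall b, ldeg n b -> f1 b = f2 b) -> f1 a = f2 a) ->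
  forall a, f1 a = f2 a.
Proof.
move=> l1 l2; apply: hom_ind; first by rewrite !linear_0.
by move=> a b; rewrite !linear_D // => -> ->.
Qed.

Lemma scale_natS_inj n a b : n.+1%:R *: a = n.+1%:R *: b -> a = b.
Proof. by apply: scalerI; rewrite pnatr_eq0. Qed.

Variables (pi : G -> 'rV[K]_d -> 'rV[K]_d -> 'rV[K]_d).
Variables (kap : G -> 'rV[K]_d -> 'rV[K]_d -> K^o).
Hypothesis pi_linl : forall g y, linear (fun x => pi g x y).
Hypothesis pi_anti : forall g x y, pi g x y = - pi g y x.
Hypothesis pi_inv : forall g h x y,
  pi (g * h * g^-1)%g (act g x) (act g y) = act g (pi h x y).
Hypothesis kap_linl : forall g y, linear (fun x => kap g x y).
Hypothesis kap_anti : forall g x y, kap g x y = - kap g y x.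
Hypothesis kap_inv : forall g h x y,
  kap (g * h * g^-1)%g (act g x) (act g y) = kap h x y.

Lemma pi_linear_r g x : linear (pi g x).
Proof.
by move=> c y z; rewrite pi_anti pi_linl opprD -scalerN -!(pi_anti g x).
Qed.

Lemma kap_linear_r g x : linear (kap g x).
Proof.
by move=> c y z; rewrite kap_anti kap_linl opprD -scalerN -!(kap_anti g x).
Qed.

(** Operators indexed by the coordinate forms, extended linearly to all forms. *)
Definition lin_ext (f : 'I_d -> A -> A) x a := \sum_i x 0 i *: f i a.
Definition mult_of f x a := v x * a + lin_ext f x a.
Definition comm_of f x y a :=
  \sum_g (mult_of f (pi g x y) (t g * a) + kap g x y *: (t g * a)).

(** Applying the Euler identity n a = sum_i e_i D_i a to the product of a form
    and a suggests the recursion that L_hom states for the lower order part of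
    the multiplication. Its right-hand side evaluates this part in smaller
    degrees only; the parameter N bounds the degrees already treated. *)
Fixpoint lower_upto N (j : 'I_d) (a : A) : A :=
  if N is N'.+1 then
    let c := cp N' a in
    lower_upto N' j a + N'.+1%:R^-1 *:
      \sum_i (mult_of (lower_upto N') (e i) (lower_upto N' j (D i c)) + comm_of (lower_upto N') (e j) (e i) (D i c))
  else 0.

Lemma ext_linl f a : linear (fun x => lin_ext f x a).
Proof.
by apply: linear_sumf => i c x y; rewrite !mxE scalerDl scalerA.
Qed.

Lemma mult_of_linl f a : linear (fun x => mult_of f x a).
Proof.
apply: linearDf (ext_linl _ _).
exact: (linear_compf (linear_mulr a) v_lin).
Qed.

Lemma ext_linr f x : (forall i, linear (f i)) -> linear (lin_ext f x).
Proof. by move=> h; apply: linear_sumf => i; exact: linearZf. Qed.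

Lemma mult_of_linr f x : (forall i, linear (f i)) -> linear (mult_of f x).
Proof. by move=> h; apply: linearDf (ext_linr _ h); exact: linear_mull. Qed.

Lemma comm_of_linr f x y : (forall i, linear (f i)) -> linear (comm_of f x y).
Proof.
move=> h; apply: linear_sumf => g; apply: linearDf.
  by apply: (linear_compf (mult_of_linr _ h)); exact: linear_mull.
by apply: linearZf; exact: linear_mull.
Qed.

Lemma scale_linl (M : lmodType K) (m : M) : linear (fun c : K^o => c *: m).
Proof. by move=> c x y; rewrite scalerDl -scalerA. Qed.

Lemma comm_of_linx f y a : linear (fun x => comm_of f x y a).
Proof.
apply: linear_sumf => g; apply: linearDf.
  exact: (linear_compf (mult_of_linl _ _) (@pi_linl _ _)).
exact: (linear_compf (scale_linl _) (@kap_linl _ _)).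
Qed.

Lemma comm_of_anti f x y a : comm_of f x y a = - comm_of f y x a.
Proof.
rewrite /comm_of -sumrN; apply: eq_bigr => g _.
by rewrite pi_anti kap_anti (linear_N (mult_of_linl _ _)) scaleNr -opprD.
Qed.

Lemma comm_of_liny f x a : linear (fun y => comm_of f x y a).
Proof.
by move=> c y z; rewrite comm_of_anti comm_of_linx opprD -scalerN -!(comm_of_anti f x).
Qed.

Lemma lower_upto_lin N j : linear (lower_upto N j).
Proof.
elim: N j => [|N IH] j; first exact: linear_zerof.
apply: linearDf => //; apply: linearZf; apply: linear_sumf => i.
have lc : linear (fun a => D i (cp N a)) by exact: linear_compf (@D_lin _) (@cp_lin _).
apply: linearDf; last exact: (linear_compf (comm_of_linr _ _ IH) lc).
apply: (linear_compf (mult_of_linr _ IH)); exact: (linear_compf (IH j) lc).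
Qed.

Lemma ext_ldeg f x N a : (forall i, ldeg N (f i a)) -> ldeg N (lin_ext f x a).
Proof. by move=> h; apply: ldeg_big => i _; exact: ldegZ. Qed.

Lemma lower_upto_ldeg N j M a : ldeg M a -> ldeg M (lower_upto N j a).
Proof.
elim: N j M a => [|N IH] j M a h; first exact: ldeg_zero.
apply: ldegD; first exact: IH.
apply: ldegZ; apply: ldeg_big => i _.
have [le|lt] := leqP M N.
  rewrite h // linear_0 // linear_0; last exact: lower_upto_lin.
  rewrite linear_0; last by apply: mult_of_linr; exact: lower_upto_lin.
  rewrite linear_0; last by apply: comm_of_linr; exact: lower_upto_lin.
  by rewrite addr0; exact: ldeg_zero.
have Xd x b : ldeg N b -> ldeg N.+1 (mult_of (lower_upto N) x b).
  move=> hb; apply: ldegD; first exact: ldegv.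
  by apply: ldeg_big => k _; apply: ldegZ; apply: IH; apply: ldegW hb.
have hc : ldeg N (D i (cp N a)) by apply: ldeg_homD; exact: hom_cp.
apply: (ldegW lt); apply: ldegD; first by apply: Xd; exact: IH.
apply: ldeg_big => g _; apply: ldegD; first by apply: Xd; exact: ldegt.
by apply: ldegZ; apply: ldegt; apply: ldegW hc.
Qed.

Lemma lower_upto_stable M N j a : ldeg M a -> (M <= N)%N -> lower_upto N j a = lower_upto M j a.
Proof.
move=> h /subnK <-; elim: (N - M)%N => [//|k IH].
rewrite addSn [LHS]/= IH h ?leq_addl // big1 ?scaler0 ?addr0 // => i _.
rewrite (linear_0 (@D_lin i)) (linear_0 (@lower_upto_lin _ _)).
rewrite (linear_0 (mult_of_linr _ (@lower_upto_lin _))) (linear_0 (comm_of_linr _ _ (@lower_upto_lin _))).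
by rewrite addr0.
Qed.

Lemma lower_upto_hom0 n j a : (forall m, (m < n)%N -> cp m a = 0) -> lower_upto n j a = 0.
Proof.
elim: n => [//|n IH] h; rewrite /= IH; last by move=> m lt; apply: h; exact: ltnW.
rewrite h // big1 ?scaler0 ?addr0 // => i _.
rewrite (linear_0 (@D_lin i)) (linear_0 (@lower_upto_lin _ _)).
rewrite (linear_0 (mult_of_linr _ (@lower_upto_lin _))) (linear_0 (comm_of_linr _ _ (@lower_upto_lin _))).
by rewrite addr0.
Qed.

Definition lower j a := lower_upto (sz a) j a.
Definition lower_op x a := lin_ext lower x a.
Local Notation L := lower_op.
Fact op_key : unit. Proof. by []. Qed.
(** Left multiplication by x in the deformed algebra. It is locked because
    rewriting would otherwise see through it in every linearity lemma. *)
Definition mult_op x a := locked_with op_key (v x * a + L x a).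
Local Notation X := mult_op.
(** The operator that the commutator of X x and X y has to be. *)
Definition comm_op x y a := \sum_g (X (pi g x y) (t g * a) + kap g x y *: (t g * a)).
Local Notation R := comm_op.

Lemma XE x a : X x a = v x * a + L x a.
Proof. exact: unlock. Qed.

Lemma loE N j a : ldeg N a -> lower j a = lower_upto N j a.
Proof.
move=> h; have [le|/ltnW le] := leqP N (sz a); first exact: lower_upto_stable.
by rewrite (lower_upto_stable _ (@ldeg_sz a) le).
Qed.

Lemma lo_lin j : linear (lower j).
Proof.
move=> c a b; set N := maxn (sz a) (sz b).
have ha : ldeg N a by apply: ldegW (@ldeg_sz a); rewrite leq_maxl.
have hb : ldeg N b by apply: ldegW (@ldeg_sz b); rewrite leq_maxr.
rewrite (loE _ ha) (loE _ hb) (@loE N) ?lower_upto_lin //.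
by apply: ldegD => //; exact: ldegZ.
Qed.

Lemma L_lin x : linear (L x). Proof. exact: ext_linr lo_lin. Qed.
Lemma X_linl a : linear (X^~ a).
Proof. by move=> c x y; rewrite !XE; exact: (mult_of_linl lower a). Qed.
Lemma X_lin x : linear (X x).
Proof. by move=> c a b; rewrite !XE; exact: (mult_of_linr x lo_lin). Qed.

Lemma RE x y a : R x y a = comm_of lower x y a.
Proof. by apply: eq_bigr => g _; rewrite XE. Qed.

Lemma R_lin x y : linear (R x y).
Proof. by move=> c a b; rewrite !RE; exact: (comm_of_linr x y lo_lin). Qed.
Lemma R_linx y a : linear (fun x => R x y a).
Proof. by move=> c x z; rewrite !RE; exact: (comm_of_linx lower y a). Qed.
Lemma R_liny x a : linear (fun y => R x y a).
Proof. by move=> c y z; rewrite !RE; exact: (comm_of_liny lower x a). Qed.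
Lemma R_anti x y a : R x y a = - R y x a.
Proof. by rewrite !RE; exact: comm_of_anti. Qed.

Lemma L_ldeg x N a : ldeg N a -> ldeg N (L x a).
Proof. by move=> h; apply: ext_ldeg => i; exact: lower_upto_ldeg. Qed.

Lemma X_ldeg x N a : ldeg N a -> ldeg N.+1 (X x a).
Proof.
move=> h; rewrite XE; apply: ldegD; first exact: ldegv.
by apply: (@ldegW N) => //; exact: L_ldeg.
Qed.

Lemma L_hom n x a : hom n a ->
  n.+1%:R *: L x a = \sum_i (X (e i) (L x (D i a)) + R x (e i) (D i a)).
Proof.
move=> h.
have loh j : n.+1%:R *: lower j a =
    \sum_i (X (e i) (lower j (D i a)) + R (e j) (e i) (D i a)).
  rewrite (loE _ (hom_ldeg h)) /= h lower_upto_hom0; last first.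
    by move=> m lt; rewrite (hom_cpE _ h) ltn_eqF.
  rewrite add0r scalerA divff ?pnatr_eq0 // scale1r; apply: eq_bigr => i _.
  have XE x' b : ldeg n b -> mult_of (lower_upto n) x' b = X x' b.
    move=> hb; rewrite XE; congr (_ + _); apply: eq_bigr => k _.
    by rewrite (loE _ hb).
  have hD := ldeg_homD i h.
  rewrite XE; last exact: lower_upto_ldeg.
  rewrite -(loE _ hD); congr (_ + _); apply: eq_bigr => g _.
  by rewrite XE //; exact: ldegt.
rewrite {1}/L /lin_ext scaler_sumr.
under eq_bigr => j _ do rewrite scalerA mulrC -scalerA loh scaler_sumr.
rewrite exchange_big /=; apply: eq_bigr => i _.
under eq_bigr => j _ do rewrite scalerDr.
rewrite big_split /=; congr (_ + _).
  rewrite (linear_big _ _ _ (X_lin _)); apply: eq_bigr => j _.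
  by rewrite (linear_Z (X_lin _)).
by rewrite [RHS](linear_row _ (R_linx _ _)).
Qed.

Lemma X_hom0 x a : hom 0 a -> X x a = v x * a.
Proof.
move=> h; rewrite XE; suff -> : L x a = 0 by rewrite addr0.
apply: (@scale_natS_inj 0); rewrite L_hom // scaler0 big1 // => i _.
by rewrite homD0 // (linear_0 (L_lin x)) (linear_0 (X_lin _)) (linear_0 (R_lin _ _)) addr0.
Qed.

Lemma sum_anti_sym (F : 'I_d -> 'I_d -> A) :
  (forall i j, F i j = - F j i) -> \sum_i \sum_j F i j = 0.
Proof.
move=> h; set S := \sum_i _; apply: (@scale_natS_inj 1); rewrite scaler0 scaler_nat mulr2n.
have {2}-> : S = - S; last by rewrite subrr.
rewrite {2}/S exchange_big -sumrN; apply: eq_bigr => i _.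
by rewrite -sumrN; apply: eq_bigr => j _.
Qed.

(** Among the possible lower order parts, the chosen one is symmetric: the
    Euler identity stays true for the deformed multiplication (sum_X_D). By
    L_hom and induction, what remains is the sum of an antisymmetric
    expression in i, j against the symmetric D_i D_j. *)
Lemma gauge a : \sum_j L (e j) (D j a) = 0.
Proof.
move: a; apply: hom_lin_ind.
- by apply: linear_sumf => j; exact: (linear_compf (L_lin _) (@D_lin _)).
- exact: linear_zerof.
case=> [|n] a h IH.
  by rewrite big1 // => j _; rewrite homD0 // linear_0 //; exact: L_lin.
apply: (@scale_natS_inj n); rewrite scaler0 scaler_sumr.
under eq_bigr => j _ do rewrite (L_hom _ (homD j h)) big_split /=.
rewrite big_split /= exchange_big /= big1 ?add0r; last first.
  move=> i _; rewrite -linear_big; last exact: X_lin.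
  under eq_bigr => j _ do rewrite DC.
  by rewrite IH ?linear_0 //; [exact: X_lin | exact: ldeg_homD].
by apply: sum_anti_sym => i j; rewrite R_anti DC.
Qed.

Lemma sum_X_D n a : hom n a -> \sum_i X (e i) (D i a) = n%:R *: a.
Proof.
move=> h; rewrite -(hom_euler h) -[RHS]addr0 -[X in _ = _ + X](gauge a) -big_split /=.
by apply: eq_bigr => i _; rewrite XE.
Qed.

Definition defect x y a := locked_with op_key (X x (X y a) - X y (X x a) - R x y a).
Local Notation C := defect.

Lemma CE x y a : C x y a = X x (X y a) - X y (X x a) - R x y a.
Proof. exact: unlock. Qed.

Lemma C_lin x y : linear (C x y).
Proof.
move=> c a b; rewrite !CE; move: c a b.
apply: linearBf (R_lin _ _); apply: linearBf; apply: linear_compf; exact: X_lin.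
Qed.

Lemma C_anti x y a : C x y a = - C y x a.
Proof. by rewrite !CE R_anti; zmod. Qed.

Lemma C_linx y a : linear (fun x => C x y a).
Proof.
move=> c x z; rewrite !CE; move: c x z.
apply: linearBf (R_linx _ _); apply: linearBf; first exact: X_linl.
apply: linear_compf; [exact: X_lin | exact: X_linl].
Qed.

Lemma C_liny x a : linear (fun y => C x y a).
Proof.
by move=> c y z; rewrite C_anti C_linx opprD -scalerN -!(C_anti x).
Qed.

(** This is the recursion defining L_x, read backwards. *)
Lemma sum_C_D x a : \sum_i C x (e i) (D i a) = 0.
Proof.
move: a; apply: hom_lin_ind.
- by apply: linear_sumf => j; exact: (linear_compf (C_lin _ _) (@D_lin _)).
- exact: linear_zerof.
move=> n a h _.
have e1 : \sum_i X x (X (e i) (D i a)) = n%:R *: X x a.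
  by rewrite -linear_big ?(sum_X_D h) ?(linear_Z (X_lin _)) //; exact: X_lin.
have e2 : \sum_i X (e i) (v x * D i a) = n.+1%:R *: (v x * a) - X x a.
  rewrite -(sum_X_D (homv x h)) [X in _ - X](linear_row _ (X_linl _)) -sumrB.
  by apply: eq_bigr => i _; rewrite Dv (linear_D (X_lin _)) (linear_Z (X_lin _)); zmod.
have := L_hom x h; rewrite big_split /= => e3.
under eq_bigr => i _ do rewrite CE.
rewrite !sumrB e1.
under eq_bigr => i _ do rewrite (XE x (D i a)) (linear_D (X_lin _)).
rewrite big_split /= e2 XE scalerDr.
have -> : \sum_i R x (e i) (D i a) = n.+1%:R *: L x a - \sum_i X (e i) (L x (D i a)).
  by rewrite e3; zmod.
by rewrite -!natr1 !scalerDl !scale1r; zmod.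
Qed.

Hypothesis t_indep : forall c : G -> K, \sum_g c g *: t g = 0 -> forall g, c g = 0.
Hypothesis hom_one : hom 0 1.

Lemma act_e g i : act g (e i) = \sum_j r g i j *: e j.
Proof. by rewrite -rowE [LHS]row_sum_delta; apply: eq_bigr => j _; rewrite mxE. Qed.

(** Sums over dual bases are invariant under the group. *)
Lemma sum_equiv (F : 'rV[K]_d -> A -> A) g a :
  (forall b, linear (F^~ b)) -> (forall x, linear (F x)) ->
  \sum_i F (act g (e i)) (t g * D i a) = \sum_j F (e j) (D j (t g * a)).
Proof.
move=> l1 l2.
under eq_bigr => i _ do rewrite act_e (linear_big _ _ _ (l1 _)).
rewrite exchange_big /=; apply: eq_bigr => j _.
rewrite Dtl (linear_big _ _ _ (l2 _)); apply: eq_bigr => i _.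
by rewrite (linear_Z (l1 _)) (linear_Z (l2 _)).
Qed.

Lemma reindex_conj (F : G -> A) g : \sum_h F h = \sum_h F (g * h * g^-1)%g.
Proof. by apply: reindex_inj => h k /mulIg /mulgI. Qed.

Lemma tR g x y a :
  (forall h z, t g * X z (t h * a) = X (act g z) (t g * (t h * a))) ->
  t g * R x y a = R (act g x) (act g y) (t g * a).
Proof.
move=> tX; rewrite /R [RHS](reindex_conj _ g) mulr_sumr; apply: eq_bigr => h _.
rewrite mulrDr tX -scalerAr pi_inv kap_inv.
by rewrite !mulrA -!tM -!mulgA mulVg mulg1.
Qed.

(** By induction on the degree, since pi and kappa are invariant. *)
Lemma tL g x a : t g * L x a = L (act g x) (t g * a).
Proof.
move: a g x; apply: hom_ind => [g x|a b IHa IHb g x|n a h IH g x].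
- by rewrite mulr0 !(linear_0 (L_lin _)) mulr0.
- by rewrite mulrDr !(linear_D (L_lin _)) mulrDr IHa IHb.
have IHX b z : ldeg n b -> t g * X z b = X (act g z) (t g * b).
  by move=> hb; rewrite !XE mulrDr IH // mulrA tv -mulrA.
apply: (@scale_natS_inj n); rewrite scalerAr (L_hom _ h) (L_hom _ (homt g h)).
rewrite -(@sum_equiv (fun y b => X y (L (act g x) b) + R (act g x) y b)); last 2 first.
- by move=> b; apply: linearDf (R_liny _ _); exact: X_linl.
- move=> y; apply: linearDf (R_lin _ _).
  by apply: linear_compf; [exact: X_lin | exact: L_lin].
rewrite mulr_sumr; apply: eq_bigr => i _; rewrite mulrDr.
have hD := ldeg_homD i h.
rewrite IHX ?IH //; last exact: L_ldeg.
by rewrite tR // => k z; apply: IHX; exact: ldegt.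
Qed.

Lemma tX g x a : t g * X x a = X (act g x) (t g * a).
Proof. by rewrite !XE mulrDr tL mulrA tv -mulrA. Qed.

Lemma Rtr_of x y a g : (forall h z, X z (t h * a) * t g = X z (t h * a * t g)) ->
  R x y a * t g = R x y (a * t g).
Proof.
move=> Xt; rewrite /R mulr_suml; apply: eq_bigr => h _.
by rewrite mulrDl Xt -scalerAl !mulrA.
Qed.

Lemma Ltr x a g : L x a * t g = L x (a * t g).
Proof.
move: a x; apply: hom_ind => [x|a b IHa IHb x|n a h IH x].
- by rewrite mul0r !(linear_0 (L_lin _)) mul0r.
- by rewrite mulrDl !(linear_D (L_lin _)) mulrDl IHa IHb.
have IHX b z : ldeg n b -> X z b * t g = X z (b * t g).
  by move=> hb; rewrite !XE mulrDl IH // -mulrA.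
apply: (@scale_natS_inj n); rewrite scalerAl (L_hom _ h) (L_hom _ (homtr g h)).
rewrite mulr_suml; apply: eq_bigr => i _; rewrite mulrDl.
have hD := ldeg_homD i h.
rewrite Dtr IHX ?IH //; last exact: L_ldeg.
by rewrite Rtr_of // => k z; apply: IHX; exact: ldegt.
Qed.

Lemma Xtr x a g : X x a * t g = X x (a * t g).
Proof. by rewrite !XE mulrDl Ltr -mulrA. Qed.

Definition linear_bracket g x y z := \sum_(a : G) \sum_(b : G | (a * b)%g == g)
  (pi a (pi b x y) (z + act b z) + pi a (pi b y z) (x + act b x)
   + pi a (pi b z x) (y + act b y)).
(** The constant part of the Jacobi identity, the linear part being
    linear_bracket. *)
Definition const_bracket g x y z : K^o := \sum_(a : G) \sum_(b : G | (a * b)%g == g)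
  (kap a (pi b x y) (z + act b z) + kap a (pi b y z) (x + act b x)
   + kap a (pi b z x) (y + act b y)).

Hypothesis Hquad : forall g, g != 1%g -> exists om : 'rV[K]_d -> 'rV[K]_d -> K,
  exists lam, (forall x y, pi g x y = om x y *: lam) /\
    forall x y z, om y z *: (act g x - x) + om z x *: (act g y - y)
                  + om x y *: (act g z - z) = 0.
Hypothesis Hjac : forall g x y z, linear_bracket g x y z =
  (kap g y z *: (x - act g x) + kap g z x *: (y - act g y)
   + kap g x y *: (z - act g z)) *+ 2.

(** The part of the commutator of X x with pi_g(y, z) g that contains two
    operators X. Its cyclic sum vanishes by the quadratic condition. *)
Definition quad g x y z b :=
  X (pi g y z) (X (act g x - x) b) + X (act g x - x) (X (pi g y z) b).

Lemma quad0 g x y z b : quad g x y z b + quad g y z x b + quad g z x y b = 0.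
Proof.
have [->|/Hquad[om [lam [piE om0]]]] := eqVneq g 1%g.
  rewrite /quad r1 !mulmx1 !subrr !(linear_0 (X_linl _)) !(linear_0 (X_lin _)).
  by rewrite !addr0.
have qE x' y' z' : quad g x' y' z' b =
    X lam (X (om y' z' *: (act g x' - x')) b) + X (om y' z' *: (act g x' - x')) (X lam b).
  rewrite /quad piE !(linear_Z (X_linl _)) /= !(linear_Z (X_lin _)) //.
have := om0 x y z; set u1 := om y z *: _; set u2 := om z x *: _; set u3 := om x y *: _.
move=> s0; transitivity (X lam (X (u1 + u2 + u3) b) + X (u1 + u2 + u3) (X lam b)).
  by rewrite !qE !(linear_D (X_linl _)) !(linear_D (X_lin _)); zmod.
by rewrite s0 !(linear_0 (X_linl _)) (linear_0 (X_lin _)) addr0.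
Qed.

Definition jacobiator x y z a := X x (C y z a) - C y z (X x a) + X y (C z x a)
  - C z x (X y a) + X z (C x y a) - C x y (X z a).

Definition comR x y z a := X x (R y z a) - R y z (X x a).

Lemma jac_comR x y z a : jacobiator x y z a = - (comR x y z a + comR y z x a + comR z x y a).
Proof. by rewrite /jacobiator /comR !CE !(linear_B (X_lin _)); zmod. Qed.

(** Moving g across X x turns the commutator into X x X l - X l X (g x) with l
    = pi_g(y, z). If x and g x are written as half their sum plus or minus
    half their difference, the sum contributes the commutator of X (x + g x)
    and X l, that is a defect and a bracket R, and the difference an
    anticommutator. The doubling avoids the halves. *)
Lemma comRE x y z a : comR x y z a *+ 2 = \sum_g
  (X (x - act g x) (kap g y z *: (t g * a)) *+ 2 - quad g x y z (t g * a)
   - C (pi g y z) (x + act g x) (t g * a) - R (pi g y z) (x + act g x) (t g * a)).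
Proof.
rewrite /comR {1 2}/R (linear_big _ _ _ (X_lin _)) -sumrB -sumrMnl.
apply: eq_bigr => g _; rewrite tX; set b := t g * a; set lam := pi g y z.
rewrite /quad CE -/lam.
rewrite !(linear_D (X_linl _)) !(linear_N (X_linl _)) !(linear_D (X_lin _)).
by rewrite !(linear_N (X_lin _)) !(linear_Z (X_lin _)); zmod.
Qed.

Lemma regroup (V : nmodType) (F : G -> G -> G -> V) :
  \sum_b \sum_a F a b (a * b)%g = \sum_g \sum_a \sum_(b | (a * b)%g == g) F a b g.
Proof.
rewrite exchange_big [RHS]exchange_big /=; apply: eq_bigr => a _.
rewrite (exchange_big_dep xpredT) //=; apply: eq_bigr => b _.
by rewrite (big_pred1 (a * b)%g) // => g; rewrite eq_sym.
Qed.

Lemma sumR x y z a :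
  \sum_g (R (pi g y z) (x + act g x) (t g * a) + R (pi g z x) (y + act g y) (t g * a)
   + R (pi g x y) (z + act g z) (t g * a)) =
  \sum_g (X (linear_bracket g x y z) (t g * a) + const_bracket g x y z *: (t g * a)).
Proof.
transitivity (\sum_b \sum_c (X (pi c (pi b x y) (z + act b z)
   + pi c (pi b y z) (x + act b x) + pi c (pi b z x) (y + act b y)) (t (c * b)%g * a) +
   (kap c (pi b x y) (z + act b z)
   + kap c (pi b y z) (x + act b x) + kap c (pi b z x) (y + act b y)) *: (t (c * b)%g * a))).
  apply: eq_bigr => b _; rewrite /R -!big_split; apply: eq_bigr => c _ /=.
  by rewrite !(linear_D (X_linl _)) !scalerDl tM -mulrA; zmod.
rewrite (regroup (fun (c b : G) (g : G) => X (pi c (pi b x y) (z + act b z)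
   + pi c (pi b y z) (x + act b x) + pi c (pi b z x) (y + act b y)) (t g * a) +
   (kap c (pi b x y) (z + act b z)
   + kap c (pi b y z) (x + act b x) + kap c (pi b z x) (y + act b y)) *: (t g * a))).
apply: eq_bigr => g _; rewrite /linear_bracket /const_bracket (linear_big _ _ _ (X_linl _)) scaler_suml -big_split.
apply: eq_bigr => c _ /=.
rewrite (linear_big _ _ _ (X_linl _)) scaler_suml -big_split.
by apply: eq_bigr.
Qed.

(** Jacobi identity. The operators X satisfy it, so the defects C have to
    compensate for the brackets of R; by the quadratic and the linear
    conditions, all that is left of these brackets is again made of defects,
    plus the constants. *)
Lemma jacE x y z a : jacobiator x y z a *+ 2 =
  \sum_g (C (pi g y z) (x + act g x) (t g * a) + C (pi g z x) (y + act g y) (t g * a)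
   + C (pi g x y) (z + act g z) (t g * a) + const_bracket g x y z *: (t g * a)).
Proof.
transitivity (- (comR x y z a *+ 2 + comR y z x a *+ 2 + comR z x y a *+ 2)).
  by rewrite jac_comR; zmod.
rewrite !comRE.
set S := RHS.
have -> : S = S + (\sum_g (R (pi g y z) (x + act g x) (t g * a)
    + R (pi g z x) (y + act g y) (t g * a) + R (pi g x y) (z + act g z) (t g * a)) -
    \sum_g (X (linear_bracket g x y z) (t g * a) + const_bracket g x y z *: (t g * a))).
  by rewrite sumR subrr addr0.
rewrite {}/S -sumrB -!big_split -sumrN /=; apply: eq_bigr => g _.
set b := t g * a.
have /eqP q0 := quad0 g x y z b.
move: q0; rewrite addr_eq0 => /eqP q0.
have -> : quad g z x y b = - (quad g x y z b + quad g y z x b) by rewrite q0 opprK; zmod.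
rewrite Hjac (linear_muln (X_linl _)) !(linear_D (X_linl _)) !(linear_Z (X_linl _)) /=.
by rewrite !(linear_Z (X_lin _)) !(linear_D (X_linl _)) !scalerDr; zmod.
Qed.

(** The Jacobi identity in x, y, e_i, contracted with D_i: by sum_C_D and the
    Euler identities, C x y a occurs n + 2 times in the contraction, and the
    other terms evaluate C in degrees smaller than n. *)
Lemma sum_jac_D n x y a : hom n a -> (n + 2)%:R *: C x y a =
  \sum_i (X (e i) (C x y (D i a)) - C y (e i) (L x (D i a)) - C (e i) x (L y (D i a)))
  - \sum_i jacobiator x y (e i) (D i a).
Proof.
move=> h.
have s1 : \sum_i X x (C y (e i) (D i a)) = 0.
  by rewrite -linear_big ?sum_C_D ?(linear_0 (X_lin _)) //; exact: X_lin.
have s2 z w : \sum_i C z (e i) (v w * D i a) = - C z w a.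
  rewrite -[RHS]add0r -[X in _ = X + _](sum_C_D z (v w * a)) [X in _ - X](linear_row _ (C_liny _ _)) -sumrB.
  apply: eq_bigr => i _.
  by rewrite Dv (linear_D (C_lin _ _)) (linear_Z (C_lin _ _)); zmod.
have s3 : \sum_i X y (C (e i) x (D i a)) = 0.
  rewrite -linear_big; last exact: X_lin.
  under eq_bigr => i _ do rewrite C_anti.
  by rewrite sumrN sum_C_D oppr0 (linear_0 (X_lin _)).
have s4 : \sum_i C (e i) x (v y * D i a) = C x y a.
  under eq_bigr => i _ do rewrite C_anti.
  by rewrite sumrN s2 opprK.
have s5 : \sum_i C x y (X (e i) (D i a)) = n%:R *: C x y a.
  by rewrite -linear_big ?(sum_X_D h) ?(linear_Z (C_lin _ _)) //; exact: C_lin.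
have s2' := s2 y x; rewrite -C_anti in s2'.
have -> : \sum_i jacobiator x y (e i) (D i a) =
    \sum_i X x (C y (e i) (D i a))
    - (\sum_i C y (e i) (v x * D i a) + \sum_i C y (e i) (L x (D i a)))
    + \sum_i X y (C (e i) x (D i a))
    - (\sum_i C (e i) x (v y * D i a) + \sum_i C (e i) x (L y (D i a)))
    + (\sum_i X (e i) (C x y (D i a)) - \sum_i C x y (X (e i) (D i a))).
  rewrite -!big_split -!sumrB -!big_split -!sumrB -!big_split /=; apply: eq_bigr => i _.
  by rewrite /jacobiator (XE x (D i a)) (XE y (D i a)) !(linear_D (C_lin _ _)); zmod.
rewrite s1 s2' s3 s4 s5 !sumrB natrD scalerDl (scaler_nat 2); zmod.
Qed.

(* If g - 1 has large rank, the vanishing of the constants for g is a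
   consequence of the other conditions. It is proved below by evaluating the
   Jacobi identity in degree one, before the defect is known to vanish. *)
Hypothesis const_bracket0_or_rank : forall g,
  (forall x y z, const_bracket g x y z = 0) \/ (3 < \rank (r g - 1%:M)%R)%N.

Lemma C_hom0 x y a : hom 0 a -> C x y a = 0.
Proof.
move=> h; apply: (@scale_natS_inj 1); rewrite scaler0 (sum_jac_D x y h).
have D0 i : D i a = 0 by exact: homD0.
rewrite !big1 ?subrr // => i _.
  by rewrite /jacobiator D0 !(linear_0 (X_lin _), linear_0 (C_lin _ _)) !addr0 !subr0.
by rewrite D0 !(linear_0 (L_lin _), linear_0 (C_lin _ _), linear_0 (X_lin _)) !subr0.
Qed.

Lemma C_ldeg1 x y a : ldeg 1 a -> C x y a = 0.
Proof. by move/hom0_ldeg; exact: C_hom0. Qed.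

Lemma jac_hom0 x y z a : hom 0 a ->
  jacobiator x y z a *+ 2 = \sum_g const_bracket g x y z *: (t g * a).
Proof.
move=> h; rewrite jacE; apply: eq_bigr => g _.
by rewrite !C_hom0 ?add0r //; exact: homt.
Qed.

(** In degree one the contraction sum_jac_D only sees the constants. *)
Lemma C_hom1 x y a : hom 1 a ->
  C x y a *+ 6 = - \sum_i \sum_g const_bracket g x y (e i) *: (t g * D i a).
Proof.
move=> h; have hD i : hom 0 (D i a) by exact: homD.
have hl i z : ldeg 1 (L z (D i a)) by apply: L_ldeg; exact: hom_ldeg.
have := sum_jac_D x y h; rewrite big1 ?sub0r => [e3|i _]; last first.
  by rewrite (C_hom0 _ _ (hD i)) !C_ldeg1 ?(linear_0 (X_lin _)) ?subr0.
rewrite (mulrnA _ (1 + 2) 2) -(scaler_nat (1 + 2)) e3 mulNrn -sumrMnl; congr (- _).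
by apply: eq_bigr => i _; exact: jac_hom0.
Qed.

Lemma C_ldeg2 x y a : ldeg 2 a -> ldeg 1 (C x y a).
Proof.
move=> /cp_sum_ldeg ->; rewrite big_ord_recl big_ord1 (linear_D (C_lin _ _)).
rewrite C_hom0 ?add0r; last exact: hom_cp.
have hc : hom 1 (cp (bump 0 0) a) by exact: hom_cp.
have -> : C x y (cp (bump 0 0) a) = 6%:R^-1 *: (C x y (cp (bump 0 0) a) *+ 6).
  by rewrite -[in RHS]scaler_nat scalerA mulVf ?pnatr_eq0 // scale1r.
rewrite C_hom1 //; apply: ldegZ; apply: ldegN; apply: ldeg_big => i _.
apply: ldeg_big => g _; apply: ldegZ; apply: hom_ldeg; apply: homt; exact: homD.
Qed.

Lemma const_bracket_cyc g x y z : const_bracket g x y z = const_bracket g y z x.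
Proof. by apply: eq_bigr => a _; apply: eq_bigr => b _; zmod. Qed.

Lemma const_bracket_anti g x y z : const_bracket g x y z = - const_bracket g y x z.
Proof.
rewrite -sumrN; apply: eq_bigr => a _; rewrite -sumrN; apply: eq_bigr => b _.
rewrite (pi_anti b x y) (pi_anti b y z) (pi_anti b z x).
by rewrite !(linear_N (kap_linl _ _)); zmod.
Qed.

Lemma const_bracket_linr g x y : linear (const_bracket g x y).
Proof.
apply: linear_sumf => a; apply: linear_sumf => b.
have l1 : linear (fun z => z + act b z).
  by move=> c u w; rewrite mulmxDl -scalemxAl scalerDr addrACA.
apply: linearDf; first apply: linearDf.
- exact: (linear_compf (@kap_linear_r _ _) l1).
- exact: (linear_compf (@kap_linl _ _) (@pi_linear_r _ _)).
- exact: (linear_compf (@kap_linl _ _) (@pi_linl _ _)).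
Qed.

Definition bracket_sum x y z : A := \sum_g const_bracket g x y z *: t g.

Lemma bracket_sum_cyc x y z : bracket_sum x y z = bracket_sum y z x.
Proof. by apply: eq_bigr => g _; rewrite const_bracket_cyc. Qed.

Lemma bracket_sum_anti x y z : bracket_sum x y z = - bracket_sum y x z.
Proof. by rewrite -sumrN; apply: eq_bigr => g _; rewrite const_bracket_anti scaleNr. Qed.

Lemma D_hom_t i g : D i (t g) = 0.
Proof. by rewrite -[t g]mulr1; apply: homD0; exact: homt. Qed.

Lemma D_vt j w g : D j (v w * t g) = w 0 j *: t g.
Proof. by rewrite Dv D_hom_t mulr0 addr0. Qed.

Lemma C_vw x y w : C x y (v w) *+ 6 = - bracket_sum x y w.
Proof.
have hw : hom 1 (v w) by rewrite -[v w]mulr1; exact: homv.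
rewrite C_hom1 //; congr (- _); rewrite exchange_big; apply: eq_bigr => g _ /=.
rewrite [const_bracket g x y w](linear_row _ (const_bracket_linr _ _ _)) scaler_suml.
apply: eq_bigr => i _; rewrite -[v w]mulr1 -t1 D_vt t1 -scalerAr mulr1 scalerA.
by rewrite mulrC.
Qed.

Definition D_defect2 j y z x w := D j (C y z (v x * v w)).

(** Derivative of the Jacobi identity at the form w. Besides the constants it
    contains the unknowns D_j C(v x v w), which are symmetric in x, w; they
    disappear from alternating sums. *)
Lemma jac_vw j x y z w :
  - (x 0 j *: bracket_sum y z w + y 0 j *: bracket_sum z x w + z 0 j *: bracket_sum x y w)
  - (D_defect2 j y z x w + D_defect2 j z x y w + D_defect2 j x y z w) *+ 6 =
  (\sum_g (const_bracket g x y z * (act g w) 0 j) *: t g) *+ 3.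
Proof.
have hw : hom 1 (v w) by rewrite -[v w]mulr1; exact: homv.
have lw : ldeg 2 (v w) by exact: hom_ldeg.
have l1 x' y' : ldeg 1 (C x' y' (v w)) by exact: C_ldeg2.
have DX x' y' z' : D j (X x' (C y' z' (v w))) = x' 0 j *: C y' z' (v w).
  by rewrite X_hom0 ?Dv ?homD0 ?mulr0 ?addr0 //; exact: hom0_ldeg.
have DC' x' y' z' : D j (C y' z' (X x' (v w))) = D_defect2 j y' z' x' w.
  rewrite XE (linear_D (C_lin _ _)) (linear_D (@D_lin _)) [X in _ + X]homD0 ?addr0 //.
  by apply: hom0_ldeg; apply: C_ldeg2; exact: L_ldeg.
have /(congr1 (D j)) := jacE x y z (v w).
rewrite (linear_muln (@D_lin _)) /jacobiator.
rewrite !(linear_D (@D_lin _)) !(linear_N (@D_lin _)).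
rewrite !DX !DC' => eJ.
have -> : \sum_g (const_bracket g x y z * (act g w) 0 j) *: t g =
   (x 0 j *: C y z (v w) - D_defect2 j y z x w + y 0 j *: C z x (v w) - D_defect2 j z x y w
   + z 0 j *: C x y (v w) - D_defect2 j x y z w) *+ 2.
  rewrite eJ (linear_big _ _ _ (@D_lin _)); apply: eq_bigr => g _.
  rewrite !(linear_D (@D_lin _)) (linear_Z (@D_lin _)).
  have D0 x' y' : D j (C x' y' (t g * v w)) = 0.
    by apply: homD0; apply: hom0_ldeg; apply: C_ldeg2; exact: ldegt.
  by rewrite !D0 !add0r tv D_vt scalerA.
have kE x' y' z' : bracket_sum x' y' z' = - (C x' y' (v z') *+ 6) by rewrite C_vw opprK.
rewrite !kE.
have sM (c : K) (a : A) n : c *: (a *+ n) = (c *: a) *+ n by rewrite -!scaler_nat !scalerA mulrC.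
by rewrite !scalerN !sM; zmod.
Qed.

(** Alternating jac_vw over the four forms eliminates the unknowns, and the
    elements t g are linearly independent. *)
Lemma const_bracket_cocycle g x y z w :
  const_bracket g x y z *: (act g w - w) - const_bracket g y z w *: (act g x - x)
  + const_bracket g z w x *: (act g y - y) - const_bracket g w x y *: (act g z - z) = 0.
Proof.
apply/rowP => j; rewrite [RHS]mxE.
pose c g : K := const_bracket g x y z * ((act g w) 0 j - w 0 j) - const_bracket g y z w * ((act g x) 0 j - x 0 j)
  + const_bracket g z w x * ((act g y) 0 j - y 0 j) - const_bracket g w x y * ((act g z) 0 j - z 0 j).
have c0 : \sum_g c g *: t g = 0.
  apply: (@scale_natS_inj 2); rewrite scaler0 scaler_nat.
  pose s x y z w := \sum_g (const_bracket g x y z * (act g w) 0 j) *: t g.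
  have -> : \sum_g c g *: t g = s x y z w - s y z w x + s z w x y - s w x y z
     - (w 0 j *: bracket_sum x y z - x 0 j *: bracket_sum y z w + y 0 j *: bracket_sum z w x - z 0 j *: bracket_sum w x y).
    have pt h : c h *: t h =
        (const_bracket h x y z * (act h w) 0 j) *: t h - (const_bracket h y z w * (act h x) 0 j) *: t h
        + (const_bracket h z w x * (act h y) 0 j) *: t h - (const_bracket h w x y * (act h z) 0 j) *: t h
        - (w 0 j *: (const_bracket h x y z *: t h) - x 0 j *: (const_bracket h y z w *: t h)
           + y 0 j *: (const_bracket h z w x *: t h) - z 0 j *: (const_bracket h w x y *: t h)).
      rewrite /c !(mulrBr, scalerBl, scalerDl) !scalerA.
      by rewrite ![_ 0 j * const_bracket h _ _ _]mulrC; zmod.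
    under eq_bigr => h _ do rewrite pt.
    by rewrite /s /bracket_sum !scaler_sumr !(big_split, sumrN).
  have E x' y' z' w' : s x' y' z' w' *+ 3 = _ := esym (jac_vw j x' y' z' w').
  have Qs x' y' z' w' : D_defect2 j x' y' z' w' = D_defect2 j x' y' w' z' by rewrite /D_defect2 vC.
  have Qa x' y' z' w' : D_defect2 j x' y' z' w' = - D_defect2 j y' x' z' w'.
    by rewrite /D_defect2 C_anti (linear_N (@D_lin _)).
  transitivity (s x y z w *+ 3 - s y z w x *+ 3 + s z w x y *+ 3 - s w x y z *+ 3
     - (w 0 j *: bracket_sum x y z - x 0 j *: bracket_sum y z w + y 0 j *: bracket_sum z w x
        - z 0 j *: bracket_sum w x y) *+ 3); first by zmod.
  rewrite !E.
  have k2 x' y' z' : bracket_sum x' y' z' = bracket_sum z' x' y' by rewrite 2!bracket_sum_cyc.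
  have ka x' y' z' : bracket_sum x' y' z' = - bracket_sum x' z' y' by rewrite bracket_sum_anti bracket_sum_cyc.
  rewrite (ka z x w) (k2 x y w) (ka w y x) (k2 y z x) (ka x z y) (k2 z w y).
  rewrite (ka y w z) (k2 w x z) (Qs y z w x) (Qa x z w y) (Qs z x w y) (Qs x y w z).
  rewrite (Qs z w y x) (Qa y w x z) (Qs w y x z) (Qs w x z y).
  by rewrite !scalerN; zmod.
by rewrite -(t_indep c0 g) /c !mxE.
Qed.

(** The rank condition provides w such that g w - w is not in the span of g x
    - x, g y - y, g z - z; so its coefficient in the cocycle identity is zero. *)
Lemma const_bracket_eq0 g x y z : const_bracket g x y z = 0.
Proof.
have [//|rk] := const_bracket0_or_rank g.
set N := r g - 1%:M; pose U := col_mx (x *m N) (col_mx (y *m N) (z *m N)).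
have /negP nsub : ~~ (N <= U)%MS.
  apply/negP => /mxrankS le; move: (leq_trans rk (leq_trans le (rank_leq_row _))).
  by [].
have /row_subPn[k] : ~~ (N <= U)%MS by apply/negP.
rewrite rowE; set w := delta_mx 0 k => nw.
have := const_bracket_cocycle g x y z w.
have sE u : act g u - u = u *m N by rewrite mulmxBr mulmx1.
rewrite !sE => /eqP; rewrite -!addrA addr_eq0 => /eqP E.
apply/eqP/negPn/negP => nz; case/negP: nw.
have := submx_refl U; rewrite !col_mx_sub => /and3P[xU yU zU].
rewrite -(eqmx_scale _ nz) -rowE rowE E.
by rewrite eqmx_opp !addmx_sub ?eqmx_opp ?scalemx_sub.
Qed.

(** By sum_jac_D and induction on the degree. *)
Lemma defect_eq0 x y a : C x y a = 0.
Proof.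
move: a x y; apply: hom_ind => [x y|a b IHa IHb x y|n a h IH x y].
- by rewrite (linear_0 (C_lin _ _)).
- by rewrite (linear_D (C_lin _ _)) IHa IHb addr0.
apply: (@scale_natS_inj n.+1); rewrite scaler0.
have := sum_jac_D x y h; rewrite addn2 => ->.
have hD i : ldeg n (D i a) by exact: ldeg_homD.
rewrite !big1 ?subrr // => i _.
  apply: (@scale_natS_inj 1); rewrite scaler0 scaler_nat jacE big1 // => g _.
  by rewrite const_bracket_eq0 scale0r !IH ?addr0 //; exact: ldegt.
by rewrite !IH ?(linear_0 (X_lin _)) ?subrr //; exact: L_ldeg.
Qed.

Lemma X_comm x y a : X x (X y a) = X y (X x a) + R x y a.
Proof. by apply/eqP; rewrite -subr_eq0 opprD addrA -CE defect_eq0. Qed.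

Hypothesis hom0_span : forall a, hom 0 a -> exists c : G -> K, a = \sum_g c g *: t g.

(** Left multiplication by a in the deformed algebra, again by the Euler
    identity: n (a * b) = sum_i X_{e_i} (D_i a * b) if a has degree n > 0. *)
Fixpoint product_upto N a b : A :=
  if N is N'.+1 then
    product_upto N' a b + (if N' is 0 then cp 0 a * b
      else N'%:R^-1 *: \sum_i X (e i) (product_upto N' (D i (cp N' a)) b))
  else 0.

Lemma product_upto_linl N b : linear (fun a => product_upto N a b).
Proof.
elim: N => [|N IH] /=; first exact: linear_zerof.
apply: linearDf => //; case: N IH => [_|N IH].
  exact: (linear_compf (linear_mulr b) (@cp_lin 0)).
apply: linearZf; apply: linear_sumf => i; apply: (linear_compf (X_lin _)).
apply: (linear_compf IH); exact: (linear_compf (@D_lin _) (@cp_lin _)).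
Qed.

Lemma product_upto_linr N a : linear (product_upto N a).
Proof.
elim: N a => [|N IH] a /=; first exact: linear_zerof.
apply: linearDf => //; case: N IH => [_|N IH]; first exact: linear_mull.
apply: linearZf; apply: linear_sumf => i.
exact: (linear_compf (X_lin _) (IH _)).
Qed.

Lemma product_upto_stable M N a b : ldeg M a -> (M <= N)%N -> product_upto N a b = product_upto M a b.
Proof.
move=> h /subnK <-; elim: (N - M)%N => [//|k IH].
have h0 : cp (k + M) a = 0 by rewrite h ?leq_addl.
rewrite addSn [LHS]/= IH; case: (k + M)%N h0 => [|m] -> ; first by rewrite mul0r addr0.
rewrite big1 ?scaler0 ?addr0 // => i _.
by rewrite (linear_0 (@D_lin i)) (linear_0 (product_upto_linl _ _)) (linear_0 (X_lin _)).
Qed.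

Lemma product_upto_low N a b : (forall m, (m < N)%N -> cp m a = 0) -> product_upto N a b = 0.
Proof.
elim: N => [//|N IH] h; rewrite /= IH; last by move=> m lt; apply: h; exact: ltnW.
have h0 : cp N a = 0 by exact: h.
rewrite add0r; case: N {IH h} h0 => [|m] ->; first by rewrite mul0r.
rewrite big1 ?scaler0 // => i _.
by rewrite (linear_0 (@D_lin i)) (linear_0 (product_upto_linl _ _)) (linear_0 (X_lin _)).
Qed.

Definition star a b := product_upto (sz a) a b.

Lemma starE N a b : ldeg N a -> star a b = product_upto N a b.
Proof.
move=> h; have [le|/ltnW le] := leqP N (sz a); first exact: product_upto_stable.
by rewrite (product_upto_stable _ (@ldeg_sz a) le).
Qed.

Lemma star_linl b : linear (star^~ b).
Proof.
move=> c a a'; set N := maxn (sz a) (sz a').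
have ha : ldeg N a by apply: ldegW (@ldeg_sz a); rewrite leq_maxl.
have hb : ldeg N a' by apply: ldegW (@ldeg_sz a'); rewrite leq_maxr.
rewrite (starE _ ha) (starE _ hb) (@starE N) ?product_upto_linl //.
by apply: ldegD => //; exact: ldegZ.
Qed.

Lemma star_linr a : linear (star a).
Proof. exact: product_upto_linr. Qed.

Lemma star_hom0 a b : hom 0 a -> star a b = a * b.
Proof. by move=> h; rewrite (starE _ (hom_ldeg h)) /= add0r h. Qed.

Lemma star_euler n a b : hom n a ->
  \sum_i X (e i) (star (D i a) b) = n%:R *: star a b.
Proof.
case: n => [|n] h.
  rewrite scale0r big1 // => i _.
  by rewrite homD0 // (linear_0 (star_linl _)) (linear_0 (X_lin _)).
rewrite (starE _ (hom_ldeg h)) [product_upto _ _ _]/= -/(product_upto n.+1 a b).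
rewrite [X in X + _](_ : _ = 0); last first.
  by rewrite -[LHS]/(product_upto n.+1 a b) product_upto_low // => m lt; rewrite (hom_cpE _ h) ltn_eqF.
rewrite add0r h scalerA divff ?pnatr_eq0 // scale1r; apply: eq_bigr => i _.
by rewrite (@starE n.+1) //; exact: ldeg_homD.
Qed.

Lemma star_t g a b : star (t g * a) b = t g * star a b.
Proof.
move: a; apply: hom_lin_ind.
- exact: (linear_compf (star_linl _) (linear_mull _)).
- exact: (linear_compf (linear_mull _) (star_linl _)).
case=> [|n] a h IH; first by rewrite !star_hom0 ?mulrA //; exact: homt.
apply: (@scale_natS_inj n); rewrite -(star_euler _ (homt g h)) scalerAr -(star_euler _ h).
rewrite -(@sum_equiv (fun y c => X y (star c b))).
- rewrite mulr_sumr; apply: eq_bigr => i _.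
  by rewrite tX IH //; exact: ldeg_homD.
- by move=> c; exact: X_linl.
- by move=> y; exact: (linear_compf (X_lin _) (star_linl _)).
Qed.

(** The Euler recursion for x a, compared with the one for a: the commutators
    of X x with the X_{e_i} are known, and the recursion defining L_x provides
    the same terms. *)
Lemma star_X x a b : star (X x a) b = X x (star a b).
Proof.
move: a x; apply: hom_ind => [x|a a' IHa IHb x|n a h IH x].
- by rewrite !(linear_0 (X_lin _), linear_0 (star_linl _)).
- by rewrite !(linear_D (X_lin _), linear_D (star_linl _)) IHa IHb.
apply: (@scale_natS_inj n).
rewrite XE (linear_D (star_linl _)) scalerDr -(star_euler _ (homv x h)).
rewrite -(linear_Z (star_linl b)) (L_hom _ h) (linear_big _ _ _ (star_linl b)) -big_split /=.
rewrite -natr1 scalerDl scale1r -(linear_Z (X_lin _)) -(star_euler _ h).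
rewrite (linear_big _ _ _ (X_lin _)) [X in _ = _ + X](linear_row _ (X_linl _)) -big_split /=.
apply: eq_bigr => i _.
have hD := ldeg_homD i h.
have Rs : star (R x (e i) (D i a)) b = R x (e i) (star (D i a) b).
  rewrite (linear_big _ _ _ (star_linl b)); apply: eq_bigr => g _.
  by rewrite (linear_D (star_linl b)) (linear_Z (star_linl b)) star_t IH ?star_t //; exact: ldegt.
rewrite (linear_D (star_linl b)) Rs (IH (L x (D i a))); last exact: L_ldeg.
rewrite Dv !(linear_D (star_linl b)) (linear_Z (star_linl b)).
have -> : star (v x * D i a) b = X x (star (D i a) b) - star (L x (D i a)) b.
  by rewrite -IH // XE (linear_D (star_linl b)); zmod.
rewrite !(linear_D (X_lin _)) (linear_N (X_lin _)) (linear_Z (X_lin _)).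
by rewrite (X_comm x (e i)); zmod.
Qed.

(** Since the product is generated by the operators X and the t g,
    associativity is star_X and star_t. *)
Lemma starA a b c : star a (star b c) = star (star a b) c.
Proof.
move: a; apply: hom_lin_ind.
- exact: star_linl.
- exact: (linear_compf (star_linl _) (star_linl _)).
case=> [|n] a h IH.
  rewrite !(star_hom0 _ h); have [k ->] := hom0_span h.
  rewrite !mulr_suml (linear_big _ _ _ (star_linl _)); apply: eq_bigr => g _.
  by rewrite -!scalerAl (linear_Z (star_linl _)) star_t.
apply: (@scale_natS_inj n); rewrite -(star_euler _ h) -(linear_Z (star_linl _)).
rewrite -(star_euler _ h) (linear_big _ _ _ (star_linl _)); apply: eq_bigr => i _.
by rewrite star_X IH //; exact: ldeg_homD.
Qed.

Lemma star_tr a b g : star a (b * t g) = star a b * t g.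
Proof.
move: a; apply: hom_lin_ind.
- exact: star_linl.
- exact: (linear_compf (linear_mulr _) (star_linl _)).
case=> [|n] a h IH; first by rewrite !star_hom0 ?mulrA.
apply: (@scale_natS_inj n); rewrite -(star_euler _ h) scalerAl -(star_euler _ h).
rewrite mulr_suml; apply: eq_bigr => i _.
by rewrite Xtr IH //; exact: ldeg_homD.
Qed.

Lemma star_tm a b g : star (a * t g) b = star a (t g * b).
Proof.
move: a; apply: hom_lin_ind.
- exact: (linear_compf (star_linl _) (linear_mulr _)).
- exact: star_linl.
case=> [|n] a h IH; first by rewrite !star_hom0 ?mulrA //; exact: homtr.
apply: (@scale_natS_inj n); rewrite -(star_euler _ (homtr g h)) -(star_euler _ h).
apply: eq_bigr => i _.
by rewrite Dtr IH //; exact: ldeg_homD.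
Qed.

Lemma star_ldeg p N a b : hom p a -> ldeg N b -> ldeg (p + N) (star a b).
Proof.
elim: p a => [|p IH] a h hb.
  rewrite star_hom0 //; have [k ->] := hom0_span h.
  rewrite mulr_suml; apply: ldeg_big => g _; rewrite -scalerAl.
  by apply: ldegZ; exact: ldegt.
have -> : star a b = p.+1%:R^-1 *: (p.+1%:R *: star a b).
  by rewrite scalerA mulVf ?pnatr_eq0 // scale1r.
rewrite -(star_euler _ h); apply: ldegZ; apply: ldeg_big => i _.
by apply: X_ldeg; apply: IH => //; exact: homD.
Qed.

Lemma star_top p q a b : hom p a -> hom q b -> cp (p + q) (star a b) = a * b.
Proof.
elim: p a => [|p IH] a h hb.
  rewrite star_hom0 //; have [k ->] := hom0_span h.
  rewrite mulr_suml (linear_big _ _ _ (@cp_lin _)); apply: eq_bigr => g _.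
  by rewrite -scalerAl (linear_Z (@cp_lin _)) cptl hb.
apply: (@scale_natS_inj p); rewrite -(linear_Z (@cp_lin _)) -(star_euler _ h).
rewrite (linear_big _ _ _ (@cp_lin _)) scalerAl -(hom_euler h) mulr_suml.
apply: eq_bigr => i _; have hD := homD i h.
rewrite XE (linear_D (@cp_lin _)) cpv IH // -mulrA.
have lt := star_ldeg hD (hom_ldeg hb).
by rewrite [X in _ + X](L_ldeg _ lt) ?addr0 // addnS.
Qed.

Lemma star_v x b : star (v x) b = X x b.
Proof.
by rewrite -[v x]mulr1 -(X_hom0 x hom_one) star_X star_hom0 ?mul1r //; exact: hom_one.
Qed.

Lemma star_comm x y :
  cp 1 (star (v x) (v y) - star (v y) (v x)) = \sum_g v (pi g x y) * t g.
Proof.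
rewrite !star_v -[v x]mulr1 -[v y]mulr1 -!(X_hom0 _ hom_one) X_comm addrAC subrr add0r.
rewrite (linear_big _ _ _ (@cp_lin _)); apply: eq_bigr => g _.
have ht : hom 0 (t g * 1) by apply: homt; exact: hom_one.
rewrite (linear_D (@cp_lin _)) (linear_Z (@cp_lin _)) X_hom0 // cpv ht.
by rewrite (hom_cpE _ ht) scaler0 addr0 mulr1.
Qed.

Lemma hom_ext (V : lmodType K) (f1 f2 : A -> V) : linear f1 -> linear f2 ->
  (forall n a, hom n a -> f1 a = f2 a) -> forall a, f1 a = f2 a.
Proof.
move=> l1 l2 h a; rewrite (cp_sum (leqnn (sz a))) !linear_big //.
by apply: eq_bigr => n _; apply: h; exact: hom_cp.
Qed.

(** The component of degree n - l, which is the coefficient of hbar^l in the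
    homogenization of an element of degree at most n. *)
Definition drop_comp n l a := if (l <= n)%N then cp (n - l) a else 0.

(** Coefficient of hbar^l in the product of the Rees algebra, which is graded
    when hbar is given the degree one. *)
Definition rees_coef l a b :=
  \sum_(p < sz a) \sum_(q < sz b) drop_comp (p + q) l (star (cp p a) (cp q b)).

Lemma drop_comp_lin n l : linear (drop_comp n l).
Proof. by rewrite /drop_comp; case: leqP => _; [exact: cp_lin | exact: linear_zerof]. Qed.

Lemma big_ldeg N a (F : nat -> A -> A) : ldeg N a -> (forall n, F n 0 = 0) ->
  \sum_(n < sz a) F n (cp n a) = \sum_(n < N) F n (cp n a).
Proof.
move=> h F0; have E P : ldeg P a -> forall Q, (P <= Q)%N ->
    \sum_(n < Q) F n (cp n a) = \sum_(n < P) F n (cp n a).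
  move=> hP Q le; rewrite -!(big_mkord xpredT (fun n => F n (cp n a))).
  rewrite (big_cat_nat (leq0n P) le) /= [X in _ + X]big_nat [X in _ + X]big1 ?addr0 //.
  by move=> n /andP[/hP -> _].
have [le|/ltnW le] := leqP (sz a) N; last exact: E.
by rewrite (E _ (@ldeg_sz a)).
Qed.

Lemma rees_coefE N M l a b : ldeg N a -> ldeg M b ->
  rees_coef l a b = \sum_(p < N) \sum_(q < M) drop_comp (p + q) l (star (cp p a) (cp q b)).
Proof.
move=> ha hb; rewrite /rees_coef.
rewrite (big_ldeg (F := fun p a' => \sum_(q < sz b) drop_comp (p + q) l (star a' (cp q b))) ha).
  apply: eq_bigr => p _.
  apply: (big_ldeg (F := fun q b' => drop_comp (p + q) l (star (cp p a) b')) hb) => q.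
  by rewrite (linear_0 (star_linr _)) (linear_0 (drop_comp_lin _ _)).
move=> p; rewrite big1 // => q _.
by rewrite (linear_0 (star_linl _)) (linear_0 (drop_comp_lin _ _)).
Qed.

Lemma rees_coef_linl l b : linear (fun a => rees_coef l a b).
Proof.
move=> c a a'; set N := maxn (sz a) (sz a').
have ha : ldeg N a by apply: ldegW (@ldeg_sz a); rewrite leq_maxl.
have hb : ldeg N a' by apply: ldegW (@ldeg_sz a'); rewrite leq_maxr.
have hs : ldeg N (c *: a + a') by apply: ldegD => //; exact: ldegZ.
rewrite (rees_coefE _ ha (@ldeg_sz b)) (rees_coefE _ hb (@ldeg_sz b)) (rees_coefE _ hs (@ldeg_sz b)).
rewrite scaler_sumr -big_split; apply: eq_bigr => p _ /=.
rewrite scaler_sumr -big_split; apply: eq_bigr => q _ /=.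
by rewrite (@cp_lin _ c) star_linl drop_comp_lin.
Qed.

Lemma rees_coef_linr l a : linear (rees_coef l a).
Proof.
move=> c b b'; set N := maxn (sz b) (sz b').
have ha : ldeg N b by apply: ldegW (@ldeg_sz b); rewrite leq_maxl.
have hb : ldeg N b' by apply: ldegW (@ldeg_sz b'); rewrite leq_maxr.
have hs : ldeg N (c *: b + b') by apply: ldegD => //; exact: ldegZ.
rewrite (rees_coefE _ (@ldeg_sz a) ha) (rees_coefE _ (@ldeg_sz a) hb) (rees_coefE _ (@ldeg_sz a) hs).
rewrite scaler_sumr -big_split; apply: eq_bigr => p _ /=.
rewrite scaler_sumr -big_split; apply: eq_bigr => q _ /=.
by rewrite (@cp_lin _ c) star_linr drop_comp_lin.
Qed.

Lemma rees_coef_hom p q l a b : hom p a -> hom q b -> rees_coef l a b = drop_comp (p + q) l (star a b).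
Proof.
move=> ha hb; rewrite (rees_coefE _ (hom_ldeg ha) (hom_ldeg hb)).
rewrite (bigD1 ord_max) //= [X in _ + X]big1 ?addr0.
  rewrite (bigD1 ord_max) //= [X in _ + X]big1 ?addr0 ?ha ?hb // => j ne.
  rewrite (hom_cpE _ hb) -[(j : nat) == q]/(j == ord_max) (negbTE ne).
  by rewrite (linear_0 (star_linr _)) (linear_0 (drop_comp_lin _ _)).
move=> i ne; rewrite big1 // => j _.
rewrite (hom_cpE _ ha) -[(i : nat) == p]/(i == ord_max) (negbTE ne).
by rewrite (linear_0 (star_linl _)) (linear_0 (drop_comp_lin _ _)).
Qed.

Lemma rees_coef0 a b : rees_coef 0 a b = a * b.
Proof.
move: a; apply: hom_ext; [exact: rees_coef_linl | exact: linear_mulr |].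
move=> p a ha; move: b; apply: hom_ext; [exact: rees_coef_linr | exact: linear_mull |].
by move=> q b hb; rewrite (rees_coef_hom _ ha hb) /drop_comp /= subn0 (star_top ha hb).
Qed.

Lemma hom_drop_comp n l a : hom (n - l) (drop_comp n l a).
Proof. by rewrite /drop_comp; case: ifP => _; [exact: hom_cp | rewrite /hom (linear_0 (@cp_lin _))]. Qed.

Lemma star_hom_ldeg p q a b : hom p a -> hom q b -> ldeg (p + q).+1 (star a b).
Proof. by move=> ha hb; rewrite -addnS; apply: star_ldeg => //; exact: hom_ldeg. Qed.

(** Lowering the degree by k - l before a filtered map and by l after it
    collects all the terms whose total drop is k. *)
Lemma drop_comp_sum (F : A -> A) n s k a : linear F -> ldeg n.+1 a ->
  (forall (j : nat) b, hom j b -> ldeg (j + s).+1 (F b)) ->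
  \sum_(l < k.+1) drop_comp (n - (k - l) + s) l (F (drop_comp n (k - l) a)) = drop_comp (n + s) k (F a).
Proof.
move=> lF ha hF.
transitivity (\sum_(l < k.+1) if (l <= n)%N then drop_comp (n + s) k (F (cp (n - l) a)) else 0).
  rewrite (reindex_inj rev_ord_inj); apply: eq_bigr => l _ /=.
  have le : (l <= k)%N by rewrite -ltnS.
  rewrite subSS subKn //.
  rewrite [drop_comp n l a]/drop_comp; case: leqP => [ln|_]; last by rewrite (linear_0 lF) (linear_0 (drop_comp_lin _ _)).
  rewrite /drop_comp; have -> : (n - l + s = n + s - l)%N by rewrite addnBAC.
  rewrite -subnDA (subnKC le); congr (if _ then _ else _).
  by rewrite leq_subRL ?subnKC //; apply: (leq_trans ln); rewrite leq_addr.
rewrite [X in F X](cp_sum_ldeg ha) (linear_big _ _ _ lF) (linear_big _ _ _ (drop_comp_lin _ _)).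
rewrite [RHS](reindex_inj rev_ord_inj) /=.
under [RHS]eq_bigr => l _ do rewrite subSS.
set H := fun l => drop_comp (n + s) k (F (cp (n - l) a)).
rewrite -(big_mkord xpredT (fun l => if (l <= n)%N then H l else 0)) -(big_mkord xpredT H).
set N := maxn k n.
have E1 : \sum_(0 <= l < k.+1) (if (l <= n)%N then H l else 0) =
   \sum_(0 <= l < N.+1) (if (l <= n)%N && (l <= k)%N then H l else 0).
  rewrite [RHS](@big_cat_nat _ _ _ k.+1) ?ltnS ?leq_maxl //= [X in _ = _ + X]big_nat.
  rewrite [X in _ = _ + X]big1 ?addr0; last first.
    by move=> l /andP[lt _]; rewrite [(l <= k)%N]leqNgt lt andbF.
  by rewrite !big_nat; apply: eq_bigr => l /andP[_]; rewrite ltnS => ->; rewrite andbT.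
rewrite E1 [LHS](@big_cat_nat _ _ _ n.+1) ?ltnS ?leq_maxr //= [X in _ + X]big_nat.
rewrite [X in _ + X]big1 ?addr0; last first.
  by move=> l /andP[lt _]; rewrite [(l <= n)%N]leqNgt lt.
rewrite !big_nat; apply: eq_bigr => l /andP[_]; rewrite ltnS => ln; rewrite ln /=.
case: leqP => // kl; rewrite /H /drop_comp; case: leqP => // le.
rewrite (hF (n - l)%N) //; first exact: hom_cp.
by move: ln kl; lia.
Qed.

Lemma rees_coefA k a b c : \sum_(l < k.+1) rees_coef l (rees_coef (k - l) a b) c =
  \sum_(l < k.+1) rees_coef l a (rees_coef (k - l) b c).
Proof.
move: a; apply: hom_ext.
- by apply: linear_sumf => l; exact: (linear_compf (rees_coef_linl _ _) (rees_coef_linl _ _)).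
- by apply: linear_sumf => l; exact: rees_coef_linl.
move=> p a ha; move: b; apply: hom_ext.
- by apply: linear_sumf => l; exact: (linear_compf (rees_coef_linl _ _) (rees_coef_linr _ _)).
- by apply: linear_sumf => l; exact: (linear_compf (rees_coef_linr _ _) (rees_coef_linl _ _)).
move=> q b hb; move: c; apply: hom_ext.
- by apply: linear_sumf => l; exact: rees_coef_linr.
- by apply: linear_sumf => l; exact: (linear_compf (rees_coef_linr _ _) (rees_coef_linr _ _)).
move=> s c hc.
under eq_bigr => l _ do
  rewrite (rees_coef_hom _ ha hb) (rees_coef_hom _ (hom_drop_comp _ _ _) hc).
under [RHS]eq_bigr => l _ do
  rewrite (rees_coef_hom _ hb hc) (rees_coef_hom _ ha (hom_drop_comp _ _ _)) [(p + _)%N]addnC.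
rewrite (drop_comp_sum _ (star_linl c) (star_hom_ldeg ha hb)); last first.
  by move=> j b1 hb1; exact: star_hom_ldeg.
rewrite (drop_comp_sum _ (star_linr a) (star_hom_ldeg hb hc)); last first.
  by move=> j b1 hb1; rewrite [(j + _)%N]addnC; exact: star_hom_ldeg.
by rewrite starA [(q + s + p)%N]addnC addnA.
Qed.

Lemma rees_coef_t l g a b : rees_coef l (t g * a) b = t g * rees_coef l a b.
Proof.
move: a; apply: hom_ext.
- exact: (linear_compf (rees_coef_linl _ _) (linear_mull _)).
- exact: (linear_compf (linear_mull _) (rees_coef_linl _ _)).
move=> p a ha; move: b; apply: hom_ext.
- exact: rees_coef_linr.
- exact: (linear_compf (linear_mull _) (rees_coef_linr _ _)).
move=> q b hb; rewrite (rees_coef_hom _ ha hb) (rees_coef_hom _ (homt g ha) hb) star_t.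
by rewrite /drop_comp; case: ifP; rewrite ?mulr0 // cptl.
Qed.

Lemma rees_coef_tr l g a b : rees_coef l a (b * t g) = rees_coef l a b * t g.
Proof.
move: a; apply: hom_ext.
- exact: rees_coef_linl.
- exact: (linear_compf (linear_mulr _) (rees_coef_linl _ _)).
move=> p a ha; move: b; apply: hom_ext.
- exact: (linear_compf (rees_coef_linr _ _) (linear_mulr _)).
- exact: (linear_compf (linear_mulr _) (rees_coef_linr _ _)).
move=> q b hb; rewrite (rees_coef_hom _ ha hb) (rees_coef_hom _ ha (homtr g hb)) star_tr.
by rewrite /drop_comp; case: ifP; rewrite ?mul0r // cptr.
Qed.

Lemma rees_coef_tm l g a b : rees_coef l (a * t g) b = rees_coef l a (t g * b).
Proof.
move: a; apply: hom_ext.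
- exact: (linear_compf (rees_coef_linl _ _) (linear_mulr _)).
- exact: rees_coef_linl.
move=> p a ha; move: b; apply: hom_ext.
- exact: rees_coef_linr.
- exact: (linear_compf (rees_coef_linr _ _) (linear_mull _)).
move=> q b hb; rewrite (rees_coef_hom _ ha (homt g hb)) (rees_coef_hom _ (homtr g ha) hb).
by rewrite star_tm.
Qed.

Lemma rees_coef1_comm x y :
  rees_coef 1 (v x) (v y) - rees_coef 1 (v y) (v x) = \sum_g v (pi g x y) * t g.
Proof.
have hv z : hom 1 (v z) by rewrite -[v z]mulr1; apply: homv; exact: hom_one.
by rewrite !(rees_coef_hom _ (hv _) (hv _)) /drop_comp /= subn1 -(linear_B (@cp_lin 1)) star_comm.
Qed.

Theorem PBW_coefficients : exists m : nat -> A -> A -> A,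
  [/\ forall l b, linear (fun a => m l a b), forall l a, linear (m l a),
      forall a b, m 0 a b = a * b,
      forall k a b c, \sum_(l < k.+1) m l (m (k - l)%N a b) c =
        \sum_(l < k.+1) m l a (m (k - l)%N b c) &
      [/\ forall l g a b, m l (t g * a) b = t g * m l a b,
          forall l g a b, m l (a * t g) b = m l a (t g * b),
          forall l g a b, m l a (b * t g) = m l a b * t g &
          forall x y, m 1 (v x) (v y) - m 1 (v y) (v x) = \sum_g v (pi g x y) * t g]].
Proof.
exists rees_coef; split; [exact: rees_coef_linl|exact: rees_coef_linr|exact: rees_coef0|exact: rees_coefA|].
by split; [exact: rees_coef_t|exact: rees_coef_tm|exact: rees_coef_tr|exact: rees_coef1_comm].
Qed.

End PBW.

(** * Star products from their coefficients *)

Section AntidiagonalSums.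
Variable V : nmodType.

Definition dsum k (F : nat -> nat -> V) : V := \sum_(i < k.+1) F i (k - i)%N.

Lemma eq_dsum k (F1 F2 : nat -> nat -> V) : (forall i j, F1 i j = F2 i j) -> dsum k F1 = dsum k F2.
Proof. by move=> h; apply: eq_bigr => i _. Qed.

Lemma dsumC k F : dsum k F = dsum k (fun i j => F j i).
Proof.
rewrite /dsum (reindex_inj rev_ord_inj); apply: eq_bigr => i _ /=.
by rewrite subSS subKn // -ltnS.
Qed.

(** Both sides run over the triples of sum k. Together with dsum_swap and
    exchange_dsum, this replaces the index bookkeeping of iterated Cauchy
    products. *)
Lemma dsumA k (F : nat -> nat -> nat -> V) :
  dsum k (fun i j => dsum i (fun a b => F a b j)) = dsum k (fun a j => dsum j (F a)).
Proof.
rewrite /dsum.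
transitivity (\sum_(i < k.+1) \sum_(a < k.+1 | (a <= i)%N) F a (i - a)%N (k - i)%N).
  apply: eq_bigr => i _.
  by rewrite (big_ord_widen k.+1 (fun a => F a (i - a)%N (k - i)%N)) ?ltn_ord.
rewrite (exchange_big_dep xpredT) //=; apply: eq_bigr => a _.
have le : (a <= k)%N by rewrite -ltnS.
rewrite -(big_mkord xpredT (fun b => F a b (k - a - b)%N)).
rewrite -(big_mkord (fun i => (a <= i)%N) (fun i => F a (i - a)%N (k - i)%N)).
rewrite (big_cat_nat (leq0n a) (leqW le)) /= big_nat_cond big1 ?add0r; last first.
  by move=> i /andP[/andP[_ lt] le']; move: lt; rewrite ltnNge le'.
rewrite -{1}[nat_of_ord a]add0n big_addn subSn // big_mkcond.
apply: eq_big_nat => b /andP[_ lt].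
by rewrite leq_addl addnK subnDA subnAC.
Qed.

Lemma dsum_swap k (F : nat -> nat -> nat -> V) :
  dsum k (fun i s => dsum s (F i)) = dsum k (fun j s => dsum s (fun i q => F i j q)).
Proof.
rewrite -dsumA -(dsumA k (fun j i q => F i j q)); apply: eq_dsum => w q.
by rewrite dsumC.
Qed.

Lemma exchange_dsum k l (F : nat -> nat -> nat -> nat -> V) :
  dsum k (fun i j => dsum l (F i j)) = dsum l (fun a b => dsum k (fun i j => F i j a b)).
Proof. exact: exchange_big. Qed.

End AntidiagonalSums.

Section StarFromCoefficients.
Variables (K : comNzRingType) (A : algType K) (m : nat -> A -> A -> A).
Hypothesis m_linl : forall l b, linear (fun a => m l a b).
Hypothesis m_linr : forall l a, linear (m l a).
Hypothesis m_0 : forall a b, m 0 a b = a * b.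
Hypothesis m_assoc : forall k a b c,
  dsum k (fun l j => m l (m j a b) c) = dsum k (fun l j => m l a (m j b c)).

Definition fps_star (a b : fps A) : fps A := fun k =>
  dsum k (fun l s => dsum s (fun i j => m l (a i) (b j))).

Lemma linear_dsum (U V : lmodType K) (f : U -> V) k F :
  linear f -> f (dsum k F) = dsum k (fun i j => f (F i j)).
Proof. by move=> h; rewrite /dsum linear_big. Qed.

Lemma dsumD (V : nmodType) k (F1 F2 : nat -> nat -> V) :
  dsum k (fun i j => F1 i j + F2 i j) = dsum k F1 + dsum k F2.
Proof. exact: big_split. Qed.

Lemma dsumZ (V : lmodType K) k c (F : nat -> nat -> V) :
  dsum k (fun i j => c *: F i j) = c *: dsum k F.
Proof. by rewrite /dsum scaler_sumr. Qed.

Lemma fps_scaleE (M : lmodType K) (s : fps K) (a : fps M) k :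
  fps_scale s a k = dsum k (fun i j => s i *: a j).
Proof. by []. Qed.

Lemma fps_star_bilinear : fps_bilinear fps_star.
Proof.
split=> s a b c; apply: functional_extensionality => k.
  rewrite /fps_add /fps_star.
  transitivity (dsum k (fun l r => dsum r (fun i j =>
      m l (fps_scale s a i) (c j)) + dsum r (fun i j => m l (b i) (c j)))).
    by apply: eq_dsum => l r; rewrite -dsumD; apply: eq_dsum => i j; rewrite (linear_D (m_linl l _)).
  rewrite dsumD; congr (_ + _); rewrite fps_scaleE.
  transitivity (dsum k (fun l r => dsum r (fun p u => s p *: dsum u (fun q j => m l (a q) (c j))))).
    apply: eq_dsum => l r.
    transitivity (dsum r (fun i j => dsum i (fun p q => s p *: m l (a q) (c j)))).
      apply: eq_dsum => i j; rewrite fps_scaleE (linear_dsum _ _ (m_linl l _)).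
      by apply: eq_dsum => p q; rewrite (linear_Z (m_linl l _)).
    by rewrite (dsumA _ (fun p q j => s p *: m l (a q) (c j))); apply: eq_dsum => p u; rewrite dsumZ.
  by rewrite dsum_swap; apply: eq_dsum => p w; rewrite dsumZ.
rewrite /fps_add /fps_star.
transitivity (dsum k (fun l r => dsum r (fun i j =>
    m l (c i) (fps_scale s a j)) + dsum r (fun i j => m l (c i) (b j)))).
  by apply: eq_dsum => l r; rewrite -dsumD; apply: eq_dsum => i j; rewrite (linear_D (m_linr l _)).
rewrite dsumD; congr (_ + _); rewrite fps_scaleE.
transitivity (dsum k (fun l r => dsum r (fun p u => s p *: dsum u (fun i q => m l (c i) (a q))))).
  apply: eq_dsum => l r.
  transitivity (dsum r (fun i j => dsum j (fun p q => s p *: m l (c i) (a q)))).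
    apply: eq_dsum => i j; rewrite fps_scaleE (linear_dsum _ _ (m_linr l _)).
    by apply: eq_dsum => p q; rewrite (linear_Z (m_linr l _)).
  by rewrite dsum_swap; apply: eq_dsum => p u; rewrite dsumZ.
by rewrite dsum_swap; apply: eq_dsum => p w; rewrite dsumZ.
Qed.

Lemma fps_starA : associative fps_star.
Proof.
move=> a b c; apply: functional_extensionality => k.
transitivity (dsum k (fun t q => dsum q (fun w j => dsum w (fun i i' =>
   dsum t (fun l l' => m l (a i) (m l' (b i') (c j))))))).
  transitivity (dsum k (fun l r => dsum r (fun l' q => dsum q (fun w j => dsum w (fun i i' =>
     m l (a i) (m l' (b i') (c j))))))).
    apply: eq_dsum => l r.
    transitivity (dsum r (fun i s => dsum s (fun l' q => dsum q (fun i' j =>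
        m l (a i) (m l' (b i') (c j)))))).
      apply: eq_dsum => i s; rewrite (linear_dsum _ _ (m_linr l _)).
      by apply: eq_dsum => l' q; rewrite (linear_dsum _ _ (m_linr l _)).
    by rewrite dsum_swap; apply: eq_dsum => l' s; rewrite -dsumA.
  rewrite -dsumA; apply: eq_dsum => t q; rewrite exchange_dsum; apply: eq_dsum => w j.
  by rewrite exchange_dsum.
transitivity (dsum k (fun t q => dsum q (fun w j => dsum w (fun i i' =>
   dsum t (fun l l' => m l (m l' (a i) (b i')) (c j)))))).
  by do 3!(apply: eq_dsum => ? ?); rewrite m_assoc.
transitivity (dsum k (fun l r => dsum r (fun l' q => dsum q (fun w j => dsum w (fun i i' =>
     m l (m l' (a i) (b i')) (c j)))))).
  rewrite -[RHS]dsumA; apply: eq_dsum => t q; rewrite [RHS]exchange_dsum; apply: eq_dsum => w j.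
  by rewrite [RHS]exchange_dsum.
apply: eq_dsum => l r; rewrite -dsumA; apply: eq_dsum => s j.
rewrite (linear_dsum _ _ (m_linl l _)); apply: eq_dsum => l' q.
by rewrite (linear_dsum _ _ (m_linl l _)).
Qed.

Lemma fps_star_const a b k : fps_star (fps_const a) (fps_const b) k = m k a b.
Proof.
rewrite /fps_star /dsum big_ord_recr /= subnn big_ord1 subn0 big1 ?add0r //.
move=> l _; rewrite big1 // => i _.
have : (i + (k - l - i) = k - l)%N by rewrite subnKC // -ltnS.
case: (nat_of_ord i) => [|i'] /=; last by rewrite (linear_0 (m_linl _ _)).
rewrite subn0; have : (0 < k - l)%N by rewrite subn_gt0.
by case: (k - l)%N => [//|u] _ _; rewrite (linear_0 (m_linr _ _)).
Qed.

Lemma fps_star_product : star_product fps_star.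
Proof.
split; [exact: fps_star_bilinear | exact: fps_starA |].
by move=> a b; rewrite fps_star_const m_0.
Qed.

Lemma cocycle_of_coef1 : hochschild_cocycle2 (m 1).
Proof.
split; first by split=> ?; [exact: m_linl | exact: m_linr].
move=> a b c; have := m_assoc 1 a b c.
rewrite /dsum !big_ord_recl !big_ord0 /= !addr0 !m_0 => e.
transitivity (a * m 1 b c + m 1 a (b * c) - (m 1 a b * c + m 1 (a * b) c)); first by zmod.
by rewrite e subrr.
Qed.

End StarFromCoefficients.

(** * Derivatives and degrees in the crossed product *)

Section PolynomialCalculus.
Variables (K : comNzRingType) (d : nat).
Implicit Types (p q : {mpoly K[d]}) (M : 'M[K]_d) (m : 'X_{1..d}).

(** The identities below are linear, so it is enough to check them on
    monomials. *)
Lemma mpoly_ext (V : lmodType K) (f g : {mpoly K[d]} -> V) : linear f -> linear g ->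
  (forall m, f 'X_[m] = g 'X_[m]) -> forall p, f p = g p.
Proof.
move=> lf lg h p; rewrite [p]mpolyE !linear_big //.
by apply: eq_bigr => m _; rewrite !linear_Z // h.
Qed.

Lemma linear_mderiv i : linear (fun p => p^`M(i)).
Proof. exact: linearP. Qed.

Lemma linear_pihomog n : linear (fun p => pihomog mdeg n p).
Proof. exact: linearP. Qed.

Lemma linear_precomp M : linear (poly_precomp M).
Proof. exact: linearP. Qed.

Lemma poly_precomp_mul M p q :
  poly_precomp M (p * q) = poly_precomp M p * poly_precomp M q.
Proof. exact: rmorphM. Qed.

(** The chain rule. It is stable under products and holds for the variables. *)
Lemma mderiv_precomp M p j :
  (poly_precomp M p)^`M(j) = \sum_i M i j *: poly_precomp M (p^`M(i)).
Proof.
pose P q := forall k, (poly_precomp M q)^`M(k) = \sum_i M i k *: poly_precomp M (q^`M(i)).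
have P1 : P 1.
  move=> k; rewrite /poly_precomp rmorph1 -mpolyC1 mderivC big1 // => i _.
  by rewrite mderivC raddf0 scaler0.
have PM q1 q2 : P q1 -> P q2 -> P (q1 * q2).
  move=> h1 h2 k; rewrite poly_precomp_mul mderivM h1 h2 mulr_suml mulr_sumr.
  rewrite -big_split; apply: eq_bigr => i _ /=.
  by rewrite mderivM (linear_D (linear_precomp M)) !poly_precomp_mul scalerDr scalerAl scalerAr.
have PX i : P 'X_i.
  move=> k; rewrite poly_precompX raddf_sum /=.
  rewrite (bigD1 k) //= mderivZ mderivX mnm1E eqxx scale1r big1 ?addr0; last first.
    by move=> l ne; rewrite mderivZ mderivX mnm1E (negbTE ne) scale0r scaler0.
  rewrite (bigD1 i) //= mderivX mnm1E eqxx scale1r [X in _ + X]big1 ?addr0; last first.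
    move=> l ne; rewrite mderivX mnm1E eq_sym (negbTE ne) scale0r.
    by rewrite /poly_precomp raddf0 scaler0.
  by rewrite -[X in (X - _)%MM]add0m addmK -[X in poly_precomp _ 'X_[(X - _)%MM]]add0m addmK mpolyX0 /poly_precomp rmorph1 !mxE.
move: p; apply: mpoly_ext.
- exact: (linear_compf (linear_mderiv j) (linear_precomp M)).
- apply: linear_sumf => i; apply: linearZf.
  exact: (linear_compf (linear_precomp M) (linear_mderiv i)).
move=> m; suff : P 'X_[m] by [].
rewrite mpolyXE_id; apply: (big_ind P) => // i _.
by elim: (m i) => [|k IH]; rewrite ?expr0 // exprS; apply: PM.
Qed.

Lemma pihomog_X n m : pihomog mdeg n 'X_[m] =
  if mdeg m == n then 'X_[m] else 0 :> {mpoly K[d]}.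
Proof. exact: pihomogX. Qed.

Lemma linear_form_mulX x m :
  linear_form x * 'X_[m] = \sum_i x 0 i *: 'X_[U_(i) + m] :> {mpoly K[d]}.
Proof.
by rewrite mulr_suml; apply: eq_bigr => i _; rewrite -scalerAl -mpolyXD.
Qed.

Lemma pihomog_linear_form n x p :
  pihomog mdeg n.+1 (linear_form x * p) = linear_form x * pihomog mdeg n p.
Proof.
move: p; apply: mpoly_ext.
- exact: (linear_compf (linear_pihomog _) (linear_mull _)).
- exact: (linear_compf (linear_mull _) (linear_pihomog _)).
move=> m; rewrite linear_form_mulX (linear_big _ _ _ (linear_pihomog _)) pihomog_X.
case: ifP => h.
  rewrite linear_form_mulX; apply: eq_bigr => i _.
  by rewrite (linear_Z (linear_pihomog _)) pihomog_X mdegD mdeg1 eqSS h.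
rewrite mulr0 big1 // => i _.
by rewrite (linear_Z (linear_pihomog _)) pihomog_X mdegD mdeg1 eqSS h scaler0.
Qed.

Lemma pihomog0_linear_form x p : pihomog mdeg 0 (linear_form x * p) = 0.
Proof.
move: p; apply: mpoly_ext.
- exact: (linear_compf (linear_pihomog _) (linear_mull _)).
- exact: linear_zerof.
move=> m; rewrite linear_form_mulX (linear_big _ _ _ (linear_pihomog _)) big1 // => i _.
by rewrite (linear_Z (linear_pihomog _)) pihomog_X mdegD mdeg1 scaler0.
Qed.

Lemma mdeg_sub1 m i : m i != 0%N -> mdeg m = (mdeg (m - U_(i))%MM).+1.
Proof.
move=> nz; have le : (U_(i) <= m)%MM by rewrite lep1mP.
by rewrite -[in LHS](submK le) mdegD mdeg1 addn1.
Qed.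

Lemma pihomog_mderiv n i p : pihomog mdeg n (p^`M(i)) = (pihomog mdeg n.+1 p)^`M(i).
Proof.
move: p; apply: mpoly_ext.
- exact: (linear_compf (linear_pihomog _) (linear_mderiv _)).
- exact: (linear_compf (linear_mderiv _) (linear_pihomog _)).
move=> m; rewrite mderivX (linear_Z (linear_pihomog _)) !pihomog_X.
have [m0|nz] := eqVneq (m i) 0%N.
  by rewrite m0 scale0r; case: ifP => _; rewrite ?mderivX ?m0 ?scale0r ?raddf0.
by rewrite (mdeg_sub1 nz) eqSS; case: ifP; rewrite ?mderivX ?raddf0 ?scaler0.
Qed.

Lemma mderiv_pihomog0 i p : (pihomog mdeg 0 p)^`M(i) = 0.
Proof.
move: p; apply: mpoly_ext.
- exact: (linear_compf (linear_mderiv _) (linear_pihomog _)).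
- exact: linear_zerof.
move=> m; rewrite pihomog_X; case: eqP => [m0|]; last by rewrite raddf0.
rewrite mderivX; have [->|/mdeg_sub1] := eqVneq (m i) 0%N; first by rewrite scale0r.
by rewrite [LHS]m0.
Qed.

Lemma euler_pihomog n p :
  \sum_i 'X_i * (pihomog mdeg n p)^`M(i) = n%:R *: pihomog mdeg n p.
Proof.
move: p; apply: mpoly_ext.
- apply: linear_sumf => i; apply: (linear_compf (linear_mull _)).
  exact: (linear_compf (linear_mderiv _) (linear_pihomog _)).
- exact: linearZf (linear_pihomog _).
move=> m; rewrite pihomog_X; case: eqP => [<-|_]; last first.
  by rewrite scaler0 big1 // => i _; rewrite raddf0 mulr0.
rewrite mdegE natr_sum scaler_suml; apply: eq_bigr => i _.
rewrite mderivX -scalerAr.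
have [->|nz] := eqVneq (m i) 0%N; first by rewrite !scale0r.
have le : (U_(i) <= m)%MM by rewrite lep1mP.
by rewrite -mpolyXD addmC submK.
Qed.

Lemma dhomog_linear_form (x : 'rV[K]_d) : linear_form x \is 1.-homog.
Proof. by apply: rpred_sum => i _; apply: rpredZ; rewrite dhomogX /= mdeg1. Qed.

Lemma dhomog_precomp M m : poly_precomp M 'X_[m] \is (mdeg m).-homog.
Proof.
rewrite /poly_precomp comp_mpolyX mdegE.
apply: (big_ind2 (fun (k : nat) (q : {mpoly K[d]}) => q \is k.-homog)).
- exact: dhomog1.
- by move=> k1 q1 k2 q2; exact: dhomogM.
move=> i _; rewrite tnth_mktuple.
by have := dhomogMn (m i) (dhomog_linear_form (row i M)); rewrite mul1n.
Qed.

Lemma pihomog_precomp n M p :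
  pihomog mdeg n (poly_precomp M p) = poly_precomp M (pihomog mdeg n p).
Proof.
move: p; apply: mpoly_ext.
- exact: (linear_compf (linear_pihomog _) (linear_precomp _)).
- exact: (linear_compf (linear_precomp _) (linear_pihomog _)).
move=> m; rewrite pihomog_X; case: eqP => [<-|/eqP ne].
  by rewrite pihomog_dE // dhomog_precomp.
by rewrite (linear_0 (linear_precomp M)); apply: (pihomog_ne0 _ (dhomog_precomp M m)).
Qed.

Lemma pihomog_const p : pihomog mdeg 0 p = p -> p = (p@_0)%:MP.
Proof.
move=> h; apply: msize1_polyC; rewrite -h msizeE big_seq.
apply: (big_ind (fun k => (k <= 1)%N)) => // [k l|m mp]; first by rewrite geq_max => -> ->.
by have /= -> := dhomog_mf (pihomogP mdeg 0 p) mp.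
Qed.

End PolynomialCalculus.

Section CrossedCalculus.
Variables (K : numFieldType) (Gamma : finGroupType) (d : nat).
Variable rho : mx_representation K [set: Gamma] d.
Local Notation A := (crossed rho).
Implicit Types (a b : A) (g h : Gamma).

Definition cderiv (i : 'I_d) a : A := [ffun h => (a h)^`M(i)].
Definition ccomp (n : nat) a : A := [ffun h => pihomog mdeg n (a h)].
Definition cdeg a : nat := \max_h msize (a h).

Lemma cderiv_coef i a h : cderiv i a h = (a h)^`M(i).
Proof. exact: ffunE. Qed.

Lemma ccomp_coef n a h : ccomp n a h = pihomog mdeg n (a h).
Proof. exact: ffunE. Qed.

Lemma crossed_zero_coef h : (0 : A) h = 0.
Proof. exact: ffunE. Qed.

Lemma mul_group_coef g a h : (crossed_group rho g * a) h = sym_act rho g (a (g^-1 * h)%g).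
Proof.
rewrite crossed_mulE crossed_mul_coef (sum_single (g := g)).
  by rewrite crossed_group_coef eqxx mul1r.
by move=> k ne; rewrite crossed_group_coef (negbTE ne) mul0r.
Qed.

Lemma mul_poly_coef p a h : (crossed_poly rho p * a) h = p * a h.
Proof.
rewrite crossed_mulE crossed_mul_coef (sum_single (g := 1%g)).
  by rewrite crossed_poly_coef eqxx sym_act1 invg1 mul1g.
by move=> k ne; rewrite crossed_poly_coef (negbTE ne) mul0r.
Qed.

Lemma dual_coef x h : crossed_dual rho x h = if h == 1%g then linear_form x else 0.
Proof. exact: ffunE. Qed.

Lemma mul_dual_coef x a h : (crossed_dual rho x * a) h = linear_form x * a h.
Proof. exact: mul_poly_coef. Qed.

Lemma mulr_group_coef g a h : (a * crossed_group rho g) h = a (h * g^-1)%g.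
Proof.
rewrite crossed_mulE crossed_mul_coef (sum_single (g := (h * g^-1)%g)).
  by rewrite crossed_group_coef invMg invgK mulgKV eqxx sym_act_one mulr1.
move=> k ne; rewrite crossed_group_coef.
case: eqP => [e|_]; last by rewrite sym_act_zero mulr0.
by case/eqP: ne; rewrite -e invMg invgK mulKVg.
Qed.

Lemma crossed_scalar_coef c a h : (c *: a) h = c *: a h :> {mpoly K[d]}.
Proof. exact: ffunE. Qed.

Lemma crossed_sum_coef (I : Type) (s : seq I) (P : pred I) (F : I -> A) h :
  (\sum_(i <- s | P i) F i) h = \sum_(i <- s | P i) F i h.
Proof.
apply: (big_morph (fun a : A => a h)) => [a b|]; exact: ffunE.
Qed.

Lemma linear_cderiv i : linear (cderiv i).
Proof. by move=> c a b; apply/ffunP => h; rewrite !ffunE linearP. Qed.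

Lemma linear_ccomp n : linear (ccomp n).
Proof. by move=> c a b; apply/ffunP => h; rewrite !ffunE linearP. Qed.

Lemma linear_crossed_dual : linear (crossed_dual rho).
Proof.
move=> c x y; apply/ffunP => h; rewrite !ffunE linear_form_is_linear.
by case: ifP => _; rewrite // scaler0 addr0.
Qed.

Lemma crossed_groupM g h :
  crossed_group rho (g * h)%g = crossed_group rho g * crossed_group rho h.
Proof.
apply/ffunP => k; rewrite mul_group_coef !crossed_group_coef.
have -> : (g^-1 * k == h)%g = (k == g * h)%g.
  by apply/eqP/eqP => [<-|->]; rewrite ?mulKVg ?mulKg.
by case: ifP => _; rewrite ?sym_act_one ?sym_act_zero.
Qed.

Lemma crossed_group1 : crossed_group rho 1%g = 1.
Proof. by []. Qed.

Lemma crossed_dualC x y :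
  crossed_dual rho x * crossed_dual rho y = crossed_dual rho y * crossed_dual rho x.
Proof.
apply/ffunP => h; rewrite [LHS]mul_dual_coef [RHS]mul_dual_coef.
rewrite (dual_coef y) (dual_coef x).
by case: ifP; rewrite ?mulr0 // mulrC.
Qed.

Lemma cderivC i j a : cderiv i (cderiv j a) = cderiv j (cderiv i a).
Proof. by apply/ffunP => h; rewrite !ffunE mderiv_comm. Qed.

Lemma mderiv_linear_form i (x : 'rV[K]_d) : (linear_form x)^`M(i) = (x 0 i)%:MP.
Proof.
rewrite raddf_sum (bigD1 i) //= big1 ?addr0 => [|j ne].
  by rewrite mderivZ mderivX mnm1E eqxx scale1r -[X in (X - _)%MM]add0m addmK mpolyX0 -mul_mpolyC mulr1.
by rewrite mderivZ mderivX mnm1E (negbTE ne) scale0r scaler0.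
Qed.
Lemma cderiv_dual i x a :
  cderiv i (crossed_dual rho x * a) = x 0 i *: a + crossed_dual rho x * cderiv i a.
Proof.
apply/ffunP => h; rewrite cderiv_coef mul_dual_coef.
rewrite crossed_add_coef crossed_scalar_coef.
rewrite mul_dual_coef.
rewrite cderiv_coef.
by rewrite mderivM mderiv_linear_form mul_mpolyC.
Qed.

Lemma cderiv_groupr i a g :
  cderiv i (a * crossed_group rho g) = cderiv i a * crossed_group rho g.
Proof. by apply/ffunP => h; rewrite cderiv_coef !mulr_group_coef cderiv_coef. Qed.

Lemma cderiv_groupl j g a : cderiv j (crossed_group rho g * a) =
  \sum_i rho g^-1%g i j *: (crossed_group rho g * cderiv i a).
Proof.
apply/ffunP => h; rewrite cderiv_coef mul_group_coef crossed_sum_coef mderiv_precomp.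
by apply: eq_bigr => i _; rewrite crossed_scalar_coef mul_group_coef cderiv_coef.
Qed.

Lemma ccomp_ccomp m n a : ccomp m (ccomp n a) = if m == n then ccomp n a else 0.
Proof.
apply/ffunP => h; rewrite !ccomp_coef; case: eqP => [->|/eqP ne]; rewrite ?crossed_zero_coef ?ccomp_coef.
  by rewrite pihomog_id.
by apply: (pihomog_ne0 _ (pihomogP mdeg n (a h))); rewrite eq_sym.
Qed.

Lemma ccomp_sum N a : (cdeg a <= N)%N -> a = \sum_(n < N) ccomp n a.
Proof.
move=> le; apply/ffunP => h; rewrite crossed_sum_coef.
under eq_bigr => n _ do rewrite ccomp_coef.
apply: pihomog_partitionE; apply: leq_trans le.
exact: (leq_bigmax_cond (F := fun h => msize (a h))).
Qed.

Lemma ccomp_dual n x a :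
  ccomp n.+1 (crossed_dual rho x * a) = crossed_dual rho x * ccomp n a.
Proof. by apply/ffunP => h; rewrite ccomp_coef [RHS]mul_dual_coef mul_dual_coef pihomog_linear_form ccomp_coef. Qed.

Lemma ccomp0_dual x a : ccomp 0 (crossed_dual rho x * a) = 0.
Proof. by apply/ffunP => h; rewrite ccomp_coef mul_dual_coef pihomog0_linear_form crossed_zero_coef. Qed.

Lemma ccomp_cderiv n i a : ccomp n (cderiv i a) = cderiv i (ccomp n.+1 a).
Proof. by apply/ffunP => h; rewrite ccomp_coef !cderiv_coef pihomog_mderiv ccomp_coef. Qed.

Lemma cderiv_ccomp0 i a : cderiv i (ccomp 0 a) = 0.
Proof. by apply/ffunP => h; rewrite cderiv_coef ccomp_coef mderiv_pihomog0 crossed_zero_coef. Qed.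

Lemma ccomp_groupl n g a : ccomp n (crossed_group rho g * a) = crossed_group rho g * ccomp n a.
Proof. by apply/ffunP => h; rewrite ccomp_coef [RHS]mul_group_coef mul_group_coef ccomp_coef pihomog_precomp. Qed.

Lemma ccomp_groupr n g a : ccomp n (a * crossed_group rho g) = ccomp n a * crossed_group rho g.
Proof. by apply/ffunP => h; rewrite ccomp_coef !mulr_group_coef ccomp_coef. Qed.

Lemma linear_form_delta (i : 'I_d) : linear_form (delta_mx 0 i : 'rV[K]_d) = 'X_i.
Proof.
rewrite /linear_form (bigD1 i) //= big1 ?addr0 => [|j ne].
  by rewrite mxE !eqxx scale1r.
by rewrite mxE (negbTE ne) andbF scale0r.
Qed.

Lemma euler_ccomp n a :
  \sum_i crossed_dual rho (delta_mx 0 i) * cderiv i (ccomp n a) = n%:R *: ccomp n a.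
Proof.
apply/ffunP => h; rewrite crossed_sum_coef crossed_scalar_coef ccomp_coef -euler_pihomog.
by apply: eq_bigr => i _; rewrite mul_dual_coef cderiv_coef ccomp_coef linear_form_delta.
Qed.

Lemma crossed_group_indep (c : Gamma -> K) :
  \sum_g c g *: crossed_group rho g = 0 -> forall g, c g = 0.
Proof.
move=> s0 g; have := congr1 (fun a : A => (a g)@_0%MM) s0.
rewrite crossed_sum_coef (bigD1 g) //= big1 ?addr0 => [|h ne].
  by rewrite crossed_scalar_coef crossed_group_coef eqxx mcoeffZ mcoeff1 eqxx mulr1 crossed_zero_coef mcoeff0.
by rewrite crossed_scalar_coef crossed_group_coef eq_sym (negbTE ne) scaler0.
Qed.

Lemma ccomp0_one : ccomp 0 1 = 1 :> A.
Proof.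
apply/ffunP => h; rewrite ccomp_coef crossed_one_coef; case: ifP => _; rewrite ?raddf0 //.
by rewrite pihomog_dE //; exact: dhomog1.
Qed.

Lemma ccomp0_span a : ccomp 0 a = a -> exists c : Gamma -> K, a = \sum_g c g *: crossed_group rho g.
Proof.
move=> h; exists (fun g => (a g)@_0%MM); apply/ffunP => g.
rewrite crossed_sum_coef (bigD1 g) //= big1 ?addr0 => [|k ne].
  rewrite crossed_scalar_coef crossed_group_coef eqxx -mul_mpolyC mulr1.
  by apply: pihomog_const; move: (congr1 (fun b : A => b g) h); rewrite /= ccomp_coef.
by rewrite crossed_scalar_coef crossed_group_coef eq_sym (negbTE ne) scaler0.
Qed.

Local Notation act := (dual_act rho).

(** The first coefficient m of the product is bilinear over the group algebra,
    and its antisymmetrization on V^* is the sum of the pi_g g; so m itself is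
    a representative from which the class can be read. *)
Theorem quantizable_of_PBW (B : 'M[K]_d)
    (pi : Gamma -> 'rV[K]_d -> 'rV[K]_d -> 'rV[K]_d)
    (kap : Gamma -> 'rV[K]_d -> 'rV[K]_d -> K^o) :
  (forall g y, linear (fun x => pi g x y)) ->
  (forall g x y, pi g x y = - pi g y x) ->
  (forall g h x y, pi (g * h * g^-1)%g (act g x) (act g y) = act g (pi h x y)) ->
  (forall g y, linear (fun x => kap g x y)) ->
  (forall g x y, kap g x y = - kap g y x) ->
  (forall g h x y, kap (g * h * g^-1)%g (act g x) (act g y) = kap h x y) ->
  (forall g, g != 1%g -> exists om : 'rV[K]_d -> 'rV[K]_d -> K, exists lam,
     (forall x y, pi g x y = om x y *: lam) /\
     forall x y z, om y z *: (act g x - x) + om z x *: (act g y - y)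
                  + om x y *: (act g z - z) = 0) ->
  (forall g x y z, poisson_bracket rho pi g x y z =
     (kap g y z *: (x - act g x) + kap g z x *: (y - act g y)
      + kap g x y *: (z - act g z)) *+ 2) ->
  (forall g, (forall x y z, const_bracket (fun g => rho g^-1%g) pi kap g x y z = 0) \/
     (3 < \rank (rho g^-1%g - 1%:M)%R)%N) ->
  (forall g x, pr rho B g (fun y : 'I_2 -> 'rV[K]_d => linear_form (pi g (y 0) (y 1))) x
     = linear_form (pi g (x 0) (x 1))) ->
  quantizable rho B (fun g x y => linear_form (pi g x y)).
Proof.
move=> pil pia pii kl ka ki quad jac kb prE.
have [m [m_linl m_linr m_0 m_assoc [mt mtm mtr mcomm]]] :=
  PBW_coefficients (r := fun g => rho g^-1%g) (v := crossed_dual rho)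
    (t := crossed_group rho) (D := cderiv) (cp := ccomp) (sz := cdeg)
    linear_crossed_dual crossed_dualC crossed_groupM crossed_group1
    (etrans (congr1 rho (invg1 _)) (repr_mx1 rho)) (@crossed_group_dual _ _ _ rho)
    linear_cderiv cderivC cderiv_dual cderiv_groupr cderiv_groupl
    linear_ccomp ccomp_ccomp ccomp_sum ccomp_dual ccomp0_dual ccomp_cderiv cderiv_ccomp0
    ccomp_groupl ccomp_groupr euler_ccomp pil pia pii kl ka ki crossed_group_indep
    ccomp0_one quad jac kb ccomp0_span.
have coefE : star_coef (fps_star m) 1 = m 1.
  apply: functional_extensionality => a; apply: functional_extensionality => b.
  exact: fps_star_const.
exists (fps_star m); rewrite coefE; split.
- exact: fps_star_product.
- exact: cocycle_of_coef1.
exists (m 1); split.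
- exact: cocycle_of_coef1.
- by move=> g a b; split; [exact: mt | exact: mtm | exact: mtr].
- exists (fun _ => 0); first exact: linear_zerof.
  move=> a b; transitivity (0 : A); first exact: subrr.
  by rewrite mulr0 mul0r subr0 addr0.
move=> g x; rewrite -prE; congr (pr _ _ _ _ _).
apply: functional_extensionality => y; rewrite mcomm crossed_sum_coef (bigD1 g) //=.
rewrite mul_dual_coef crossed_group_coef eqxx mulr1 big1 ?addr0 // => h ne.
by rewrite mul_dual_coef crossed_group_coef eq_sym (negbTE ne) mulr0.
Qed.

End CrossedCalculus.

(** * Reflections and pointwise stabilizers *)

(** Sylvester's identity: both sides are the determinant of the block matrix
    (1, -B; A, 1). *)
Lemma det_1_mulC (C : comNzRingType) m n (A : 'M[C]_(m, n)) (B : 'M[C]_(n, m)) :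
  \det (1%:M + A *m B) = \det (1%:M + B *m A).
Proof.
have e1 : block_mx 1%:M (- B) A 1%:M =
    block_mx 1%:M 0 A 1%:M *m block_mx 1%:M (- B) 0 (1%:M + A *m B).
  rewrite mulmx_block !mul1mx !mul0mx !mulmx1 ?mulmx0 ?addr0 mulmxN; congr block_mx.
  by rewrite addrCA addNr addr0.
have e2 : block_mx 1%:M (- B) A 1%:M =
    block_mx 1%:M (- B) 0 1%:M *m block_mx (1%:M + B *m A) 0 A 1%:M.
  rewrite mulmx_block !mul1mx !mul0mx !mulmx1 ?mulmx0 ?add0r mulNmx; congr block_mx.
  by rewrite addrK.
have := congr1 determinant e1; rewrite {1}e2 !det_mulmx !det_ublock !det_lblock !det1.
by rewrite !mul1r !mulr1 => ->.
Qed.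

Lemma mxtrace_idem (C : fieldType) n (E : 'M[C]_n) : E *m E = E -> \tr E = (\rank E)%:R.
Proof.
move=> EE; have := mulmx_base E; have := row_base_free E; have := col_base_full E.
move: (\rank E) (row_base E) (col_base E) => k rb cb /row_fullP[u uE] fr base.
have idr : rb *m cb = 1%:M.
  apply: (row_free_inj fr); rewrite mul1mx.
  have := congr1 (mulmx u) EE; rewrite -base -!mulmxA (mulmxA u cb) uE mul1mx.
  by rewrite (mulmxA u cb) uE mul1mx.
by rewrite -base mxtrace_mulC idr mxtrace1.
Qed.

Section Representation.
Variables (F : fieldType) (Gamma : finGroupType) (n : nat).
Variable r : mx_representation F [set: Gamma] n.
Implicit Types g h : Gamma.

Lemma repr_mulg g h : r (g * h)%g = r g *m r h.
Proof. by rewrite repr_mxM ?inE. Qed.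

Lemma repr_oneg : r 1%g = 1%:M.
Proof. exact: repr_mx1. Qed.

Lemma repr_mulgV g : r g *m r g^-1%g = 1%:M.
Proof. by rewrite -repr_mulg mulgV repr_oneg. Qed.

Lemma repr_mulVg g : r g^-1%g *m r g = 1%:M.
Proof. by rewrite -repr_mulg mulVg repr_oneg. Qed.

End Representation.

Section Reflections.
Variables (C : numFieldType) (Gamma : finGroupType) (n : nat).
Variable r : mx_representation C [set: Gamma] n.
Hypothesis r_faithful : forall g, r g = 1%:M -> g = 1%g.
Implicit Types (g h u s t q : Gamma) (y : 'rV[C]_n).

(** Matrices act on row vectors from the right, so the rows of r g - 1 span
    the displacements of these vectors. *)
Definition fix_codim g := \rank (r g - 1%:M).
Local Notation rk := fix_codim.

Lemma fix_codim_gt0 g : g != 1%g -> (0 < rk g)%N.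
Proof.
move=> ne; rewrite lt0n mxrank_eq0 subr_eq0; apply/eqP => e.
by rewrite (r_faithful e) eqxx in ne.
Qed.

(** The powers of g are 1 + k N, and g has finite order. *)
Lemma unipotent_one g : (r g - 1%:M) *m (r g - 1%:M) = 0 -> g = 1%g.
Proof.
set N := r g - 1%:M => N2; have rE : r g = 1%:M + N by rewrite addrC subrK.
have rX k : r (g ^+ k)%g = 1%:M + k%:R *: N.
  elim: k => [|k IH]; first by rewrite expg0 repr_oneg scale0r addr0.
  rewrite expgS repr_mulg IH rE mulmxDl !mulmxDr !mul1mx mulmx1 -scalemxAr N2 scaler0 addr0.
  by rewrite -addrA -[k.+1]addn1 natrD scalerDl scale1r [X in _ + X]addrC.
have /eqP : #[g]%g%:R *: N = 0.
  by apply: (addrI 1%:M); rewrite -rX expg_order repr_oneg addr0.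
rewrite scaler_eq0 pnatr_eq0 -[#[g]%g == 0%N]negbK -lt0n order_gt0 /= => /eqP N0.
by apply: r_faithful; rewrite rE N0 addr0.
Qed.

Lemma rank1_det1_one u : (rk u <= 1)%N -> \det (r u) = 1 -> u = 1%g.
Proof.
move=> rk1 detu; have [//|ne] := eqVneq u 1%g.
have {rk1} rk1 : rk u = 1%N by apply/eqP; rewrite eqn_leq rk1 fix_codim_gt0.
apply: unipotent_one; rewrite -(mulmx_base (r u - 1%:M)) mulmxA -(mulmxA (col_base _)).
suff -> : row_base (r u - 1%:M) *m col_base (r u - 1%:M) = 0 by rewrite mulmx0 mul0mx.
move: (row_base _) (col_base _) (mulmx_base (r u - 1%:M)); rewrite -/(rk u) rk1 => v c cv.
have := detu; rewrite -[r u](subrK 1%:M) addrC -cv det_1_mulC det_mx11 mxE !mxE eqxx.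
move/eqP; rewrite -[X in _ == X]addr0 (inj_eq (addrI _)) => /eqP e.
by apply/matrixP => i j; rewrite !ord1 !mxE.
Qed.

Variable gam : Gamma.
(** Pointwise stabilizer of the column vectors fixed by gam, written in terms
    of the displacements of row vectors; pstab1 is its subgroup of determinant
    one. *)
Definition pstab : {set Gamma} := [set g | (r g - 1%:M <= r gam - 1%:M)%MS].
Definition pstab1 : {set Gamma} := [set g in pstab | \det (r g) == 1].

Lemma pstab_sub g h : g \in pstab -> h \in pstab -> (r (g * h)%g - 1%:M <= r gam - 1%:M)%MS.
Proof.
rewrite !inE => hg hh.
have -> : r (g * h)%g - 1%:M = (r g - 1%:M) *m (r h - 1%:M) + (r g - 1%:M) + (r h - 1%:M).
  by rewrite repr_mulg mulmxBl !mulmxBr !mulmx1 mul1mx; zmod.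
by apply: addmx_sub => //; apply: addmx_sub => //; apply: mulmx_sub.
Qed.

Lemma group_set_pstab : group_set pstab.
Proof.
apply/group_setP; split; first by rewrite inE repr_oneg subrr sub0mx.
by move=> g h hg hh; rewrite inE pstab_sub.
Qed.
Canonical pstab_group := Group group_set_pstab.

Lemma group_set_pstab1 : group_set pstab1.
Proof.
apply/group_setP; split; first by rewrite inE group1 repr_oneg det1 eqxx.
move=> g h /setIdP[hg /eqP dg] /setIdP[hh /eqP dh].
by rewrite inE groupM //= repr_mulg det_mulmx dg dh mulr1.
Qed.
Canonical pstab1_group := Group group_set_pstab1.
Local Notation P := pstab_group.
Local Notation P0 := pstab1_group.

Lemma gam_pstab : gam \in P. Proof. by rewrite inE submx_refl. Qed.

Lemma pstab1_sub g : g \in P0 -> g \in P. Proof. by case/setIdP. Qed.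

Lemma pstab1_det g h : g \in P -> h \in P -> \det (r g) = \det (r h) -> (g^-1 * h)%g \in P0.
Proof.
move=> gP hP e; rewrite inE groupM ?groupV //= repr_mulg det_mulmx -e -det_mulmx.
by rewrite repr_mulVg det1.
Qed.

Lemma det_conj g h : \det (r (h ^ g)%g) = \det (r h).
Proof.
rewrite conjgE !repr_mulg !det_mulmx mulrC -mulrA -det_mulmx repr_mulgV det1 mulr1.
by [].
Qed.

Lemma pstab1_J u g : u \in P0 -> g \in P -> (u ^ g)%g \in P0.
Proof.
move=> /setIdP[uP du] gP; rewrite inE det_conj du andbT.
by rewrite groupJ.
Qed.

(** Projection onto the fixed vectors of H. *)
Definition avg (H : {group Gamma}) : 'M[C]_n := #|H|%:R^-1 *: \sum_(g in H) r g.

Lemma card_neq0 (H : {group Gamma}) : (#|H|%:R : C) != 0.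
Proof. by rewrite pnatr_eq0 -lt0n cardG_gt0. Qed.

Lemma avg_mulr (H : {group Gamma}) g : g \in H -> avg H *m r g = avg H.
Proof.
move=> hg; rewrite -scalemxAl mulmx_suml; congr (_ *: _).
rewrite [RHS](reindex_inj (mulIg g)) /=; apply: eq_big => [h|h _]; last by rewrite repr_mulg.
by rewrite groupMr.
Qed.

Lemma avg_mull (H : {group Gamma}) g : g \in H -> r g *m avg H = avg H.
Proof.
move=> hg; rewrite -scalemxAr mulmx_sumr; congr (_ *: _).
rewrite [RHS](reindex_inj (mulgI g)) /=; apply: eq_big => [h|h _]; last by rewrite repr_mulg.
by rewrite groupMl.
Qed.

Lemma avg_fixed (H : {group Gamma}) m (Y : 'M_(m, n)) :
  (forall g, g \in H -> Y *m r g = Y) -> Y *m avg H = Y.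
Proof.
move=> fixY; rewrite -scalemxAr mulmx_sumr (eq_bigr (fun _ => Y)) //.
by rewrite sumr_const -scaler_nat scalerA mulVf ?card_neq0 // scale1r.
Qed.

Lemma avg_idem (H : {group Gamma}) : avg H *m avg H = avg H.
Proof. by apply: avg_fixed => g; exact: avg_mulr. Qed.

Lemma one_sub_avg (H : {group Gamma}) : H \subset P -> (1%:M - avg H <= r gam - 1%:M)%MS.
Proof.
move=> sH; have -> : 1%:M - avg H = - (#|H|%:R^-1 *: \sum_(g in H) (r g - 1%:M)).
  rewrite sumrB sumr_const -scaler_nat scalerBr scalerA mulVf ?card_neq0 // scale1r.
  by rewrite opprB.
rewrite eqmx_opp scalemx_sub // summx_sub // => g gH.
by have := subsetP sH g gH; rewrite inE.
Qed.

Lemma rank_avg : (n - rk gam <= \rank (avg P))%N.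
Proof.
have := mxrankS (one_sub_avg (subxx _)); rewrite -/(rk gam) => le2.
have := mxrank_add (avg P) (1%:M - avg P); rewrite addrC subrK mxrank1 => le3.
by rewrite leq_subLR addnC; apply: (leq_trans le3); rewrite leq_add2l.
Qed.

Lemma fixed_by_pstab u y : u \in P -> rk u = rk gam -> y *m r u = y ->
  forall g, g \in P -> y *m r g = y.
Proof.
move=> uP rku yu g gP.
have le : (avg P <= kermx (r u - 1%:M))%MS.
  by apply/sub_kermxP; rewrite mulmxBr mulmx1 avg_mulr // subrr.
have eqE : (avg P == kermx (r u - 1%:M))%MS.
  rewrite -(mxrank_leqif_eq le) mxrank_ker -/(rk u) rku eqn_leq rank_avg andbT.
  by have := mxrankS le; rewrite mxrank_ker -/(rk u) rku.
have : (y <= kermx (r u - 1%:M))%MS.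
  by apply/sub_kermxP; rewrite mulmxBr mulmx1 yu subrr.
rewrite -(eqmxP eqE) => /submxP[a ->].
by rewrite -mulmxA avg_mulr.
Qed.

Hypothesis rk_gam : rk gam = 2%N.

Lemma fix_codim_pstab1 u : u \in P0 -> u != 1%g -> rk u = 2%N.
Proof.
move=> /setIdP[]; rewrite inE => uP /eqP du ne; apply/eqP; rewrite eqn_leq -{1}rk_gam mxrankS //=.
by rewrite ltnNge; apply: contra ne => le; apply/eqP; exact: rank1_det1_one.
Qed.

Lemma pstab1_eqmx u : u \in P0 -> u != 1%g -> (r u - 1%:M :=: r gam - 1%:M)%MS.
Proof.
move=> uP ne; apply/eqmxP; rewrite -mxrank_leqif_eq.
  by rewrite -!/(rk _) rk_gam fix_codim_pstab1.
by case/setIdP: uP; rewrite inE.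
Qed.

(** A matrix of rank one is a column times a row, and both formulas are about
    the scalar product of these two. *)
Lemma rank1_trace q : rk q = 1%N ->
  (r q - 1%:M) *m (r q - 1%:M) = \tr (r q - 1%:M) *: (r q - 1%:M) /\
  \det (r q) = 1 + \tr (r q - 1%:M).
Proof.
move=> rk1; have rE : r q = 1%:M + (r q - 1%:M) by rewrite addrC subrK.
move: rE (mulmx_base (r q - 1%:M)); move: (row_base _) (col_base _).
rewrite -/(rk q) rk1; move: (r q - 1%:M) => N v c rE cv; rewrite -cv in rE *.
rewrite mxtrace_mulC /mxtrace big_ord1; set k := (v *m c) 0 0.
have vc : v *m c = k%:M by apply/matrixP => i j; rewrite !ord1 [RHS]mxE eqxx mulr1n.
split; last by rewrite rE det_1_mulC vc det_mx11 !mxE eqxx.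
by rewrite mulmxA -(mulmxA c) vc mul_mx_scalar scalemxAl.
Qed.

Lemma mxtrace_conj u q : \tr (r (u * q * u^-1)%g) = \tr (r q).
Proof. by rewrite !repr_mulg mxtrace_mulC mulmxA repr_mulVg mul1mx. Qed.

(** Together with the rotations, which are the elements of pstab1, q generates
    a dihedral group: it is an involution that inverts them and is conjugate
    to its products with them. *)
Definition dihedral_reflection q := [/\ (q * q = 1)%g, \det (r q) = -1,
  forall u, u \in P0 -> (q * u * q = u^-1)%g &
  forall w, w \in P0 -> exists2 u, u \in P0 & (q * w = u * q * u^-1)%g].

(** As q commutes with no rotation but 1, the map sending u to its commutator
    with q is a bijection of the rotations, hence every q w is conjugate to q.
    So q has the same trace as its average over the coset q P0, which is the
    trace of avg P0, namely n - 2. For a reflection this means that the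
    eigenvalue is -1. *)
Lemma reflection_involution q u0 : q \in P -> rk q = 1%N -> u0 \in P0 -> u0 != 1%g ->
  (forall u, u \in P0 -> (u * q = q * u)%g -> u = 1%g) -> dihedral_reflection q.
Proof.
move=> qP rkq u0P u01 cent.
pose phi u := ((u ^ q) * u^-1)%g.
have phiP u : u \in P0 -> phi u \in P0 by move=> uP; rewrite groupM ?groupV // pstab1_J.
have phi_inj : {in P0 &, injective phi}.
  move=> u v uP vP e; have e1 : (v^-1 * u = 1)%g; last by apply: (mulgI v^-1%g); rewrite e1 mulVg.
  apply: cent; first by rewrite groupM ?groupV.
  rewrite conjgC; congr (q * _)%g; rewrite conjMg conjVg.
  have -> : (u ^ q)%g = (v ^ q * (v^-1 * u))%g; last by rewrite mulKg.
  by rewrite mulgA -[(v ^ q * _)%g]/(phi v) -e mulgKV.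
have phi_im : phi @: P0 = P0.
  apply/eqP; rewrite eqEcard (card_in_imset phi_inj) leqnn andbT.
  by apply/subsetP => _ /imsetP[u uP ->]; exact: phiP.
have qwE w : w \in P0 -> exists2 u, u \in P0 & (q * w = u * q * u^-1)%g.
  by rewrite -{1}phi_im => /imsetP[u uP ->]; exists u => //; rewrite /phi conjgE !mulgA mulgV mul1g.
have Nu0 : (r u0 - 1%:M) *m avg P0 = 0 by rewrite mulmxBl mul1mx avg_mull // subrr.
have Nq0 : (r q - 1%:M) *m avg P0 = 0.
  have : (r q - 1%:M <= r u0 - 1%:M)%MS.
    by rewrite (pstab1_eqmx u0P u01); move: qP; rewrite inE.
  by case/submxP => a ->; rewrite -mulmxA Nu0 mulmx0.
have trq : \tr (r q) = \tr (avg P0).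
  have -> : \tr (avg P0) = \tr (r q *m avg P0).
    by apply/eqP; rewrite -subr_eq0 -raddfB /= -{1}[avg P0]mul1mx -mulmxBl -opprB mulNmx Nq0 oppr0 raddf0.
  rewrite /avg -scalemxAr mxtraceZ mulmx_sumr raddf_sum /=.
  rewrite (eq_bigr (fun=> \tr (r q))).
    by rewrite sumr_const -[X in _ * X]mulr_natl mulrA mulVf ?mul1r // card_neq0.
  by move=> w /qwE[u _ e]; rewrite -repr_mulg e mxtrace_conj.
have tr2 : \tr (1%:M - avg P0) = 2%:R.
  rewrite mxtrace_idem; last first.
    by rewrite mulmxBl mul1mx mulmxBr mulmx1 avg_idem subrr subr0.
  congr _%:R; apply/eqP; rewrite eqn_leq; apply/andP; split.
    by rewrite -rk_gam; apply: mxrankS; apply: one_sub_avg; apply/subsetP => g; exact: pstab1_sub.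
  rewrite -(fix_codim_pstab1 u0P u01); apply: mxrankS; apply/submxP.
  by exists (r u0 - 1%:M); rewrite mulmxBr mulmx1 Nu0 subr0.
have trN : \tr (r q - 1%:M) = -2%:R.
  by rewrite raddfB /= trq -tr2 raddfB /= opprB.
have [NN dq] := rank1_trace rkq.
have qq : (q * q = 1)%g.
  have rE : r q = 1%:M + (r q - 1%:M) by rewrite addrC subrK.
  apply: r_faithful; rewrite repr_mulg rE; move: (r q - 1%:M) NN trN => N NN trN.
  by rewrite mulmxDl !mulmxDr !mulmx1 !mul1mx NN trN scaleNr scaler_nat; zmod.
split=> //; first by rewrite dq trN; rewrite -[2%:R]/(1 + 1); zmod.
move=> u /qwE[v _ e]; apply: (mulIg u); rewrite mulVg -(mulgA (q * u)%g) e.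
by rewrite -!mulgA mulKg (mulgA q) qq mul1g mulgV.
Qed.

(** A displacement is killed by averaging. *)
Lemma moved_fixed_eq0 y g : g \in P ->
  (forall h, h \in P -> (y *m (r g - 1%:M)) *m r h = y *m (r g - 1%:M)) ->
  y *m (r g - 1%:M) = 0.
Proof.
move=> gP /avg_fixed <-.
by rewrite -mulmxA mulmxBl mul1mx avg_mull // subrr mulmx0.
Qed.

Section Pair.
Variables (s t : Gamma) (lam : 'rV[C]_n).
Hypotheses (gamE : gam = (s * t)%g) (rk_s : rk s = 1%N) (rk_t : rk t = 1%N).
Hypothesis lam_cent : forall g, (g * t = t * g)%g -> lam *m r g = lam.
Hypothesis lam_moved : lam *m r gam != lam.

(** The displacements of s t lie in the sum of those of s and t, which has
    dimension at most two, like that of gam. *)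
Lemma pair_in_pstab : s \in P /\ t \in P.
Proof.
have le : (r gam - 1%:M <= (r s - 1%:M) + (r t - 1%:M))%MS.
  have -> : r gam - 1%:M = (r s - 1%:M) + ((r s - 1%:M) *m (r t - 1%:M) + (r t - 1%:M)).
    by rewrite gamE repr_mulg mulmxBl !mulmxBr !mulmx1 mul1mx; zmod.
  apply: addmx_sub_adds => //; apply: addmx_sub => //; exact: submxMl.
have eq : (r gam - 1%:M == (r s - 1%:M) + (r t - 1%:M))%MS.
  rewrite -(mxrank_leqif_eq le) -/(rk gam) rk_gam eqn_leq.
  rewrite -{1}rk_gam mxrankS //=; apply: (leq_trans (mxrank_adds_leqif _ _)).
  by rewrite -/(rk s) -/(rk t) rk_s rk_t.
by rewrite !inE !(eqmxP eq) addsmxSl addsmxSr.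
Qed.

(** A rotation u <> 1 has the same fixed space as gam. If it commuted with t,
    it would fix lam, and so would gam. *)
Lemma cent_pstab1 u : u \in P0 -> (u * t = t * u)%g -> u = 1%g.
Proof.
move=> uP c; apply/eqP/negPn/negP => ne; case/eqP: lam_moved.
exact: (fixed_by_pstab (pstab1_sub uP) (etrans (fix_codim_pstab1 uP ne) (esym rk_gam)) (lam_cent c) gam_pstab).
Qed.

Lemma pstab1_nontrivial : exists2 u, u \in P0 & u != 1%g.
Proof.
have [sP tP] := pair_in_pstab.
exists (t^-1 * (s * t * s^-1))%g.
  apply: pstab1_det => //; first by rewrite !groupM ?groupV.
  by rewrite !repr_mulg !det_mulmx mulrC mulrA -det_mulmx repr_mulVg det1 mul1r.
rewrite -eq_mulVg1; apply: contra lam_moved => /eqP e.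
have c : (s * t = t * s)%g by rewrite {2}e mulgKV.
by rewrite gamE repr_mulg mulmxA lam_cent // lam_cent.
Qed.

Lemma pair_dihedral_reflection : dihedral_reflection t.
Proof.
have [u uP ne] := pstab1_nontrivial; have [_ tP] := pair_in_pstab.
exact: (reflection_involution tP rk_t uP ne cent_pstab1).
Qed.

Lemma moved_by u : u \in P0 -> u != 1%g -> lam *m (r u - 1%:M) != 0.
Proof.
move=> uP ne; apply: contra lam_moved => /eqP; rewrite mulmxBr mulmx1 => /subr0_eq e.
by rewrite (fixed_by_pstab (pstab1_sub uP) (etrans (fix_codim_pstab1 uP ne) (esym rk_gam)) e gam_pstab).
Qed.

Lemma rank_pair (y z : 'rV[C]_n) : y != 0 -> ~~ (z <= y)%MS -> (1 < \rank (col_mx y z))%N.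
Proof.
move=> y0 zy; rewrite -addsmxE; have : (y < y + z)%MS.
  by rewrite /ltmx addsmxSl; apply: contra zy => /(submx_trans (addsmxSr _ _)).
by rewrite ltmxErank rank_rV y0 => /andP[].
Qed.

(** Suppose v <> 1. Then rr fixes the displacement eta = lam (v - 1) as well
    as eta v. If these two span the plane, then rr is trivial there. If they
    are proportional, eta is an eigenvector of v, and comparing with t, which
    inverts v, gives the eigenvalue 1 or -1; then v v fixes eta, and this is
    excluded. *)
Lemma cent_reflection rr v : rr \in P -> rr != 1%g -> lam *m r rr = lam ->
  v \in P0 -> (v * rr = rr * v)%g -> v = 1%g.
Proof.
move=> rP rne lr vP c; apply/eqP/negPn/negP => vne.
have [tt _ inv _] := pair_dihedral_reflection.
set eta := lam *m (r v - 1%:M); have eta0 : eta != 0 by exact: moved_by.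
have cr : r v *m r rr = r rr *m r v by rewrite -!repr_mulg c.
have er : eta *m r rr = eta.
  by rewrite /eta !mulmxBr !mulmx1 mulmxBl -mulmxA cr mulmxA lr.
have ev : eta *m r v = lam *m r v *m (r v - 1%:M).
  by rewrite /eta mulmxBr mulmx1 mulmxBl mulmxBr mulmx1.
have evr : eta *m r v *m r rr = eta *m r v by rewrite -mulmxA cr mulmxA er.
have vv1 : (v * v != 1)%g.
  apply: contra vne => /eqP vv; apply/eqP; apply: cent_pstab1 => //.
  have vi : (v^-1 = v)%g by apply: (mulgI v); rewrite mulgV.
  by have := inv v vP; rewrite vi => {1}<-; rewrite -!mulgA tt mulg1.
have [dep|indep] := boolP (eta *m r v <= eta)%MS.
  have /sub_rVP[e ee] := dep.
  have e0 : e != 0.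
    apply: contra eta0 => /eqP z; have := congr1 (mulmx^~ (r v^-1%g)) ee.
    by rewrite z scale0r mul0mx -mulmxA repr_mulgV mulmx1 => ->.
  have evi : eta *m r v^-1%g = e^-1 *: eta.
    rewrite -[eta in LHS]scale1r -(mulVf e0) -scalerA -ee -scalemxAl -mulmxA repr_mulgV.
    by rewrite mulmx1.
  have vt : (v * t = t * v^-1)%g by rewrite -(inv v vP) !mulgA tt mul1g.
  have lt : lam *m r t = lam by exact: lam_cent.
  have et : eta *m r t = - (e^-1 *: eta).
    rewrite -evi /eta !mulmxBr !mulmx1 !mulmxBl -!mulmxA -!repr_mulg vt repr_mulg mulmxA lt.
    by rewrite mulgV repr_oneg mulmx1 opprB.
  have e2 : e * e = 1.
    have : eta *m r (v * t)%g = eta *m r (t * v^-1)%g by rewrite vt.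
    rewrite !repr_mulg !mulmxA ee -scalemxAl !et mulNmx -scalemxAl evi scalerN !scalerA divff //.
    rewrite scale1r => /oppr_inj h; have := congr1 (GRing.scale (e * e)) h.
    rewrite [in RHS]scalerA mulrACA !divff // mulr1 scale1r => h2.
    apply/eqP; rewrite -subr_eq0; have : (e * e - 1) *: eta = 0.
      by rewrite scalerBl scale1r h2 subrr.
    by move/eqP; rewrite scaler_eq0 (negbTE eta0) orbF.
  have evv : eta *m r (v * v)%g = eta by rewrite repr_mulg mulmxA ee -scalemxAl ee scalerA e2 scale1r.
  have vvP : (v * v)%g \in P0 by rewrite groupM.
  have fx := fixed_by_pstab (pstab1_sub vvP) (etrans (fix_codim_pstab1 vvP vv1) (esym rk_gam)) evv.
  by case/eqP: eta0; apply: moved_fixed_eq0 fx; exact: pstab1_sub.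
have rk2 := rank_pair eta0 indep.
set U := col_mx eta (eta *m r v) in rk2.
have Ule : (U <= r v - 1%:M)%MS by rewrite col_mx_sub ev /eta !submxMl.
have Ueq : (U == r v - 1%:M)%MS.
  rewrite -(mxrank_leqif_eq Ule) -/(rk v) (fix_codim_pstab1 vP vne) eqn_leq rk2 andbT.
  by have := mxrankS Ule; rewrite -/(rk v) (fix_codim_pstab1 vP vne).
case/eqP: rne; apply: unipotent_one.
have /submxP[a {1}->] : (r rr - 1%:M <= U)%MS.
  by rewrite (eqmxP Ueq) (pstab1_eqmx vP vne); move: rP; rewrite inE.
rewrite -mulmxA /U mul_col_mx !mulmxBr !mulmx1 er evr !subrr.
by rewrite col_mx0 mulmx0.
Qed.

(** The conjugate of t by s is also its conjugate by a rotation u, so that rr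
    = u^-1 s commutes with t and fixes lam. It is a reflection, to which
    reflection_involution applies. So s, which has the same determinant as rr,
    has determinant -1, like t. *)
Lemma gam_pstab1 : gam \in P0.
Proof.
have [sP tP] := pair_in_pstab; have [tt dt inv qw] := pair_dihedral_reflection.
have [u0 u0P u01] := pstab1_nontrivial.
have wP : (t^-1 * (s * t * s^-1))%g \in P0.
  apply: pstab1_det => //; first by rewrite !groupM ?groupV.
  by rewrite !repr_mulg !det_mulmx mulrC mulrA -det_mulmx repr_mulVg det1 mul1r.
have [u uP] := qw _ wP; rewrite mulKVg => e.
set rr := (u^-1 * s)%g.
have rrP : rr \in P by rewrite groupM // groupV; exact: pstab1_sub.
have du : \det (r u) = 1 by case/setIdP: uP => _ /eqP.
have drr : \det (r rr) = \det (r s).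
  have : \det (r s) = \det (r (u * rr)%g) by rewrite mulKVg.
  by rewrite repr_mulg det_mulmx du mul1r.
have ds : \det (r s) != 1.
  apply/eqP => d1; have s1 := rank1_det1_one (eq_leq rk_s) d1.
  by move: rk_s; rewrite /rk s1 repr_oneg subrr mxrank0.
have rne : rr != 1%g.
  by apply: contra ds => /eqP r1'; rewrite -drr r1' repr_oneg det1.
have rc : (rr * t = t * rr)%g.
  apply: (mulgI u); apply: (mulIg s^-1%g).
  by rewrite !mulgA /rr mulgV mul1g e -!mulgA mulgV mulg1.
have lr := lam_cent rc.
have rkr : rk rr = 1%N.
  apply/eqP; rewrite eqn_leq fix_codim_gt0 // andbT.
  have le : (avg P + lam <= kermx (r rr - 1%:M))%MS.
    rewrite addsmx_sub; apply/andP; split; apply/sub_kermxP.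
      by rewrite mulmxBr mulmx1 avg_mulr // subrr.
    by rewrite mulmxBr mulmx1 lr subrr.
  have lt : (avg P < avg P + lam)%MS.
    rewrite /ltmx addsmxSl; apply: contra lam_moved => /(submx_trans (addsmxSr _ _)).
    by case/submxP => a ->; rewrite -mulmxA avg_mulr // gam_pstab.
  have := mxrankS le; rewrite mxrank_ker -/(rk rr) => le1.
  move: lt; rewrite ltmxErank => /andP[_ lt1].
  have n2 : (2 <= n)%N by rewrite -rk_gam rank_leq_row.
  have rn : (rk rr <= n)%N by rewrite rank_leq_row.
  move: (leq_ltn_trans rank_avg (leq_trans lt1 le1)) n2 rn; rewrite rk_gam.
  by move: (rk rr) => k; clear; lia.
have [_ dr _ _] := reflection_involution rrP rkr u0P u01
   (fun v vP c => cent_reflection rrP rne lr vP c).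
rewrite inE gam_pstab gamE repr_mulg det_mulmx -drr dr dt mulrNN mulr1 eqxx.
by [].
Qed.

End Pair.

End Reflections.

Section Factors.
Variables (C : numFieldType) (Gamma : finGroupType) (n : nat).
Variable r : mx_representation C [set: Gamma] n.

(** If a and b have different displacement lines, a vector fixed by a b is
    fixed by both, and the fixed vectors of a b and of b have the same
    dimension. *)
Lemma fixed_by_factor (a b : Gamma) (y : 'rV[C]_n) :
  fix_codim r a = 1%N -> fix_codim r b = 1%N -> fix_codim r (a * b)%g = 1%N -> y *m r b = y -> y *m r a = y.
Proof.
move=> ra rb rab yb.
have [le|nle] := boolP (r a - 1%:M <= r b - 1%:M)%MS.
  apply: (fixed_by_pstab (gam := b) (u := b)) => //; last by rewrite inE.
  exact: gam_pstab.
have cap0 : ((r a - 1%:M) :&: (r b - 1%:M))%MS = 0.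
  apply/eqP; rewrite -mxrank_eq0; apply: contraNT nle; rewrite -lt0n => rc.
  have eqr := mxrank_leqif_sup (capmxSl (r a - 1%:M) (r b - 1%:M)).
  apply: submx_trans (capmxSr (r a - 1%:M) (r b - 1%:M)).
  by rewrite -eqr eqn_leq mxrankS ?capmxSl //= -/(fix_codim r a) ra.
set N := kermx (r (a * b)%g - 1%:M).
have Nab : N *m r a *m r b = N.
  have : N *m (r (a * b)%g - 1%:M) = 0 by rewrite mulmx_ker.
  by rewrite mulmxBr mulmx1 repr_mulg mulmxA => /subr0_eq.
have Na : N *m (r a - 1%:M) = 0.
  apply/eqP; rewrite -submx0 -cap0 sub_capmx submxMl /=.
  have -> : N *m (r a - 1%:M) = - (N *m r a) *m (r b - 1%:M).
    by rewrite mulmxBr mulmx1 mulmxBr mulmx1 mulNmx Nab; zmod.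
  exact: submxMl.
have Nb : N *m (r b - 1%:M) = 0.
  move: Na; rewrite mulmxBr mulmx1 => /subr0_eq Na.
  by rewrite mulmxBr mulmx1 -[X in X *m r b]Na Nab subrr.
have le : (N <= kermx (r b - 1%:M))%MS by apply/sub_kermxP.
have eq : (N == kermx (r b - 1%:M))%MS.
  by rewrite -(mxrank_leqif_eq le) !mxrank_ker -!/(fix_codim r _) rab rb.
have : (y <= N)%MS.
  by rewrite (eqmxP eq); apply/sub_kermxP; rewrite mulmxBr mulmx1 yb subrr.
case/submxP => d ->; have := congr1 (mulmx d) Na.
by rewrite mulmx0 mulmxA mulmxBr mulmx1 => /subr0_eq.
Qed.

End Factors.

(** * Fixed spaces for an invariant inner product *)

Section FixedSpaces.
Variables (R : realFieldType) (Gamma : finGroupType) (d : nat).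
Variable rho : mx_representation R [set: Gamma] d.
Variable B : 'M[R]_d.
Hypothesis B_inner : invariant_inner_product rho B.
Implicit Types (g h : Gamma) (x y : 'rV[R]_d).

Local Notation F g := (fixed_space rho g).
Local Notation N g := (normal_space rho B g).
Local Notation T g := ((rho g)^T - 1%:M).

Lemma B_form_eq0 (v : 'rV[R]_d) : v *m B *m v^T = 0 -> v = 0.
Proof.
case: B_inner => _ pos _ vB; apply/eqP; rewrite -[v]trmxK trmx_eq0; apply/negPn/negP => nz.
by have := pos _ nz; rewrite trmxK vB mxE ltxx.
Qed.

Lemma B_unit : B \in unitmx.
Proof.
rewrite -row_free_unit -kermx_eq0; apply/eqP/row_matrixP => i; rewrite row0.
apply: B_form_eq0; rewrite -row_mul mulmx_ker row0 mul0mx.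
by [].
Qed.

Lemma rho_adjoint g : (rho g)^T *m B = B *m rho g^-1%g.
Proof.
case: B_inner => _ _ inv; rewrite -[in RHS](inv g) -!mulmxA; congr (_ *m _).
by rewrite repr_mulgV mulmx1.
Qed.

Lemma fixed_spaceP m (v : 'M_(m, d)) g : (v <= F g)%MS -> v *m T g = 0.
Proof. by move/eigenspaceP; rewrite mulmxBr mulmx1 scale1r => ->; rewrite subrr. Qed.

(** The orthogonal complement of the fixed space is the image of g - 1, since
    the adjoint of g is its inverse. The transposes appear because the
    subspaces of V are encoded by rows. *)
Lemma normal_spaceE g : (N g :=: T g)%MS.
Proof.
have le : (T g <= N g)%MS.
  apply/sub_kermxP; rewrite mulmxA mulmxBl mul1mx rho_adjoint mulmxBl -mulmxA.
  have FT : rho g *m (F g)^T = (F g)^T.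
    have /eqP := fixed_spaceP (submx_refl (F g)).
    rewrite mulmxBr mulmx1 subr_eq0 => /eqP e.
    by move: (F g) e => U e; rewrite -[in RHS]e trmx_mul trmxK.
  by rewrite -[in X in _ *m X - _]FT (mulmxA (rho _)) repr_mulVg mul1mx subrr.
apply/eqmx_sym/eqmxP; rewrite -(mxrank_leqif_eq le) eq_sym.
rewrite [\rank (N g)]mxrank_ker eqmxMfull ?mxrank_tr; last first.
  by rewrite row_full_unit B_unit.
by rewrite mxrank_ker subKn // rank_leq_row.
Qed.

Lemma normal_dimE g : normal_dim rho B g = \rank (rho g - 1%:M).
Proof.
by rewrite /normal_dim normal_spaceE -mxrank_tr linearB /= trmxK trmx1.
Qed.

Lemma fixed_normal_cap g : (F g :&: N g)%MS = 0.
Proof.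
apply/eqP; rewrite -submx0; apply/row_subP => i.
have := row_sub i (F g :&: N g)%MS; rewrite sub_capmx => /andP[vF vN].
move: (row i _) vF vN => v vF /sub_kermxP; move: (F g) vF => U /submxP[a ->] vN.
suff -> : a *m U = 0 by exact: sub0mx.
by apply: B_form_eq0; rewrite trmx_mul mulmxA -(mulmxA (a *m U) B) vN mul0mx.
Qed.

Lemma fixed_normal_full g : (1%:M <= F g + N g)%MS.
Proof.
rewrite sub1mx -col_leq_rank.
have := mxrank_sum_cap (F g) (N g); rewrite fixed_normal_cap mxrank0 addn0 => ->.
by rewrite normal_spaceE mxrank_ker subnK // rank_leq_row.
Qed.

(** The functionals that vanish on the normal space are the fixed ones. *)
Lemma in_fixed_dualP g x : in_fixed_dual rho B g x <-> x *m rho g = x.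
Proof.
split=> [fx|fx v].
  suff e : x *m (T g)^T = 0.
    by apply/eqP; rewrite -subr_eq0 -e linearB /= trmxK trmx1 mulmxBr mulmx1.
  apply/rowP => i; have := fx (row i (T g))^T; rewrite trmxK normal_spaceE row_sub.
  move=> /(_ isT) /matrixP/(_ 0 0); rewrite [RHS]mxE => e; rewrite [RHS]mxE -[RHS]e !mxE.
  by apply: eq_bigr => j _; rewrite !mxE.
rewrite normal_spaceE => /submxP[a e].
have -> : v = (T g)^T *m a^T by rewrite -trmx_mul -e trmxK.
by rewrite mulmxA linearB /= trmxK trmx1 mulmxBr mulmx1 fx subrr mul0mx.
Qed.

Lemma fixed_normal_projD g : fixed_proj rho B g + normal_proj rho B g = 1%:M.
Proof.
rewrite /fixed_proj /normal_proj -linearD /=.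
have := add_proj_mx (fixed_normal_cap g) (fixed_normal_full g).
by rewrite !mul1mx => ->; rewrite trmx1.
Qed.

Lemma fixed_proj_fixed g : fixed_proj rho B g *m rho g = fixed_proj rho B g.
Proof.
apply/eqP; rewrite -subr_eq0 -trmx_eq0 linearB /= trmx_mul /fixed_proj trmxK.
rewrite -{2}[proj_mx _ _]mul1mx -mulmxBl; apply/eqP.
by apply: proj_mx_0; rewrite ?fixed_normal_cap // normal_spaceE.
Qed.

Lemma normal_proj_fixed0 g x : x *m rho g = x -> x *m normal_proj rho B g = 0.
Proof.
move=> fx; have : (proj_mx (N g) (F g) <= T g)%MS.
  by rewrite -normal_spaceE -[proj_mx _ _]mul1mx proj_mx_sub.
rewrite /normal_proj => /submxP[a ->]; rewrite trmx_mul linearB /= trmxK trmx1.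
by rewrite mulmxA mulmxBr mulmx1 fx subrr mul0mx.
Qed.

Lemma fixed_proj_id g x : x *m rho g = x -> x *m fixed_proj rho B g = x.
Proof.
move=> fx; rewrite -[RHS]mulmx1 -(fixed_normal_projD g) mulmxDr.
by rewrite normal_proj_fixed0 // addr0.
Qed.

Lemma fixed_part_fixed g x : x *m fixed_proj rho B g *m rho g = x *m fixed_proj rho B g.
Proof. by rewrite -mulmxA fixed_proj_fixed. Qed.

Lemma linear_form_inj : injective (@linear_form R d).
Proof.
move=> x y e; apply/rowP => i.
have := congr1 (fun p => p@_(U_(i))%MM) e.
have cE (z : 'rV[R]_d) : (linear_form z)@_(U_(i))%MM = z 0 i.
  rewrite raddf_sum /= (bigD1 i) //= mcoeffZ mcoeffX eqxx mulr1 big1 ?addr0 // => j ne.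
  by rewrite mcoeffZ mcoeffX eq_mnm1 (negbTE ne) mulr0.
by rewrite !cE.
Qed.

End FixedSpaces.

(** * Complex coordinates on the real dual *)

Section ComplexRows.
Variables (R : rcfType) (n : nat).
Implicit Types (x y : 'rV[R]_(n + n)) (X Y : 'rV[R[i]]_n).
Local Notation Re := (@complex.Re R).
Local Notation Im := (@complex.Im R).

(** A real functional on C^n is the real part of a unique complex one. This
    turns the action of realify_mx M on rows into that of M. *)
Definition cx x : 'rV[R[i]]_n :=
  \row_j (x 0 (lshift n j) +i* - x 0 (rshift n j))%C.
Definition uncx X : 'rV[R]_(n + n) := row_mx (map_mx Re X) (- map_mx Im X).

Lemma cxK : cancel cx uncx.
Proof.
move=> x; rewrite -[RHS]hsubmxK; congr row_mx; apply/rowP => j; rewrite !mxE //=.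
by rewrite opprK.
Qed.

Lemma uncxK : cancel uncx cx.
Proof.
move=> X; apply/rowP => j; rewrite mxE row_mxEl row_mxEr !mxE opprK.
by case: (X 0 j).
Qed.

Lemma cx_inj : injective cx. Proof. exact: can_inj cxK. Qed.

Lemma cxD x y : cx (x + y) = cx x + cx y.
Proof. by apply/rowP => j; rewrite !mxE opprD. Qed.

Lemma cxZ a x : cx (a *: x) = a%:C%C *: cx x.
Proof.
by apply/rowP => j; rewrite !mxE; apply/eqP; rewrite eq_complex /= !mul0r subr0 addr0 mulrN !eqxx.
Qed.

Lemma cx0 : cx 0 = 0.
Proof. by apply/rowP => j; rewrite !mxE oppr0. Qed.

Lemma cxN x : cx (- x) = - cx x.
Proof. by apply: (addrI (cx x)); rewrite -cxD !subrr cx0. Qed.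

Lemma cxB x y : cx (x - y) = cx x - cx y.
Proof. by rewrite cxD cxN. Qed.

Lemma cx_sum (I : Type) (s : seq I) (P : pred I) (F : I -> 'rV[R]_(n + n)) :
  cx (\sum_(i <- s | P i) F i) = \sum_(i <- s | P i) cx (F i).
Proof. exact: (big_morph cx cxD cx0). Qed.

Lemma cx_realify x (M : 'M[R[i]]_n) : cx (x *m realify_mx M) = cx x *m M.
Proof.
rewrite -{1}(cxK x); move: (cx x) => X.
rewrite -[RHS]uncxK; congr cx.
by rewrite /uncx /realify_mx mul_row_block map_ReM map_ImM !mulNmx mulmxN -opprD.
Qed.

(** The same block matrix for rectangular matrices, so that it can be applied
    to rank factorizations. *)
Definition realify_rect p q (M : 'M[R[i]]_(p, q)) : 'M[R]_(p + p, q + q) :=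
  block_mx (map_mx Re M) (- map_mx Im M) (map_mx Im M) (map_mx Re M).

Lemma realify_rectM p q k (M : 'M[R[i]]_(p, q)) (N : 'M[R[i]]_(q, k)) :
  realify_rect (M *m N) = realify_rect M *m realify_rect N.
Proof.
rewrite /realify_rect mulmx_block map_ReM map_ImM !(mulNmx, mulmxN) opprD.
by congr block_mx; rewrite addrC.
Qed.

Lemma rank_realify (M : 'M[R[i]]_n) : \rank (realify_mx M) = (\rank M + \rank M)%N.
Proof.
rewrite -[realify_mx M]/(realify_rect M); apply/eqP; rewrite eqn_leq; apply/andP; split.
  rewrite -{1}(mulmx_base M) realify_rectM.
  by apply: (leq_trans (mxrankM_maxl _ _)); exact: rank_leq_col.
have := mulmx_base M; have := row_base_free M; have := col_base_full M.
move: (\rank M) (row_base M) (col_base M) => k rb cb /row_fullP[U eU] /row_freeP[W eW] e.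
have : realify_rect (U *m M *m W) = 1%:M.
  by rewrite -e mulmxA eU mul1mx eW; exact: realify_mx1.
rewrite !realify_rectM => e1; rewrite -{1}(mxrank1 R (k + k)) -e1.
by apply: (leq_trans (mxrankM_maxl _ _)); exact: mxrankM_maxr.
Qed.

Lemma realify_mxB (M N : 'M[R[i]]_n) : realify_mx (M - N) = realify_mx M - realify_mx N.
Proof.
rewrite /realify_mx opp_block_mx add_block_mx.
by congr block_mx; apply/matrixP => i j; rewrite !mxE; case: (M i j) => a b; case: (N i j) => c e /=;
  rewrite ?opprK ?opprD ?opprK.
Qed.

Lemma rank_realify_sub1 (M : 'M[R[i]]_n) :
  \rank (realify_mx M - 1%:M) = (\rank (M - 1%:M)%R + \rank (M - 1%:M)%R)%N.
Proof. by rewrite -realify_mx1 -realify_mxB rank_realify. Qed.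

End ComplexRows.

(** * Linear Poisson structures *)

Section Poisson.
Variables (R : rcfType) (Gamma : finGroupType) (n : nat).
Variable rC : mx_representation R[i] [set: Gamma] n.
Hypothesis rC_inj : forall g, rC g = 1%:M -> g = 1%g.
Local Notation rho := (realify rC).
Variable B : 'M[R]_(n + n).
Hypothesis B_inner : invariant_inner_product rho B.
Variable pi : Gamma -> 'rV[R]_(n + n) -> 'rV[R]_(n + n) -> 'rV[R]_(n + n).
Hypothesis pi_poisson : linear_poisson rho B pi.
Implicit Types (g h s t : Gamma) (x y z u w : 'rV[R]_(n + n)) (X Y : 'rV[R[i]]_n).
Local Notation Re := (@complex.Re R).
Local Notation Im := (@complex.Im R).
Local Notation act := (dual_act rho).
Local Notation rk := (fix_codim rC).

Lemma cx_rho x g : cx (x *m rho g) = cx x *m rC g.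
Proof. exact: cx_realify. Qed.

Lemma cx_act g x : cx (act g x) = cx x *m rC g^-1%g.
Proof. exact: cx_realify. Qed.

Lemma rho_fixedE x g : x *m rho g = x <-> cx x *m rC g = cx x.
Proof. by rewrite -cx_rho; split=> [-> //|]; exact: cx_inj. Qed.

Lemma rank_rho_sub1 g : \rank (rho g - 1%:M) = (rk g + rk g)%N.
Proof. exact: rank_realify_sub1. Qed.

Lemma normal_dim_rk g : normal_dim rho B g = (rk g + rk g)%N.
Proof. by rewrite normal_dimE // rank_rho_sub1. Qed.

Lemma actM g h x : act (g * h)%g x = act g (act h x).
Proof. by rewrite /dual_act invMg (repr_mulg rho) mulmxA. Qed.

Lemma act1 x : act 1%g x = x.
Proof. by rewrite /dual_act invg1 repr_mx1 mulmx1. Qed.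

Lemma linear_act g : linear (act g).
Proof. by move=> c x y; rewrite /dual_act mulmxDl scalemxAl. Qed.

Lemma actK g x : act g^-1%g (act g x) = x.
Proof. by rewrite -actM mulVg act1. Qed.

Lemma act_fixedE g x : act g x = x <-> x *m rho g = x.
Proof.
rewrite /dual_act; split=> e.
  by rewrite -{1}e -mulmxA (repr_mulVg rho) mulmx1.
by rewrite -{1}e -mulmxA (repr_mulgV rho) mulmx1.
Qed.

Lemma pi_linl g y : linear (fun x => pi g x y).
Proof. by have [h _] := lp_bilinear pi_poisson g; exact: h. Qed.

Lemma pi_linr g x : linear (pi g x).
Proof. by have [_ h] := lp_bilinear pi_poisson g; exact: h. Qed.

Lemma pi_anti g x y : pi g x y = - pi g y x.
Proof. exact: (lp_antisym pi_poisson). Qed.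

Lemma pi_inv g h x y : pi (g * h * g^-1)%g (act g x) (act g y) = act g (pi h x y).
Proof. exact: (lp_invariant pi_poisson). Qed.

Lemma pi_fixedl g x y : rk g = 1%N -> x *m rho g = x -> pi g x y = 0.
Proof.
move=> rg fx; apply: (lp_normal pi_poisson); first by rewrite normal_dim_rk rg.
by apply/in_fixed_dualP.
Qed.

Lemma pi_fixedr g x y : rk g = 1%N -> y *m rho g = y -> pi g x y = 0.
Proof. by move=> rg fy; rewrite pi_anti pi_fixedl ?oppr0. Qed.

Lemma pi_value g x y : rk g = 1%N -> pi g x y *m rho g = pi g x y.
Proof.
move=> rg; apply/(in_fixed_dualP B_inner); apply: (lp_values pi_poisson).
by rewrite normal_dim_rk rg.
Qed.

Lemma pi_support g x y : g != 1%g -> rk g != 1%N -> pi g x y = 0.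
Proof.
move=> g1 rg; apply: (lp_support pi_poisson) => //; rewrite normal_dim_rk addnn.
by apply: contra rg => /eqP e; apply/eqP; lia.
Qed.

Lemma fix_codim1 : rk 1%g = 0%N.
Proof. by rewrite /fix_codim repr_mx1 subrr mxrank0. Qed.

Lemma pr_pi g (x : 'I_2 -> 'rV[R]_(n + n)) :
  pr rho B g (fun y : 'I_2 -> 'rV[R]_(n + n) => linear_form (pi g (y 0) (y 1))) x
  = linear_form (pi g (x 0) (x 1)).
Proof.
rewrite /pr; have [g1|g1] := eqVneq g 1%g.
  rewrite (eq_bigl (pred1 set0)) => [|S]; last first.
    by rewrite normal_dim_rk g1 fix_codim1 cards_eq0.
  rewrite big_pred1_eq !in_set0 poly_precomp_linear_form.
  have fx (y : 'rV[R]_(n + n)) : y *m fixed_proj rho B g = y.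
    by apply: fixed_proj_id => //; rewrite g1 repr_mx1 mulmx1.
  by rewrite !fx.
have [rg|rg] := eqVneq (rk g) 1%N; last first.
  have lf0 : linear_form (0 : 'rV[R]_(n + n)) = 0.
    exact: (linear_0 (@linear_form_is_linear _ _)).
  rewrite pi_support // lf0 big1 => [|S _]; last by rewrite pi_support.
  by rewrite (linear_0 (linear_precomp _)).
rewrite (eq_bigl (pred1 setT)) => [|S]; last first.
  rewrite normal_dim_rk rg /= eqEcard subsetT cardsT card_ord.
  by rewrite eqn_leq; have := max_card (mem S); rewrite card_ord => ->.
rewrite big_pred1_eq !in_setT poly_precomp_linear_form fixed_proj_id ?pi_value //.
have np (y : 'rV[R]_(n + n)) : y = y *m fixed_proj rho B g + y *m normal_proj rho B g.
  by rewrite -mulmxDr fixed_normal_projD // mulmx1.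
rewrite [in RHS](np (x 0)) [in RHS](np (x 1)) (linear_D (pi_linl _ _)).
rewrite [X in _ = linear_form (X + _)]pi_fixedl ?fixed_part_fixed // add0r.
by rewrite (linear_D (pi_linr _ _)) [X in _ = linear_form (X + _)]pi_fixedr ?fixed_part_fixed // add0r.
Qed.

Definition lin_coord (c : 'cV[R[i]]_n) x : R[i] := (cx x *m c) 0 0.
(** Area of the parallelogram on the coordinates of x and y. *)
Definition area (c : 'cV[R[i]]_n) x y : R :=
  Re (lin_coord c x) * Im (lin_coord c y) - Im (lin_coord c x) * Re (lin_coord c y).

Lemma lin_coordD c x y : lin_coord c (x + y) = lin_coord c x + lin_coord c y.
Proof. by rewrite /lin_coord cxD mulmxDl mxE. Qed.

Lemma lin_coordZ c a x : lin_coord c (a *: x) = a%:C%C * lin_coord c x.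
Proof. by rewrite /lin_coord cxZ -scalemxAl mxE. Qed.

Lemma complexRI (a : R[i]) : a = (Re a)%:C%C + (Im a)%:C%C * 'i%C.
Proof. by case: a => p q; apply/eqP; rewrite eq_complex /= !(mulr0, mul0r, mulr1, subr0, addr0, add0r) !eqxx. Qed.

Lemma reflection_factor g : rk g = 1%N ->
  exists c : 'cV[R[i]]_n, exists v : 'rV[R[i]]_n,
    [/\ rC g - 1%:M = c *m v, c != 0 & v != 0].
Proof.
move=> rg; have := mulmx_base (rC g - 1%:M); move: (row_base _) (col_base _).
have := rg; rewrite /fix_codim => ->; move=> v c e; exists c, v; split=> //.
  by apply/eqP => c0; move: rg; rewrite /fix_codim -e c0 mul0mx mxrank0.
by apply/eqP => c0; move: rg; rewrite /fix_codim -e c0 mulmx0 mxrank0.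
Qed.

Lemma cv_dual (c : 'cV[R[i]]_n) : c != 0 -> exists X : 'rV[R[i]]_n, X *m c = 1%:M.
Proof.
case/cV0Pn => i ci; exists ((c i 0)^-1 *: delta_mx 0 i).
by apply/matrixP => j k; rewrite !ord1 -scalemxAl -rowE !mxE mulVf.
Qed.

Lemma fixed_lin_coord g c v x : rC g - 1%:M = c *m v -> lin_coord c x = 0 -> x *m rho g = x.
Proof.
move=> e z0; apply/rho_fixedE; apply/eqP; rewrite -subr_eq0 -{2}[cx x]mulmx1 -mulmxBr e mulmxA.
have -> : cx x *m c = 0 by apply/matrixP => i j; rewrite !ord1 [RHS]mxE.
by rewrite mul0mx.
Qed.

(** As pi_g vanishes on the functionals fixed by the reflection g, it factors
    through one complex coordinate, that is through a real plane; on a plane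
    there is only one alternating form up to scalars. *)
Lemma reflection_form g c v : rk g = 1%N -> rC g - 1%:M = c *m v -> c != 0 ->
  exists lam, forall x y, pi g x y = area c x y *: lam.
Proof.
move=> rg e c0; have [X Xc] := cv_dual c0.
exists (pi g (uncx X) (uncx ('i%C *: X))) => x y.
have XE z : pi g z = pi g (Re (lin_coord c z) *: uncx X + Im (lin_coord c z) *: uncx ('i%C *: X)).
  apply: functional_extensionality => w; apply/eqP; rewrite -subr_eq0 -(linear_B (pi_linl _ _)).
  apply/eqP; apply: pi_fixedl => //; apply: (fixed_lin_coord e).
  have zX a : lin_coord c (uncx (a *: X)) = a by rewrite /lin_coord uncxK -scalemxAl Xc !mxE mulr1.
  have zX1 : lin_coord c (uncx X) = 1 by rewrite -[X]scale1r zX.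
  rewrite lin_coordD -scaleN1r lin_coordZ lin_coordD !lin_coordZ zX zX1 mulr1.
  by rewrite -complexRI rmorphN1 mulN1r subrr.
rewrite XE pi_anti XE -pi_anti.
set a := uncx X; set b := uncx _.
have paa (w : 'rV[R]_(n + n)) : pi g w w = 0.
  have /eqP : 2%:R *: pi g w w = 0 by rewrite scaler_nat mulr2n {2}pi_anti subrr.
  by rewrite scaler_eq0 pnatr_eq0 => /eqP.
rewrite !(linear_D (pi_linl _ _)) !(linear_D (pi_linr _ _)).
rewrite !(linear_Z (pi_linl _ _)) !(linear_Z (pi_linr _ _)) !paa (pi_anti g b a).
by rewrite !scaler0 addr0 add0r !scalerN !scalerA -scalerBl.
Qed.

Definition sqnorm (a : R[i]) : R := Re a * Re a + Im a * Im a.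

Lemma sqnormM a b : sqnorm (a * b) = sqnorm a * sqnorm b.
Proof. by case: a => p q; case: b => p' q'; rewrite /sqnorm /=; ring. Qed.

Lemma sqnorm_ge0 a : 0 <= sqnorm a.
Proof. by rewrite addr_ge0 // -expr2 sqr_ge0. Qed.

Lemma area_scale c x y x' y' a : lin_coord c x' = a * lin_coord c x -> lin_coord c y' = a * lin_coord c y ->
  area c x' y' = sqnorm a * area c x y.
Proof.
move=> ex ey; rewrite /area ex ey /sqnorm.
case: a {ex ey} => p q; case: (lin_coord c x) => p1 q1; case: (lin_coord c y) => p2 q2 /=; ring.
Qed.

(** An element h commuting with g multiplies the coordinate of g by a root of
    unity, so it preserves the area, and invariance of pi says that it fixes
    the value. That h is complex-linear is used here: an orientation-reversing
    h would change the sign. *)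
Lemma pi_centralised g h x y : rk g = 1%N -> (h * g = g * h)%g ->
  pi g x y *m rho h = pi g x y.
Proof.
move=> rg hg; apply/act_fixedE.
have [c [v [e c0 v0]]] := reflection_factor rg.
have [lam piE] := reflection_form rg e c0.
have [w vw] : exists w : 'cV[R[i]]_n, v *m w = 1%:M.
  have [|W eW] := @cv_dual v^T; first by rewrite trmx_eq0.
  by exists W^T; rewrite -[v]trmxK -trmx_mul eW trmx1.
set H := rC h^-1%g.
have Hg : H *m (rC g - 1%:M) = (rC g - 1%:M) *m H.
  rewrite mulmxBr mulmxBl mulmx1 mul1mx -!repr_mxM ?inE //; congr (rC _ - _).
  by apply: (mulgI h); rewrite mulKVg mulgA hg mulgK.
set a := (v *m H *m w) 0 0.
have Hc : H *m c = a *: c.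
  rewrite -[LHS]mulmx1 -vw mulmxA -(mulmxA H) -e Hg e -!mulmxA (mulmxA v).
  rewrite -mul_mx_scalar; congr (c *m _).
  by apply/matrixP => i j; rewrite !ord1 [RHS]mxE eqxx mulr1n.
have Hk k : rC (h^-1 ^+ k)%g *m c = a ^+ k *: c.
  elim: k => [|k IH]; first by rewrite repr_mx1 mul1mx scale1r.
  by rewrite expgS repr_mxM ?inE // -mulmxA IH -scalemxAr Hc scalerA exprSr.
have aN : a ^+ #[h^-1]%g = 1.
  have := Hk #[h^-1]%g; rewrite expg_order repr_mx1 mul1mx => /eqP.
  rewrite -subr_eq0 -{1}[c]scale1r -scalerBl scaler_eq0 (negbTE c0) orbF subr_eq0.
  by move/eqP.
have n1 : sqnorm a = 1.
  have nX k : sqnorm (a ^+ k) = sqnorm a ^+ k.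
    elim: k => [|k IH]; first by rewrite !expr0 /sqnorm /= mulr1 mulr0 addr0.
    by rewrite !exprS sqnormM IH.
  have := nX #[h^-1]%g; rewrite aN /sqnorm /= mulr1 mulr0 addr0 => /esym/eqP.
  by rewrite pexpr_eq1 ?order_gt0 ?sqnorm_ge0 // => /eqP.
have za z : lin_coord c (act h z) = a * lin_coord c z.
  by rewrite /lin_coord cx_act -mulmxA -/H Hc -scalemxAr mxE.
have := pi_inv h g x y; have -> : (h * g * h^-1 = g)%g by rewrite hg mulgK.
by move=> <-; rewrite !piE (area_scale (za x) (za y)) n1 mul1r.
Qed.

(** Three vectors of a plane satisfy this relation. *)
Lemma area_cyc c x y z :
  (area c y z)%:C%C * lin_coord c x + (area c z x)%:C%C * lin_coord c y + (area c x y)%:C%C * lin_coord c z = 0.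
Proof.
rewrite /area; case: (lin_coord c x) => p1 q1; case: (lin_coord c y) => p2 q2; case: (lin_coord c z) => p3 q3.
by apply/eqP; rewrite eq_complex /=; apply/andP; split; apply/eqP; ring.
Qed.

Lemma quad_condition g : g != 1%g -> exists area : 'rV[R]_(n + n) -> 'rV[R]_(n + n) -> R,
  exists lam, (forall x y, pi g x y = area x y *: lam) /\
    forall x y z, area y z *: (act g x - x) + area z x *: (act g y - y)
                  + area x y *: (act g z - z) = 0.
Proof.
move=> g1; have [rg|rg] := eqVneq (rk g) 1%N; last first.
  exists (fun _ _ => 0), 0; split=> [x y|x y z]; first by rewrite pi_support // scale0r.
  by rewrite !scale0r !addr0.
have [c [v [e c0 v0]]] := reflection_factor rg.
have [lam piE] := reflection_form rg e c0.
exists (area c), lam; split=> // x y z.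
have aE w : cx (act g w - w) = - (lin_coord c w *: (v *m rC g^-1%g)).
  rewrite cxB cx_act -[X in _ - X]mulmx1 -(repr_mulVg rC g^-1%g) invgK -mulmxBr.
  have -> : rC g^-1%g - rC g *m rC g^-1%g = - (c *m v *m rC g^-1%g).
    by rewrite -e mulmxBl mul1mx opprB.
  rewrite mulmxN; congr (- _); rewrite -(mulmxA c v) (mulmxA (cx w)) -mul_scalar_mx; congr (_ *m _).
  by apply/matrixP => i j; rewrite !ord1 [RHS]mxE eqxx mulr1n.
apply: cx_inj; rewrite cx0 !cxD !cxZ !aE !scalerN !scalerA -!opprD -!scalerDl area_cyc.
by rewrite scale0r oppr0.
Qed.

(** Contribution of the pair (a, b) to the bracket at a * b. *)
Definition bracket_term (a b : Gamma) x y z := pi a (pi b x y) (z + act b z)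
  + pi a (pi b y z) (x + act b x) + pi a (pi b z x) (y + act b y).

Local Notation W := (poisson_bracket rho pi).

Lemma bracketE g x y z : W g x y z = \sum_b bracket_term (g * b^-1)%g b x y z.
Proof.
rewrite /poisson_bracket (exchange_big_dep xpredT) //=; apply: eq_bigr => b _.
rewrite (big_pred1 (g * b^-1)%g) // => a /=.
by apply/eqP/eqP => [<-|->]; rewrite ?mulgK ?mulgKV.
Qed.

Lemma term_eq0 a b x y z : (forall u w u', pi a (pi b u w) u' = 0) -> bracket_term a b x y z = 0.
Proof. by move=> h; rewrite /bracket_term !h !addr0. Qed.

Lemma pi_pi_support a b x y z : (a != 1%g /\ rk a != 1%N) \/ (b != 1%g /\ rk b != 1%N) ->
  pi a (pi b x y) z = 0.
Proof.
case=> -[h1 h2]; first exact: pi_support.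
by rewrite (pi_support x y h1 h2) (linear_0 (pi_linl _ _)).
Qed.

(** The value of pi_b is fixed by b. If a b is trivial or a reflection, it is
    also fixed by a, and pi_a vanishes there. *)
Lemma pi_pi_reflections a b x y z : rk a = 1%N -> rk b = 1%N -> (rk (a * b)%g <= 1)%N ->
  pi a (pi b x y) z = 0.
Proof.
move=> ra rb rab; apply: pi_fixedl => //; apply/rho_fixedE.
have fb : cx (pi b x y) *m rC b = cx (pi b x y) by apply/rho_fixedE; exact: pi_value.
have [ab1|abn] := eqVneq (a * b)%g 1%g.
  have -> : a = b^-1%g by apply: (mulIg b); rewrite mulVg.
  by rewrite -{1}fb -mulmxA (repr_mulgV rC) mulmx1.
apply: (fixed_by_factor ra rb) fb.
by apply/eqP; rewrite eqn_leq rab (fix_codim_gt0 rC_inj).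
Qed.

Lemma bracket_cyc g x y z : W g x y z = W g y z x.
Proof. by apply: eq_bigr => a _; apply: eq_bigr => b _; zmod. Qed.

Lemma bracket_anti g x y z : W g x y z = - W g y x z.
Proof.
rewrite -sumrN; apply: eq_bigr => a _; rewrite -sumrN; apply: eq_bigr => b _.
rewrite (pi_anti b x y) (pi_anti b y z) (pi_anti b z x).
by rewrite !(linear_N (pi_linl _ _)); zmod.
Qed.

Lemma linear_add_act b : linear (fun z => z + act b z).
Proof. by apply: linearDf => //; exact: linear_act. Qed.

Lemma bracket_linr g x y : linear (W g x y).
Proof.
apply: linear_sumf => a; apply: linear_sumf => b.
apply: linearDf; first apply: linearDf.
- exact: (linear_compf (pi_linr _ _) (linear_add_act b)).
- exact: (linear_compf (pi_linl _ _) (pi_linr _ _)).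
- exact: (linear_compf (pi_linl _ _) (pi_linl _ _)).
Qed.

Lemma bracket_linm g x z : linear (fun y => W g x y z).
Proof.
by move=> c y y'; rewrite !(bracket_cyc g x) !(bracket_cyc g _ z) bracket_linr.
Qed.

Lemma bracket_linl g y z : linear (fun x => W g x y z).
Proof. by move=> c x x'; rewrite !(bracket_cyc g _ y) bracket_linr. Qed.

Lemma bracket_diag g x z : W g x x z = 0.
Proof.
have /eqP : 2%:R *: W g x x z = 0 by rewrite scaler_nat mulr2n {2}bracket_anti subrr.
by rewrite scaler_eq0 pnatr_eq0 => /eqP.
Qed.

(** For g = 1 the projection pr is the identity. *)
Lemma bracket_one x y z : W 1%g x y z = 0.
Proof.
pose f (i : 'I_3) := if i == 0 then x else if i == 1 then y else z.
have := lp_jacobi pi_poisson 1%g f; rewrite /pr (eq_bigl (pred1 set0)) => [|S]; last first.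
  by rewrite normal_dim_rk fix_codim1 cards_eq0.
rewrite big_pred1_eq !in_set0 poly_precomp_linear_form.
have fx (u : 'rV[R]_(n + n)) : u *m fixed_proj rho B 1%g = u.
  by apply: fixed_proj_id => //; rewrite repr_mx1 mulmx1.
rewrite !fx /f /= => e; apply: linear_form_inj; rewrite e.
by rewrite (linear_0 (@linear_form_is_linear _ _)).
Qed.

Section OneReflection.
Variable s : Gamma.
Hypothesis rk_s : rk s = 1%N.
Local Notation fixed x := (x *m rho s = x).

Lemma s_neq1 : s != 1%g.
Proof. by apply/eqP => s1; move: rk_s; rewrite s1 fix_codim1. Qed.

Lemma bracket_reflectionE x y z : W s x y z = bracket_term 1%g s x y z + bracket_term s 1%g x y z.
Proof.
rewrite bracketE (bigD1 s) //= mulgV (bigD1 1%g) /=; last by rewrite eq_sym s_neq1.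
rewrite invg1 mulg1.
rewrite big1 ?addr0 // => b /andP[b1 bs].
have [rb|rb] := eqVneq (rk b) 1%N; last first.
  by apply: term_eq0 => u w u'; apply: pi_pi_support; right.
have sb : (s * b^-1 != 1)%g by rewrite -eq_mulgV1 eq_sym.
have [rsb|rsb] := eqVneq (rk (s * b^-1)%g) 1%N; last first.
  by apply: term_eq0 => u w u'; apply: pi_pi_support; left.
by apply: term_eq0 => u w u'; apply: pi_pi_reflections => //; rewrite mulgKV rk_s.
Qed.

Lemma pi1_fixed u w : fixed u -> fixed w -> fixed (pi 1%g u w).
Proof.
move=> fu fw; apply/act_fixedE; rewrite -pi_inv mulg1 mulgV.
by rewrite (iffRL (act_fixedE _ _) fu) (iffRL (act_fixedE _ _) fw).
Qed.

Lemma fixedD u w : fixed u -> fixed w -> fixed (u + w).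
Proof. by move=> fu fw; rewrite mulmxDl fu fw. Qed.

Lemma fixed_act z : fixed z -> fixed (act s z).
Proof. by move=> fz; rewrite (iffRL (act_fixedE _ _) fz). Qed.

Lemma bracket_fixed2 x y z : fixed y -> fixed z -> W s x y z = 0.
Proof.
move=> fy fz; rewrite bracket_reflectionE /bracket_term !act1.
rewrite [pi s x y]pi_fixedr // [pi s y z]pi_fixedr // [pi s z x]pi_fixedl //.
rewrite !(linear_0 (pi_linl _ _)) !addr0 add0r.
rewrite [pi s _ (z + z)]pi_fixedr //; last exact: fixedD.
rewrite [pi s _ (y + y)]pi_fixedr //; last exact: fixedD.
by rewrite [pi s _ (x + x)]pi_fixedl ?addr0 //; exact: pi1_fixed.
Qed.

Lemma bracket_value_fixed x y z : fixed z -> fixed (W s x y z).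
Proof.
move=> fz; rewrite bracket_reflectionE /bracket_term !act1.
rewrite [pi s y z]pi_fixedr // [pi s z x]pi_fixedl // !(linear_0 (pi_linl _ _)) !addr0.
rewrite !mulmxDl !pi_value // pi1_fixed ?pi_value //.
by apply: fixedD => //; exact: fixed_act.
Qed.

Local Notation fp := (fixed_proj rho B s).
Local Notation np := (normal_proj rho B s).

(** This is what the Jacobi identity of pi says for a reflection: two
    arguments are projected to the normal part, one to the fixed part. *)
Lemma bracket_normal2 x y z : fixed z -> W s (x *m np) (y *m np) z = 0.
Proof.
move=> fz.
have npnp (u : 'rV[R]_(n + n)) : u *m np *m np = u *m np.
  have f0 := normal_proj_fixed0 B_inner (fixed_part_fixed B_inner s u).
  have e : u = u *m fp + u *m np by rewrite -mulmxDr fixed_normal_projD // mulmx1.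
  by have := congr1 (mulmx^~ np) e; rewrite mulmxDl f0 add0r.
pose f (i : 'I_3) := if i == 0 then x *m np else if i == 1 then y *m np else z.
have := lp_jacobi pi_poisson s f; rewrite /pr (bigD1 (~: [set 2])); last first.
  by rewrite cardsC1 card_ord normal_dim_rk rk_s.
rewrite big1 /= ?addr0; last first.
  move=> S /andP[/eqP cS neS].
  have -> : (2 : 'I_3) \in S.
    apply: contraR neS => n2; rewrite eqEcard cS cardsC1 card_ord normal_dim_rk rk_s andbT.
    by apply/subsetP => i iS; rewrite !inE; apply: contraNneq n2 => <-.
  rewrite {3}/f /= (normal_proj_fixed0 B_inner fz) (linear_0 (bracket_linr _ _ _)).
  by rewrite (linear_0 (@linear_form_is_linear _ _)).
rewrite !inE /= /f /= !npnp (fixed_proj_id B_inner fz) poly_precomp_linear_form.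
rewrite (fixed_proj_id B_inner); last exact: bracket_value_fixed.
move=> e; apply: linear_form_inj; rewrite e.
by rewrite (linear_0 (@linear_form_is_linear _ _)).
Qed.

(** When two arguments are fixed, all the terms of the bracket vanish; so the
    first two arguments may be projected to the normal part. *)
Lemma bracket_fixed1 x y z : fixed z -> W s x y z = 0.
Proof.
move=> fz.
have split (u : 'rV[R]_(n + n)) : u = u *m fp + u *m np.
  by rewrite -mulmxDr fixed_normal_projD // mulmx1.
rewrite (split x) (linear_D (bracket_linl _ _ _)) [X in X + _]bracket_anti.
rewrite (bracket_fixed2 _ (fixed_part_fixed B_inner _ _) fz) oppr0 add0r.
rewrite (split y) (linear_D (bracket_linm _ _ _)) bracket_normal2 // addr0.
exact: (bracket_fixed2 _ (fixed_part_fixed B_inner _ _) fz).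
Qed.

(** Modulo fixed arguments there is a plane left, on which alternating
    trilinear maps vanish. *)
Lemma bracket_reflection x y z : W s x y z = 0.
Proof.
have [c [v [e c0 v0]]] := reflection_factor rk_s.
have [X Xc] := cv_dual c0.
set p := uncx X; set q := uncx ('i%C *: X).
have dec u : exists2 w, fixed w & u = w + (Re (lin_coord c u) *: p + Im (lin_coord c u) *: q).
  exists (u - (Re (lin_coord c u) *: p + Im (lin_coord c u) *: q)); last by rewrite subrK.
  apply: (fixed_lin_coord e).
  have zX a : lin_coord c (uncx (a *: X)) = a by rewrite /lin_coord uncxK -scalemxAl Xc !mxE mulr1.
  have zX1 : lin_coord c p = 1 by rewrite /p -[X]scale1r zX.
  rewrite lin_coordD -scaleN1r lin_coordZ lin_coordD !lin_coordZ zX zX1 mulr1.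
  by rewrite -complexRI rmorphN1 mulN1r subrr.
have W3 u u' w : fixed w -> W s u u' w = 0 by exact: bracket_fixed1.
have W2 u u' w : fixed w -> W s u w u' = 0 by rewrite -bracket_cyc; exact: W3.
have W1 u u' w : fixed w -> W s w u u' = 0 by rewrite bracket_cyc; exact: W3.
have [x' fx ->] := dec x; have [y' fy ->] := dec y; have [z' fz ->] := dec z.
have D1 a a' b b' : W s a b b' = 0 -> W s a' b b' = 0 -> W s (a + a') b b' = 0.
  by move=> h h'; rewrite (linear_D (bracket_linl _ _ _)) h h' addr0.
have D2 a a' b b' : W s b a b' = 0 -> W s b a' b' = 0 -> W s b (a + a') b' = 0.
  by move=> h h'; rewrite (linear_D (bracket_linm _ _ _)) h h' addr0.
have D3 a a' b b' : W s b b' a = 0 -> W s b b' a' = 0 -> W s b b' (a + a') = 0.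
  by move=> h h'; rewrite (linear_D (bracket_linr _ _ _)) h h' addr0.
have Dg a b : W s a a b = 0 by exact: bracket_diag.
have Dg' a b : W s a b a = 0 by rewrite bracket_cyc bracket_cyc bracket_diag.
have Dg2 a b : W s b a a = 0 by rewrite bracket_cyc bracket_diag.
apply: (D1); first exact: W1.
apply: (D2); first exact: W2.
apply: (D3); first exact: W3.
by apply: (D1); apply: (D2); apply: (D3);
  rewrite !(linear_Z (bracket_linl _ _ _), linear_Z (bracket_linm _ _ _), linear_Z (bracket_linr _ _ _))
    ?(Dg, Dg', Dg2) !scaler0.
Qed.

End OneReflection.

End Poisson.

(** * Dihedral subgroups *)

Section RealTrace.
Variables (R : rcfType) (Gamma : finGroupType) (n : nat).
Variable rC : mx_representation R[i] [set: Gamma] n.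
Local Notation rho := (realify rC).
Variable B : 'M[R]_(n + n).
Hypothesis B_inner : invariant_inner_product rho B.

Definition rowform (x y : 'rV[R]_(n + n)) : R := (x *m invmx B *m y^T) 0 0.

Lemma B_sym_inv : (invmx B)^T = invmx B.
Proof. by rewrite trmx_inv; case: B_inner => ->. Qed.

Lemma rowform_pos x : x != 0 -> 0 < rowform x x.
Proof.
move=> x0; case: (B_inner) => _ pos _.
have Bu := B_unit B_inner.
have : (x *m invmx B)^T != 0.
  rewrite trmx_eq0; apply: contra x0 => /eqP e.
  by rewrite -[x](mulmxKV Bu) e mul0mx.
by move/pos; rewrite trmxK trmx_mul B_sym_inv mulmxKV // mulmxA.
Qed.

Lemma rowform_adj g x y : rowform (x *m rho g^-1%g) y = rowform x (y *m rho g).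
Proof.
rewrite /rowform trmx_mul !mulmxA; congr ((_ *m _) 0 0).
rewrite -!mulmxA; congr (_ *m _).
have Bu := B_unit B_inner; have := rho_adjoint B_inner g => e.
apply: (can_inj (mulKmx Bu)); rewrite mulmxA -e mulmxK // mulmxA mulmxV // mul1mx.
by [].
Qed.

(** The operator g + g^-1 is self-adjoint for the inner product, so its
    eigenvalues are real. *)
Lemma real_eigenvalue (b : 'rV[R[i]]_n) g tau : b != 0 ->
  b *m rC g + b *m rC g^-1%g = tau *: b -> tau = (complex.Re tau)%:C%C.
Proof.
move=> b0 e; set p := complex.Re tau; set r := complex.Im tau.
have tauE : tau = p%:C%C + r%:C%C * 'i%C by exact: complexRI.
(* In terms of the real vectors x and y = i x, an imaginary part r of tau
   gives S x = p x + r y and S y = p y - r x, whence r (|x|^2 + |y|^2) = 0. *)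
pose x := uncx b; pose y := uncx ('i%C *: b).
pose S (z : 'rV[R]_(n + n)) := z *m rho g + z *m rho g^-1%g.
have cS z : cx (S z) = cx z *m rC g + cx z *m rC g^-1%g by rewrite cxD !cx_realify.
have Sx : S x = p *: x + r *: y.
  apply: cx_inj; rewrite cS cxD !cxZ !uncxK e {1}tauE scalerDl scalerA.
  by [].
have Sy : S y = p *: y - r *: x.
  apply: cx_inj; rewrite cS cxB !cxZ !uncxK -!scalemxAl -scalerDr e {1}tauE.
  rewrite !scalerA -scalerBl; congr (_ *: _).
  by apply/eqP; rewrite eq_complex /=; apply/andP; split; apply/eqP; ring.
have rD u v w : rowform (u + v) w = rowform u w + rowform v w.
  by rewrite /rowform !mulmxDl mxE.
have rDr u v w : rowform w (u + v) = rowform w u + rowform w v.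
  by rewrite /rowform linearD /= mulmxDr mxE.
have rZ a v w : rowform (a *: v) w = a * rowform v w.
  by rewrite /rowform -!scalemxAl mxE.
have rZr a v w : rowform w (a *: v) = a * rowform w v.
  by rewrite /rowform linearZ /= -scalemxAr mxE.
have rsym u v : rowform u v = rowform v u.
  rewrite /rowform -[in LHS](trmxK (u *m _ *m _)) [LHS]mxE !trmx_mul trmxK B_sym_inv.
  by rewrite mulmxA.
have adj : rowform (S x) y = rowform x (S y).
  have a1 := rowform_adj g x y; have a2 := rowform_adj g^-1%g x y.
  by rewrite invgK in a2; rewrite /S rD rDr a1 a2 addrC.
have x0 : x != 0.
  by apply: contra b0 => /eqP x0; rewrite -[b]uncxK -/x x0 cx0.
have : r * (rowform x x + rowform y y) = 0.
  move: adj; rewrite Sx Sy rD !rZ rDr -scaleNr !rZr => h.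
  have : p * rowform x y + r * rowform y y - (p * rowform x y + - r * rowform x x) = 0.
    by rewrite h subrr.
  by move=> <-; ring.
have pp := rowform_pos x0.
have py : 0 <= rowform y y.
  have [->|y0] := eqVneq y 0; first by rewrite /rowform !mul0mx mxE.
  by apply/ltW; exact: rowform_pos.
move/eqP; rewrite mulf_eq0 [X in _ || X]gt_eqF ?orbF; last by rewrite ltr_wpDr.
by move=> /eqP r0; rewrite tauE r0 mul0r addr0.
Qed.

End RealTrace.

Section Correction.
Variables (R : rcfType) (Gamma : finGroupType) (n : nat).
Variable rC : mx_representation R[i] [set: Gamma] n.
Variable pi : Gamma -> 'rV[R]_(n + n) -> 'rV[R]_(n + n) -> 'rV[R]_(n + n).
Local Notation rho := (realify rC).
Local Notation act := (dual_act rho).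

Definition solves g (kap : 'rV[R]_(n + n) -> 'rV[R]_(n + n) -> R) := forall x y z,
  poisson_bracket rho pi g x y z = (kap y z *: (x - act g x) + kap z x *: (y - act g y)
      + kap x y *: (z - act g z)) *+ 2.

(** The last condition makes the constant brackets vanish at reflections. *)
Definition correction g (kap : 'rV[R]_(n + n) -> 'rV[R]_(n + n) -> R) : Prop :=
  [/\ forall y, linear (fun x => kap x y : R^o), forall x y, kap x y = - kap y x,
      solves g kap & forall q x y z, q \in pstab_group rC g -> fix_codim rC q = 1%N ->
        kap (pi q x y) z = 0].

End Correction.

Section Dihedral.
Variables (R : rcfType) (Gamma : finGroupType) (n : nat).
Variable rC : mx_representation R[i] [set: Gamma] n.
Hypothesis rC_inj : forall g, rC g = 1%:M -> g = 1%g.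
Local Notation rho := (realify rC).
Variable B : 'M[R]_(n + n).
Hypothesis B_inner : invariant_inner_product rho B.
Local Notation Re := (@complex.Re R).
Local Notation Im := (@complex.Im R).
Local Notation rk := (fix_codim rC).
Implicit Types (g u v w : Gamma) (X Y : 'rV[R[i]]_n).

Variables (gam s t : Gamma) (lam : 'rV[R[i]]_n).
Hypotheses (gamE : gam = (s * t)%g) (rk_gam : rk gam = 2%N).
Hypotheses (rk_s : rk s = 1%N) (rk_t : rk t = 1%N).
Hypothesis lam_cent : forall g, (g * t = t * g)%g -> lam *m rC g = lam.
Hypothesis lam_moved : lam *m rC gam != lam.
Local Notation P := (pstab_group rC gam).
Local Notation P0 := (pstab1_group rC gam).

(* The dihedral situation: gam = s t, and lam is going to be a value of pi_t.
   The rotations are the elements of P0. *)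
Let tP : t \in P. Proof. by case: (pair_in_pstab rk_gam gamE rk_s rk_t). Qed.
Let gamP0 : gam \in P0. Proof. exact: (gam_pstab1 rC_inj rk_gam gamE rk_s rk_t lam_cent lam_moved). Qed.
Let gam1 : gam != 1%g.
Proof. by apply/eqP => e; move: rk_gam; rewrite e fix_codim1. Qed.
Let refl : dihedral_reflection rC gam t. Proof. exact: (pair_dihedral_reflection rC_inj rk_gam gamE rk_s rk_t lam_cent lam_moved). Qed.
Let tt : (t * t = 1)%g. Proof. by case: refl. Qed.
Let tut u : u \in P0 -> (t * u * t = u^-1)%g. Proof. by case: refl => _ _ h _ /h. Qed.

Lemma refl_swap u : u \in P0 -> (u * t = t * u^-1)%g.
Proof. by move=> uP; rewrite -(tut uP) !mulgA tt mul1g. Qed.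

Lemma pstab1_comm u v : u \in P0 -> v \in P0 -> (u * v = v * u)%g.
Proof.
move=> uP vP; apply: invg_inj; rewrite -[LHS]tut ?groupM // invMg.
rewrite -(tut uP) -(tut vP) !mulgA; congr (_ * _)%g.
by rewrite -(mulgA (t * u)%g) tt mulg1.
Qed.

(** If two rotations have the same square, their quotient is inverted by t and
    equal to its inverse, so it commutes with t. Hence the number of rotations
    is odd. *)
Lemma pstab1_sqr_inj u v : u \in P0 -> v \in P0 -> (u * u = v * v)%g -> u = v.
Proof.
move=> uP vP e; apply/eqP; rewrite eq_mulgV1; apply/eqP.
have qP : (u * v^-1)%g \in P0 by rewrite groupM ?groupV.
apply: (cent_pstab1 rC_inj rk_gam lam_cent lam_moved) => //.
rewrite (refl_swap qP); congr (t * _)%g; rewrite invMg invgK.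
apply: (mulIg u); rewrite mulgKV -mulgA (pstab1_comm _ uP) ?groupV //.
by rewrite mulgA e mulgK.
Qed.

Lemma sum_sqr (V : nmodType) (F : Gamma -> V) :
  \sum_(u in P0) F (u * u)%g = \sum_(u in P0) F u.
Proof.
pose S := [set (u * u)%g | u in P0].
have inj : {in P0 &, injective (fun u => (u * u)%g)} by exact: pstab1_sqr_inj.
have SP : S = P0.
  apply/eqP; rewrite eqEcard (card_in_imset inj) leqnn andbT.
  by apply/subsetP => _ /imsetP[u uP ->]; rewrite groupM.
transitivity (\sum_(u in S) F u); last by apply: eq_bigl => u; rewrite SP.
by rewrite big_imset.
Qed.

Lemma pstab1_sqrt : exists2 w, w \in P0 & gam = (w * w)%g.
Proof.
pose S := [set (u * u)%g | u in P0].
have inj : {in P0 &, injective (fun u => (u * u)%g)} by exact: pstab1_sqr_inj.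
have SP : S = P0.
  apply/eqP; rewrite eqEcard (card_in_imset inj) leqnn andbT.
  by apply/subsetP => _ /imsetP[u uP ->]; rewrite groupM.
have : gam \in S by rewrite SP; exact: gamP0.
by case/imsetP => w wP e; exists w.
Qed.

(* The moved plane is spanned by b, fixed by t, and h, negated by t. The
   vector h is chosen so that the matrices of the rotations are real in this
   basis. *)
Let E := avg rC P.
Let b := lam *m (1%:M - E).
Let h := b *m rC gam - b *m rC gam^-1%g.

Lemma avgE_l g : g \in P -> rC g *m E = E. Proof. exact: avg_mull. Qed.
Lemma avgE_r g : g \in P -> E *m rC g = E. Proof. exact: avg_mulr. Qed.

Lemma b_avg : b *m E = 0.
Proof. by rewrite -mulmxA mulmxBl mul1mx avg_idem subrr mulmx0. Qed.

Lemma h_avg : h *m E = 0.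
Proof. by rewrite mulmxBl -!mulmxA !avgE_l ?groupV ?gam_pstab ?subrr. Qed.

Lemma fixed_eq0 Y u : Y *m E = 0 -> u \in P0 -> u != 1%g -> Y *m rC u = Y -> Y = 0.
Proof.
move=> YE uP u1 Yu; rewrite -YE.
have rku : rk u = rk gam by rewrite rk_gam (fix_codim_pstab1 rC_inj rk_gam uP).
by rewrite (avg_fixed (fixed_by_pstab (pstab1_sub uP) rku Yu)).
Qed.

Lemma lam_t : lam *m rC t = lam. Proof. exact: lam_cent. Qed.

Lemma b_t : b *m rC t = b.
Proof.
by rewrite -mulmxA mulmxBl mul1mx avgE_r // mulmxBr lam_t /b mulmxBr mulmx1.
Qed.

Lemma b_neq0 : b != 0.
Proof.
apply: contra lam_moved; rewrite /b mulmxBr mulmx1 subr_eq0 => /eqP ->.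
by rewrite -mulmxA avgE_r // gam_pstab.
Qed.

Lemma b_swap u : u \in P0 -> b *m rC u *m rC t = b *m rC u^-1%g.
Proof. by move=> uP; rewrite -mulmxA -(repr_mulg rC) refl_swap // (repr_mulg rC) mulmxA b_t. Qed.

Lemma h_t : h *m rC t = - h.
Proof. by rewrite mulmxBl !b_swap ?groupV // invgK opprB. Qed.

Lemma gam2_neq1 : (gam * gam != 1)%g.
Proof.
apply: contra gam1 => /eqP g2; apply/eqP; apply: (pstab1_sqr_inj gamP0 (group1 _)).
by rewrite mulg1.
Qed.

Lemma mul_pm X u : X *m rC u = X *m rC u^-1%g -> X *m rC (u * u)%g = X.
Proof. by move=> e; rewrite (repr_mulg rC) mulmxA e -mulmxA (repr_mulVg rC) mulmx1. Qed.

Lemma h_neq0 : h != 0.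
Proof.
apply: contra b_neq0; rewrite subr_eq0 => /eqP /mul_pm e; apply/eqP.
exact: (fixed_eq0 b_avg (groupM gamP0 gamP0) gam2_neq1 e).
Qed.

Lemma two_neq0 : (2%:R : R[i]) != 0. Proof. by rewrite pnatr_eq0. Qed.

Lemma add_self_eq0 (Y : 'rV[R[i]]_n) : Y = - Y -> Y = 0.
Proof.
move=> e; have /eqP : 2%:R *: Y = 0 by rewrite scaler_nat mulr2n {2}e subrr.
by rewrite scaler_eq0 (negbTE two_neq0) => /eqP.
Qed.

(** The columns c1 and c2 are the coordinates along b and h. *)
Lemma dihedral_decomposition : exists c1 c2 : 'cV[R[i]]_n,
  [/\ 1%:M - E = c1 *m b + c2 *m h,
      b *m c1 = 1%:M /\ h *m c1 = 0, b *m c2 = 0 /\ h *m c2 = 1%:M & E *m c1 = 0 /\ E *m c2 = 0].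
Proof.
have nhb : ~~ (h <= b)%MS.
  apply/negP => /sub_rVP[a e]; case/eqP: h_neq0; apply: add_self_eq0.
  by rewrite -h_t e -scalemxAl b_t.
have rk2 := rank_pair b_neq0 nhb.
have EE : (1%:M - E) *m (1%:M - E) = 1%:M - E.
  by rewrite mulmxBl mul1mx mulmxBr mulmx1 avg_idem subrr subr0.
have bE : b *m (1%:M - E) = b by rewrite mulmxBr mulmx1 b_avg subr0.
have hE : h *m (1%:M - E) = h by rewrite mulmxBr mulmx1 h_avg subr0.
have le0 := one_sub_avg (subxx P); rewrite -/E in le0.
have Ule : (col_mx b h <= rC gam - 1%:M)%MS.
  by rewrite col_mx_sub -bE -hE !(submx_trans (submxMl _ _) le0).
have Ueq : (col_mx b h == rC gam - 1%:M)%MS.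
  rewrite -(mxrank_leqif_eq Ule) -/(fix_codim rC gam) rk_gam eqn_leq rk2 andbT.
  by have := mxrankS Ule; rewrite -/(fix_codim rC gam) rk_gam.
have : (1%:M - E <= col_mx b h)%MS by rewrite (eqmxP Ueq).
case/submxP => D0; rewrite -[D0]hsubmxK mul_row_col; set d1 := lsubmx D0; set d2 := rsubmx D0.
move=> e; pose c1 := (1%:M - E) *m d1; pose c2 := (1%:M - E) *m d2.
have e' : 1%:M - E = c1 *m b + c2 *m h by rewrite /c1 /c2 -!mulmxA -mulmxDr -e EE.
have fr : row_free (col_mx b h).
  by rewrite /row_free eqn_leq rank_leq_row; exact: rk2.
have id : col_mx b h *m row_mx c1 c2 = 1%:M.
  apply: (row_free_inj fr); rewrite mul1mx -mulmxA mul_row_col -e'.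
  by rewrite mul_col_mx bE hE.
move: id; rewrite mul_col_row scalar_mx_block => /eq_block_mx[i1 i2 i3 i4].
exists c1, c2; split=> //.
by split; rewrite mulmxA mulmxBr mulmx1 avg_idem subrr mul0mx.
Qed.

Section Coordinates.
Variables c1 c2 : 'cV[R[i]]_n.
Hypothesis dec : 1%:M - E = c1 *m b + c2 *m h.
Hypotheses (bc1 : b *m c1 = 1%:M) (hc1 : h *m c1 = 0).
Hypotheses (bc2 : b *m c2 = 0) (hc2 : h *m c2 = 1%:M).

(** The coordinates of b u. In the real form of the plane they would be the
    cosine and a multiple of the sine of the angle of u. *)
Definition gcos u : R[i] := (b *m rC u *m c1) 0 0.
Definition gsin u : R[i] := (b *m rC u *m c2) 0 0.

Lemma coordE (X : 'rV[R[i]]_n) (Y : 'rV[R[i]]_n) (c : 'cV[R[i]]_n) :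
  X *m (c *m Y) = (X *m c) 0 0 *: Y.
Proof.
rewrite mulmxA -mul_scalar_mx; congr (_ *m _).
by apply/matrixP => i j; rewrite !ord1 [RHS]mxE eqxx mulr1n.
Qed.

Lemma coord_dec X : X - X *m E = (X *m c1) 0 0 *: b + (X *m c2) 0 0 *: h.
Proof. by rewrite -{1}[X]mulmx1 -mulmxBr dec mulmxDr !coordE. Qed.

Lemma moved_dec X : X *m E = 0 -> X = (X *m c1) 0 0 *: b + (X *m c2) 0 0 *: h.
Proof. by move=> XE; rewrite -coord_dec XE subr0. Qed.

Lemma coord_b p q : ((p *: b + q *: h) *m c1) 0 0 = p.
Proof. by rewrite mulmxDl -!scalemxAl bc1 hc1 scaler0 addr0 !mxE mulr1. Qed.

Lemma coord_h p q : ((p *: b + q *: h) *m c2) 0 0 = q.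
Proof. by rewrite mulmxDl -!scalemxAl bc2 hc2 scaler0 add0r !mxE mulr1. Qed.

Lemma moved_mul X u : X *m E = 0 -> u \in P0 -> (X *m rC u) *m E = 0.
Proof. by move=> XE uP; rewrite -mulmxA avgE_l ?XE // pstab1_sub. Qed.

Lemma b_mul u : u \in P0 -> b *m rC u = gcos u *: b + gsin u *: h.
Proof. by move=> uP; apply: moved_dec; apply: moved_mul => //; exact: b_avg. Qed.

Lemma b_mulV u : u \in P0 -> b *m rC u^-1%g = gcos u *: b - gsin u *: h.
Proof.
move=> uP; rewrite -b_swap //; move: (gcos u) (gsin u) (b_mul uP) => p q ->.
by rewrite mulmxDl -!scalemxAl b_t h_t scalerN.
Qed.

Lemma gcosV u : u \in P0 -> gcos u^-1%g = gcos u.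
Proof. by move=> uP; rewrite [LHS]/gcos b_mulV // -scaleNr coord_b. Qed.

Lemma gsinV u : u \in P0 -> gsin u^-1%g = - gsin u.
Proof. by move=> uP; rewrite [LHS]/gsin b_mulV // -scaleNr coord_h. Qed.

Lemma gcos1 : gcos 1%g = 1.
Proof. by rewrite /gcos (repr_oneg rC) mulmx1 bc1 mxE. Qed.

Lemma real_half (a : R[i]) : a + a = (Re (a + a))%:C%C -> a = (Re a)%:C%C.
Proof.
case: a => p q /eqP; rewrite eq_complex /= => /andP[_ /eqP e].
apply/eqP; rewrite eq_complex /= eqxx /=; apply/eqP.
have /eqP : 2%:R * q = 0 by rewrite mulr_natl mulr2n.
by rewrite mulf_eq0 pnatr_eq0 => /eqP.
Qed.

(** The sum b u + b u^-1 is fixed by t, so it is a multiple of b, which is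
    real by real_eigenvalue. *)
Lemma gcos_real u : u \in P0 -> gcos u = (Re (gcos u))%:C%C.
Proof.
move=> uP; apply: real_half; apply: (real_eigenvalue B_inner b_neq0 (g := u)).
rewrite b_mulV // {1}b_mul // addrACA subrr addr0 scalerDl.
by [].
Qed.

Let hh := h *m rC gam - h *m rC gam^-1%g.
(* Minus k0 is the square of the ratio of the sine to gsin. *)
Let k0 := (hh *m c1) 0 0.

(** The vector hh lies in the moved plane and is fixed by t. *)
Lemma hh_eq : hh = k0 *: b.
Proof.
have hhE : hh *m E = 0.
  by rewrite mulmxBl !moved_mul ?groupV ?subrr // h_avg.
have hs u : u \in P0 -> h *m rC u *m rC t = - (h *m rC u^-1%g).
  by move=> uP; rewrite -mulmxA -(repr_mulg rC) refl_swap // (repr_mulg rC) mulmxA h_t mulNmx.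
have hht : hh *m rC t = hh by rewrite mulmxBl !hs ?groupV // invgK opprK addrC.
rewrite {1}(moved_dec hhE) -/k0; set q := (hh *m c2) 0 0.
suff -> : q *: h = 0 by rewrite addr0.
apply: add_self_eq0; rewrite -scalerN -h_t scalemxAl.
have := hht; rewrite {1 2}(moved_dec hhE) -/q -/k0 mulmxDl -[k0 *: b *m _]scalemxAl b_t.
by move/addrI.
Qed.

Lemma scale_sub (p q : R[i]) (X X' Y Y' : 'rV[R[i]]_n) :
  p *: X + q *: Y - (p *: X' + q *: Y') = p *: (X - X') + q *: (Y - Y').
Proof. by rewrite opprD addrACA -!scalerBr. Qed.

Lemma h_mul u : u \in P0 -> h *m rC u = (gsin u * k0) *: b + gcos u *: h.
Proof.
move=> uP.
have comm v : v \in P0 -> rC v *m rC u = rC u *m rC v.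
  by move=> vP; rewrite -!(repr_mulg rC) (pstab1_comm vP uP).
have hv v : v \in P0 -> b *m rC v *m rC u = b *m rC u *m rC v.
  by move=> vP; rewrite -!(mulmxA b) comm.
have -> : h *m rC u = gcos u *: h + gsin u *: hh.
  rewrite {1}/h mulmxBl (hv _ gamP0) (hv _ (groupVr gamP0)); move: (gcos u) (gsin u) (b_mul uP) => p q bu.
  rewrite !bu !mulmxDl -!scalemxAl.
  exact: scale_sub.
by rewrite hh_eq scalerA addrC.
Qed.

Lemma gsin_gam : gsin gam + gsin gam = 1.
Proof.
have e : h = (gsin gam + gsin gam) *: h.
  move: (gsin gam) (gcos gam) (b_mulV gamP0) (b_mul gamP0) => q p bv bu.
  by rewrite {1}/h bu bv scalerDl; zmod.
apply/eqP; rewrite -subr_eq0; have := h_neq0; apply: contraR => ne; apply/eqP.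
have /eqP : (gsin gam + gsin gam - 1) *: h = 0 by rewrite scalerBl -e scale1r subrr.
by rewrite scaler_eq0 (negbTE ne) => /eqP.
Qed.

Lemma b_mulM u v : u \in P0 -> v \in P0 ->
  b *m rC (u * v)%g = (gcos u * gcos v + gsin u * (gsin v * k0)) *: b + (gcos u * gsin v + gsin u * gcos v) *: h.
Proof.
move=> uP vP; rewrite (repr_mulg rC) (mulmxA b).
move: (gcos u) (gsin u) (b_mul uP) (gcos v) (gsin v) (b_mul vP) (h_mul vP) => p q -> p' q' ev eh.
rewrite mulmxDl -!scalemxAl ev eh; move: b h k0 => X Y k; rewrite !scalerDr !scalerA !scalerDl.
by rewrite addrACA.
Qed.

Lemma gcos_mul u v : u \in P0 -> v \in P0 -> gcos (u * v)%g = gcos u * gcos v + gsin u * (gsin v * k0).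
Proof. by move=> uP vP; rewrite [LHS]/gcos (b_mulM uP vP) coord_b. Qed.

Lemma gsin_mul u v : u \in P0 -> v \in P0 -> gsin (u * v)%g = gcos u * gsin v + gsin u * gcos v.
Proof. by move=> uP vP; rewrite [LHS]/gsin (b_mulM uP vP) coord_h. Qed.

Lemma gcos_norm u : u \in P0 -> gcos u * gcos u - gsin u * (gsin u * k0) = 1.
Proof.
move=> uP; have := gcos_mul uP (groupVr uP).
by rewrite mulgV gcos1 gcosV // gsinV // mulNr mulrN => <-.
Qed.

(** Follows from gcos_norm at gam, where gsin is 1/2. *)
Lemma k0_real : k0 = (Re k0)%:C%C.
Proof.
have e : k0 = (gcos gam * gcos gam - 1) * 4%:R.
  rewrite -{1}(gcos_norm gamP0) opprB addrC addrNK; set q := gsin gam.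
  have -> : q * (q * k0) * 4%:R = (q + q) * (q + q) * k0 by ring.
  by rewrite gsin_gam !mul1r.
have -> // : k0 = ((Re (gcos gam) * Re (gcos gam) - 1) * 4%:R)%:C%C.
by rewrite e (gcos_real gamP0) rmorphM rmorphB rmorphM rmorph1 rmorph_nat.
Qed.

Lemma k0_neq0 : k0 != 0.
Proof.
apply: contra h_neq0 => /eqP k00; apply/eqP.
apply: (fixed_eq0 h_avg (groupM gamP0 gamP0) gam2_neq1); apply: mul_pm.
by apply/eqP; rewrite -subr_eq0 -/hh hh_eq k00 scale0r.
Qed.

(** By the addition formula, the cosine of u gam determines the sine of u. *)
Lemma gsin_real u : u \in P0 -> gsin u = (Re (gsin u))%:C%C.
Proof.
move=> uP.
have e : gsin u * k0 = (gcos (u * gam)%g - gcos u * gcos gam) * 2%:R.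
  rewrite gcos_mul // addrC addKr; set q := gsin gam.
  have -> : gsin u * (q * k0) * 2%:R = (q + q) * (gsin u * k0) by ring.
  by rewrite gsin_gam mul1r.
have r1 : gsin u * k0 = (Re (gsin u * k0))%:C%C.
  have -> // : gsin u * k0 = ((Re (gcos (u * gam)%g) - Re (gcos u) * Re (gcos gam)) * 2%:R)%:C%C.
  by rewrite e (gcos_real (groupM uP gamP0)) (gcos_real uP) (gcos_real gamP0) rmorphM rmorphB rmorphM rmorph_nat.
have -> : gsin u = (gsin u * k0) / k0 by rewrite mulfK ?k0_neq0.
have -> // : gsin u * k0 / k0 = (Re (gsin u * k0) / Re k0)%:C%C.
by rewrite r1 {2}k0_real rmorphM fmorphV.
Qed.

Hypotheses (Ec1 : E *m c1 = 0) (Ec2 : E *m c2 = 0).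
Definition rcos u : R := Re (gcos u).
Definition rsin u : R := Re (gsin u).
Definition rdisc : R := Re k0.

Lemma gcosE u : u \in P0 -> gcos u = (rcos u)%:C%C. Proof. exact: gcos_real. Qed.
Lemma gsinE u : u \in P0 -> gsin u = (rsin u)%:C%C. Proof. exact: gsin_real. Qed.
Lemma k0E : k0 = rdisc%:C%C. Proof. exact: k0_real. Qed.

Lemma complexR_inj : injective (real_complex R). Proof. by move=> p q []. Qed.

Lemma rcos_norm u : u \in P0 -> rcos u * rcos u - rdisc * (rsin u * rsin u) = 1.
Proof.
move=> uP; have := gcos_norm uP; rewrite gcosE // gsinE // k0E -!rmorphM -rmorphB -(rmorph1 (real_complex R)).
by move/complexR_inj <-; ring.
Qed.

Lemma rcos_sqr u : u \in P0 -> rcos (u * u)%g = rcos u * rcos u + rdisc * (rsin u * rsin u).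
Proof.
move=> uP; apply: complexR_inj; rewrite -gcosE ?groupM // gcos_mul // gcosE // gsinE // k0E -!rmorphM -rmorphD.
by congr (_%:C%C); ring.
Qed.

Lemma rsin_sqr u : u \in P0 -> rsin (u * u)%g = rcos u * rsin u + rcos u * rsin u.
Proof.
move=> uP; apply: complexR_inj; rewrite -gsinE ?groupM // gsin_mul // gcosE // gsinE // -!rmorphM -rmorphD.
by congr (_%:C%C); ring.
Qed.

(** The sum is fixed by the rotations. *)
Lemma sum_b_mul : \sum_(u in P0) b *m rC u = 0.
Proof.
apply: (fixed_eq0 _ gamP0 gam1).
  by rewrite mulmx_suml big1 // => u uP; apply: moved_mul => //; exact: b_avg.
rewrite mulmx_suml [RHS](reindex_inj (mulIg gam)) /=.
by apply: eq_big => [u|u _]; rewrite ?groupMr // (repr_mulg rC) mulmxA.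
Qed.

Lemma sum_rcos : \sum_(u in P0) rcos u = 0.
Proof.
apply: complexR_inj; rewrite rmorph_sum rmorph0.
have := congr1 (fun Y : 'rV_n => (Y *m c1) 0 0) sum_b_mul; rewrite mulmx_suml summxE mul0mx mxE => e; rewrite -[RHS]e.
by apply: eq_bigr => u uP; exact/esym/gcosE.
Qed.

Lemma sum_rsin : \sum_(u in P0) rsin u = 0.
Proof.
apply: complexR_inj; rewrite rmorph_sum rmorph0.
have := congr1 (fun Y : 'rV_n => (Y *m c2) 0 0) sum_b_mul; rewrite mulmx_suml summxE mul0mx mxE => e; rewrite -[RHS]e.
by apply: eq_bigr => u uP; exact/esym/gsinE.
Qed.

(** The cosines of the doubled angles have sum zero as well, since squaring
    permutes the rotations. *)
Lemma sum_rcos2 : \sum_(u in P0) rcos u * rcos u = - (rdisc * \sum_(u in P0) rsin u * rsin u).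
Proof.
apply/eqP; rewrite -addr_eq0 mulr_sumr -big_split /= -[X in _ == X]sum_rcos -(sum_sqr rcos); apply/eqP.
by apply: eq_bigr => u uP; rewrite rcos_sqr.
Qed.

Lemma sum_rcos_rsin : \sum_(u in P0) rcos u * rsin u = 0.
Proof.
have := sum_sqr rsin; rewrite sum_rsin (eq_bigr (fun u => rcos u * rsin u + rcos u * rsin u)); last exact: rsin_sqr.
rewrite big_split /= -mulr2n -mulr_natl => /eqP.
by rewrite mulf_eq0 pnatr_eq0 => /eqP.
Qed.

Local Notation z1 := (lin_coord c1).
Local Notation z2 := (lin_coord c2).

Lemma row_dec X : X = (X *m c1) 0 0 *: b + (X *m c2) 0 0 *: h + X *m E.
Proof. by rewrite -coord_dec subrK. Qed.

Lemma lin_coord1_rho x u : u \in P0 ->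
  z1 (x *m rho u) = (rcos u)%:C%C * z1 x + (rsin u * rdisc)%:C%C * z2 x.
Proof.
move=> uP; have -> : (rsin u * rdisc)%:C%C = gsin u * k0 by rewrite gsinE // k0E -rmorphM.
rewrite -gcosE // {1}/lin_coord cx_rho {1}[cx x]row_dec -!/(lin_coord _ _).
rewrite !mulmxDl -(mulmxA (cx x)) avgE_r ?pstab1_sub // -(mulmxA (cx x)) Ec1 mulmx0 addr0.
rewrite -!scalemxAl b_mul // h_mul // !mulmxDl -!scalemxAl bc1 hc1 !scaler0 !addr0 !mxE.
by rewrite !mulr1 mulrC [X in _ + X]mulrC.
Qed.

Lemma lin_coord2_rho x u : u \in P0 ->
  z2 (x *m rho u) = (rcos u)%:C%C * z2 x + (rsin u)%:C%C * z1 x.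
Proof.
move=> uP; rewrite -gcosE // -gsinE // {1}/lin_coord cx_rho {1}[cx x]row_dec -!/(lin_coord _ _).
rewrite !mulmxDl -(mulmxA (cx x)) avgE_r ?pstab1_sub // -(mulmxA (cx x)) Ec2 mulmx0 addr0.
rewrite -!scalemxAl b_mul // h_mul // !mulmxDl -!scalemxAl bc2 hc2 !scaler0 !add0r !mxE.
by rewrite !mulr1 addrC mulrC [X in _ + X]mulrC.
Qed.

Lemma lin_coord1_t x : z1 (x *m rho t) = z1 x.
Proof.
rewrite {1}/lin_coord cx_rho {1}[cx x]row_dec -!/(lin_coord _ _).
rewrite !mulmxDl -(mulmxA (cx x)) avgE_r // -(mulmxA (cx x)) Ec1 mulmx0 addr0.
by rewrite -!scalemxAl b_t h_t mulNmx bc1 hc1 oppr0 scaler0 addr0 !mxE mulr1.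
Qed.

Lemma lin_coord2_t x : z2 (x *m rho t) = - z2 x.
Proof.
rewrite {1}/lin_coord cx_rho {1}[cx x]row_dec -!/(lin_coord _ _).
rewrite !mulmxDl -(mulmxA (cx x)) avgE_r // -(mulmxA (cx x)) Ec2 mulmx0 addr0.
by rewrite -!scalemxAl b_t h_t mulNmx bc2 hc2 scaler0 add0r !mxE mulrN mulr1.
Qed.

(** In the real coordinates x1, x3 (real and imaginary part along b) and x2,
    x4 (along h), vol is the 3-form x2 x4 x3 and vol' is x1 x4 x3. *)
Definition vol x y z : R := area c2 x y * Im (z1 z) + area c2 y z * Im (z1 x) + area c2 z x * Im (z1 y).
Definition area12 x y : R := Re (z1 x) * Im (z2 y) - Im (z2 x) * Re (z1 y).
Definition vol' x y z : R := area12 x y * Im (z1 z) + area12 y z * Im (z1 x) + area12 z x * Im (z1 y).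

Lemma Re_lin p q (a c : R[i]) : Re (p%:C%C * a + q%:C%C * c) = p * Re a + q * Re c.
Proof. by case: a => a1 a2; case: c => c'1 c'2 /=; ring. Qed.

Lemma Im_lin p q (a c : R[i]) : Im (p%:C%C * a + q%:C%C * c) = p * Im a + q * Im c.
Proof. by case: a => a1 a2; case: c => c'1 c'2 /=; ring. Qed.

(** A rotation mixes (x1, x2) and (x3, x4) by the same real matrix of
    determinant one. *)
Lemma vol_rho u x y z : u \in P0 ->
  vol (x *m rho u) (y *m rho u) (z *m rho u) = rcos u * vol x y z + rsin u * vol' x y z.
Proof.
move=> uP; rewrite -[RHS]mul1r -(rcos_norm uP) /vol /vol' /area /area12.
have I1 (v : 'rV[R]_(n + n)) : Im (z1 (v *m rho u)) = rcos u * Im (z1 v) + rsin u * rdisc * Im (z2 v).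
  by rewrite (lin_coord1_rho v uP) Im_lin.
have R2 (v : 'rV[R]_(n + n)) : Re (z2 (v *m rho u)) = rcos u * Re (z2 v) + rsin u * Re (z1 v).
  by rewrite (lin_coord2_rho v uP) Re_lin.
have I2 (v : 'rV[R]_(n + n)) : Im (z2 (v *m rho u)) = rcos u * Im (z2 v) + rsin u * Im (z1 v).
  by rewrite (lin_coord2_rho v uP) Im_lin.
move: (I1 x) (I1 y) (I1 z) (R2 x) (R2 y) (R2 z) (I2 x) (I2 y) (I2 z).
move: (z1 (x *m _)) (z1 (y *m _)) (z1 (z *m _)) (z2 (x *m _)) (z2 (y *m _)) (z2 (z *m _)).
move: (rcos u) (rsin u) rdisc (z1 x) (z1 y) (z1 z) (z2 x) (z2 y) (z2 z) => c s' k.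
case=> p1 q1 [p2 q2] [p3 q3] [a1 b1] [a2 b2] [a3 b3] f1 f2 f3 f4 f5 f6.
by move=> -> -> -> -> -> -> -> -> -> /=; ring.
Qed.

Lemma reflection_dec : rC t - 1%:M = c2 *m (- (h + h)).
Proof.
have : (1%:M - E) *m (rC t - 1%:M) = rC t - 1%:M.
  rewrite mulmxBl mul1mx mulmxBr mulmx1.
  by rewrite avgE_r // subrr subr0.
have bt : b *m (rC t - 1%:M) = 0 by rewrite mulmxBr mulmx1 b_t subrr.
have ht : h *m (rC t - 1%:M) = - (h + h) by rewrite mulmxBr mulmx1 h_t -opprD.
by move=> <-; rewrite dec mulmxDl -(mulmxA c1) bt mulmx0 add0r -mulmxA ht.
Qed.

Section Bracket.
Variable pi : Gamma -> 'rV[R]_(n + n) -> 'rV[R]_(n + n) -> 'rV[R]_(n + n).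
Hypothesis pi_poisson : linear_poisson rho B pi.
Variables (L : 'rV[R]_(n + n)) (k : R).
Hypothesis lamE : lam = cx L.
Hypothesis pi_tE : forall x y, pi t x y = (k * area c2 x y) *: L.
Variable w : Gamma.
Hypotheses (wP : w \in P0) (gamw : gam = (w * w)%g).
Local Notation act := (dual_act rho).
Local Notation W := (poisson_bracket rho pi).

Lemma pi_conj g q x y : pi (g * q * g^-1)%g x y = act g (pi q (x *m rho g) (y *m rho g)).
Proof. by rewrite -(pi_inv pi_poisson) /dual_act -!mulmxA !(repr_mulgV rho) !mulmx1. Qed.

Lemma lam_dec : lam = lam *m E + b.
Proof. by rewrite /b mulmxBr mulmx1 addrC subrK. Qed.

Lemma z1L : z1 L = 1.
Proof. by rewrite /lin_coord -lamE lam_dec mulmxDl -mulmxA Ec1 mulmx0 add0r bc1 mxE. Qed.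

Lemma z2L : z2 L = 0.
Proof. by rewrite /lin_coord -lamE lam_dec mulmxDl -mulmxA Ec2 mulmx0 add0r bc2 mxE. Qed.

(** With gam = w^2, the cofactor of a reflection of the dihedral group is its
    conjugate by w. *)
Lemma factor_conj u : u \in P0 ->
  (gam * (u * t * u^-1)^-1 = (w * u) * t * (w * u)^-1)%g.
Proof.
move=> uP; have ti : (t^-1 = t)%g by apply: (mulgI t); rewrite mulgV.
have -> : ((w * u)^-1 = u^-1 * w^-1)%g by rewrite invMg.
rewrite !invMg invgK ti gamw.
have := refl_swap (groupVr wP); rewrite invgK => tw.
have := refl_swap wP => wt.
have wu := pstab1_comm wP uP.
have wuV : (u^-1 * w^-1 = w^-1 * u^-1)%g by rewrite -!invMg wu.
have -> : (w * u * t * (u^-1 * w^-1) = w * u * (t * w^-1) * u^-1)%g by rewrite wuV !mulgA.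
by rewrite -wt !mulgA -(mulgA w u w) -wu !mulgA.
Qed.

(** After conjugating by w u, the inner value becomes a multiple of L w, whose
    h-coordinate is the sine of w, and only the b-coordinate of z survives in
    z + t z. *)
Lemma pi_pi_conj u x y z : u \in P0 ->
  pi (gam * (u * t * u^-1)^-1)%g (pi (u * t * u^-1)%g x y) (z + act (u * t * u^-1)%g z)
  = (2%:R * k * k * (rsin w * rsin w) * (area c2 (x *m rho u) (y *m rho u) * Im (z1 (z *m rho u))))
     *: act (w * u)%g L.
Proof.
move=> uP; rewrite (factor_conj uP) !pi_conj pi_tE.
have wu := pstab1_comm wP uP.
have ti : (t^-1 = t)%g by apply: (mulgI t); rewrite mulgV.
have actrho g q (Y : 'rV[R]_(n + n)) : act g Y *m rho q = Y *m rho (g^-1 * q)%g.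
  by rewrite /dual_act -mulmxA -(repr_mulg rho).
have -> : act u (pi t (x *m rho u) (y *m rho u)) *m rho (w * u)%g
          = (k * area c2 (x *m rho u) (y *m rho u)) *: (L *m rho w).
  by rewrite pi_tE actrho wu mulKg scalemxAl.
have -> : (z + act (u * t * u^-1)%g z) *m rho (w * u)%g
          = (z *m rho u + z *m rho u *m rho t) *m rho w.
  rewrite (mulmxDl z) actrho wu !invMg invgK ti !mulgA mulgVK (repr_mulg rho) mulmxA mulmxDl.
  by rewrite !(repr_mulg rho) !mulmxA.
set zu := z *m rho u; set o := area c2 (x *m rho u) _.
have e1 : z2 ((k * o) *: (L *m rho w)) = (k * o * rsin w)%:C%C.
  by rewrite lin_coordZ lin_coord2_rho // z1L z2L mulr0 add0r mulr1 -rmorphM.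
have e2 : Im (z2 ((zu + zu *m rho t) *m rho w)) = rsin w * (Im (z1 zu) + Im (z1 zu)).
  rewrite lin_coord2_rho // Im_lin !lin_coordD lin_coord1_t lin_coord2_t subrr raddf0 mulr0 add0r.
  by rewrite raddfD.
rewrite /area e1 e2 /= mul0r subr0 /dual_act scalemxAl; congr (_ *m _); congr (_ *: _).
by ring.
Qed.

Lemma term_conj u x y z : u \in P0 ->
  bracket_term rC pi (gam * (u * t * u^-1)^-1)%g (u * t * u^-1)%g x y z
  = (2%:R * k * k * (rsin w * rsin w) * (rcos u * vol x y z + rsin u * vol' x y z)) *: act (w * u)%g L.
Proof.
move=> uP; rewrite /bracket_term !pi_pi_conj // -!scalerDl -vol_rho //; congr (_ *: _).
by rewrite /vol !mulrDr.
Qed.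

Lemma cx_act_L u : u \in P0 -> cx (act (w * u)%g L)
  = lam *m E + ((rcos u)%:C%C *: b - (rsin u)%:C%C *: h) *m rC w^-1%g.
Proof.
move=> uP; have bV : b *m rC u^-1%g = (rcos u)%:C%C *: b - (rsin u)%:C%C *: h.
  by rewrite b_mulV // gcosE // gsinE.
have lE g : g \in P -> lam *m E *m rC g = lam *m E by move=> gP; rewrite -mulmxA avgE_r.
have lu : lam *m rC u^-1%g = lam *m E + ((rcos u)%:C%C *: b - (rsin u)%:C%C *: h).
  by rewrite -bV -{1}(lE u^-1%g) -?mulmxDl -?lam_dec // groupV pstab1_sub.
rewrite cx_act -lamE invMg (repr_mulg rC) mulmxA lu mulmxDl lE //.
by rewrite groupV pstab1_sub.
Qed.

Lemma sum_terms (I : finType) (A : {set I}) (c s' : I -> R[i]) (a p q : R[i]) (f b' h' : 'rV[R[i]]_n) :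
  \sum_(u in A) (a * (c u * p + s' u * q)) *: (f + (c u *: b' - s' u *: h'))
  = (\sum_(u in A) c u) *: ((a * p) *: f) + (\sum_(u in A) s' u) *: ((a * q) *: f)
    + (\sum_(u in A) c u * c u) *: ((a * p) *: b')
    + (\sum_(u in A) c u * s' u) *: ((a * q) *: b' - (a * p) *: h')
    - (\sum_(u in A) s' u * s' u) *: ((a * q) *: h').
Proof.
rewrite !scaler_suml -sumrN -!big_split; apply: eq_bigr => u _ /=.
by apply/rowP => j; rewrite !mxE; ring.
Qed.

Local Notation S := (\sum_(u in P0) rsin u * rsin u).

(** Summing over the rotations, the terms linear in sine and cosine and the
    products of a sine and a cosine disappear, and the two sums of squares are
    related by sum_rcos2. *)
Lemma cx_sum_terms x y z :
  cx (\sum_(u in P0) bracket_term rC pi (gam * (u * t * u^-1)^-1)%g (u * t * u^-1)%g x y z)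
  = - ((2%:R * k * k * (rsin w * rsin w) * S)%:C%C *:
        ((rdisc * vol x y z)%:C%C *: b + (vol' x y z)%:C%C *: h) *m rC w^-1%g).
Proof.
rewrite cx_sum; set a := 2%:R * k * k * _; set p := vol x y z; set q := vol' x y z.
transitivity (\sum_(u in P0) (a%:C%C * ((rcos u)%:C%C * p%:C%C + (rsin u)%:C%C * q%:C%C)) *:
   (lam *m E + ((rcos u)%:C%C *: (b *m rC w^-1%g) - (rsin u)%:C%C *: (h *m rC w^-1%g)))).
  apply: eq_bigr => u uP; rewrite term_conj // cxZ cx_act_L // mulmxBl -!scalemxAl.
  by rewrite [X in X *: _]rmorphM [X in _ * X]rmorphD [X in X + _]rmorphM [X in _ + X]rmorphM.
rewrite sum_terms.
have sumC (F : Gamma -> R) : \sum_(u in P0) (F u)%:C%C = (\sum_(u in P0) F u)%:C%C.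
  by rewrite rmorph_sum.
have sumCC (F G : Gamma -> R) : \sum_(u in P0) (F u)%:C%C * (G u)%:C%C = (\sum_(u in P0) F u * G u)%:C%C.
  by rewrite rmorph_sum; apply: eq_bigr => u _; rewrite rmorphM.
rewrite !sumC !sumCC sum_rcos sum_rsin sum_rcos2 sum_rcos_rsin !scale0r !add0r addr0.
move: S => Q; rewrite -!rmorphM !scalerA -!rmorphM.
move: b h (rC w^-1%g) p q => X Y M p q.
rewrite -scalemxAl mulmxDl -!scalemxAl scalerDr opprD !scalerA -!rmorphM -!scaleNr -!rmorphN.
by congr ((_%:C%C *: _) + (_%:C%C *: _)); ring.
Qed.

Definition kappa_scale : R := k * k * rsin w * S / 2%:R.
(** The multiple of the 2-form x3 x4 for which dihedral_kappa_bracket and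
    cx_sum_terms have the same right-hand side. *)
Definition dihedral_kappa x y : R := kappa_scale * (Im (z1 x) * Im (z2 y) - Im (z2 x) * Im (z1 y)).

(** Writing x - gam x as (x w - x w^-1) w^-1 makes it a multiple of the sine
    of w. *)
Lemma move_gam x : cx (x - act gam x) =
  ((rsin w + rsin w)%:C%C *: (z1 x *: h + (rdisc%:C%C * z2 x) *: b)) *m rC w^-1%g.
Proof.
have bw : b *m rC w - b *m rC w^-1%g = (gsin w + gsin w) *: h.
  by rewrite b_mulV // b_mul // scalerDl; move: (gcos w) (gsin w) b h => p q Y X; zmod.
have hw : h *m rC w - h *m rC w^-1%g = (gsin w + gsin w) *: (k0 *: b).
  rewrite h_mul // h_mul ?groupV // gcosV // gsinV // scalerDl !scalerA mulNr scaleNr.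
  by move: (gcos w) (gsin w * k0) b h => p q Y X; zmod.
have Ew g : g \in P -> cx x *m E *m rC g = cx x *m E by move=> gP; rewrite -mulmxA avgE_r.
have wPP := pstab1_sub wP.
have e : cx x *m rC w - cx x *m rC w^-1%g = (gsin w + gsin w) *: (z1 x *: h + (k0 * z2 x) *: b).
  have XE v : v \in P -> cx x *m rC v = z1 x *: (b *m rC v) + z2 x *: (h *m rC v) + cx x *m E.
    move=> vP; rewrite {1}[cx x]row_dec -!/(lin_coord _ _).
    move: (z1 x) (z2 x) b h (cx x *m E) (Ew v vP) => p q Y X Z eZ.
    by rewrite !mulmxDl eZ -!scalemxAl.
  rewrite !XE ?groupV //.
  transitivity (z1 x *: (b *m rC w - b *m rC w^-1%g) + z2 x *: (h *m rC w - h *m rC w^-1%g)).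
    move: (b *m _) (b *m _) (h *m _) (h *m _) (cx x *m E) => A1 A2 A3 A4 A5.
    by rewrite !scalerBr; zmod.
  rewrite bw hw; move: (gsin w) (z1 x) (z2 x) k0 b h => p q q' k' Y X.
  by rewrite scalerDr !scalerA; congr (_ *: _ + _ *: _); ring.
have -> : (rsin w + rsin w)%:C%C = gsin w + gsin w by rewrite gsinE // rmorphD.
rewrite -k0E -e mulmxBl -!mulmxA (repr_mulgV rC) mulmx1 cxB cx_act.
by rewrite -(repr_mulg rC) gamw invMg.
Qed.

Lemma dihedral_kappa_vol' x y z :
  (dihedral_kappa y z)%:C%C * z1 x + (dihedral_kappa z x)%:C%C * z1 y + (dihedral_kappa x y)%:C%C * z1 z = - (kappa_scale * vol' x y z)%:C%C.
Proof.
rewrite /dihedral_kappa /vol' /area12; move: kappa_scale (z1 x) (z1 y) (z1 z) (z2 x) (z2 y) (z2 z) => c.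
case=> p1 q1 [p2 q2] [p3 q3] [a1 b1] [a2 b2] [a3 b3].
by apply/eqP; rewrite eq_complex /=; apply/andP; split; apply/eqP; ring.
Qed.

Lemma dihedral_kappa_vol x y z :
  (dihedral_kappa y z)%:C%C * z2 x + (dihedral_kappa z x)%:C%C * z2 y + (dihedral_kappa x y)%:C%C * z2 z = - (kappa_scale * vol x y z)%:C%C.
Proof.
rewrite /dihedral_kappa /vol /area; move: kappa_scale (z1 x) (z1 y) (z1 z) (z2 x) (z2 y) (z2 z) => c.
case=> p1 q1 [p2 q2] [p3 q3] [a1 b1] [a2 b2] [a3 b3].
by apply/eqP; rewrite eq_complex /=; apply/andP; split; apply/eqP; ring.
Qed.

Lemma comb3 (K : comNzRingType) (a1 a2 a3 s0 kk p1 p2 p3 q1 q2 q3 : K) (X Y : 'rV[K]_n) (M : 'M[K]_n) :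
  a1 *: ((s0 *: (p1 *: X + (kk * q1) *: Y)) *m M) + a2 *: ((s0 *: (p2 *: X + (kk * q2) *: Y)) *m M)
   + a3 *: ((s0 *: (p3 *: X + (kk * q3) *: Y)) *m M)
  = (s0 *: ((kk * (a1 * q1 + a2 * q2 + a3 * q3)) *: Y + (a1 * p1 + a2 * p2 + a3 * p3) *: X)) *m M.
Proof.
rewrite !(scalemxAl _ _ M) -!mulmxDl; congr (_ *m _).
by apply/rowP => j; rewrite !mxE; ring.
Qed.

Lemma dihedral_kappa_bracket x y z :
  cx ((dihedral_kappa y z *: (x - act gam x) + dihedral_kappa z x *: (y - act gam y) + dihedral_kappa x y *: (z - act gam z)) *+ 2)
  = - ((2%:R * k * k * (rsin w * rsin w) * S)%:C%C *:
        ((rdisc * vol x y z)%:C%C *: b + (vol' x y z)%:C%C *: h) *m rC w^-1%g).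
Proof.
set T := dihedral_kappa y z *: _ + _ + _.
have e : cx T = ((rsin w + rsin w)%:C%C *: ((rdisc%:C%C * - (kappa_scale * vol x y z)%:C%C) *: b
                   + (- (kappa_scale * vol' x y z)%:C%C) *: h)) *m rC w^-1%g.
  rewrite cxD cxD (cxZ (dihedral_kappa y z)) (cxZ (dihedral_kappa z x)) (cxZ (dihedral_kappa x y)) !move_gam.
  by rewrite -dihedral_kappa_vol -dihedral_kappa_vol'; exact: comb3.
rewrite mulr2n cxD e -mulmxDl -mulNmx; congr (_ *m _).
have -> : 2%:R * k * k * (rsin w * rsin w) * S = 2%:R * kappa_scale * (rsin w + rsin w).
  by rewrite /kappa_scale; field.
move: (rsin w) kappa_scale (vol _ _ _) (vol' _ _ _) rdisc b h => p c v v' kk Y X.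
apply/rowP => j; rewrite !mxE.
have cM (a1 a2 : R) : (a1 * a2)%:C%C = a1%:C%C * a2%:C%C by rewrite rmorphM.
rewrite !cM rmorphD rmorph_nat.
by ring.
Qed.

Lemma dihedral_kappa_real x y : Im (z1 x) = 0 -> Im (z2 x) = 0 -> dihedral_kappa x y = 0.
Proof. by move=> e1 e2; rewrite /dihedral_kappa e1 e2 !mul0r subrr mulr0. Qed.

(** The values of the pi_q have real coordinates, since rotations act by real
    matrices, and the form only involves imaginary parts. *)
Lemma dihedral_kappa_act_L u y a : u \in P0 -> dihedral_kappa (a *: act u L) y = 0.
Proof.
move=> uP; apply: dihedral_kappa_real; rewrite lin_coordZ /dual_act.
  rewrite lin_coord1_rho ?groupV // z1L z2L mulr0 addr0 mulr1 -rmorphM.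
  by [].
by rewrite lin_coord2_rho ?groupV // z1L z2L mulr0 add0r mulr1 -rmorphM.
Qed.

Lemma dihedral_kappa_fixed x y : (forall g, g \in P -> cx x *m rC g = cx x) -> dihedral_kappa x y = 0.
Proof.
move=> fx; have e : cx x *m E = cx x by exact: avg_fixed.
by apply: dihedral_kappa_real; rewrite /lin_coord -e -mulmxA (Ec1, Ec2) mulmx0 mxE.
Qed.

(** A reflection q with a value moved by gam satisfies the hypotheses made on
    t, so it has determinant -1 and lies in the coset t P0. *)
Lemma reflection_conj q x y : q \in P -> rk q = 1%N ->
  cx (pi q x y) *m rC gam != cx (pi q x y) -> exists2 u, u \in P0 & q = (u * t * u^-1)%g.
Proof.
move=> qP rkq moved.
have cent g : (g * q = q * g)%g -> cx (pi q x y) *m rC g = cx (pi q x y).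
  by move=> c; rewrite -cx_rho (pi_centralised B_inner pi_poisson).
have [_ dq _ _] := reflection_involution rC_inj rk_gam qP rkq gamP0 gam1
   (cent_pstab1 rC_inj rk_gam cent moved).
have [_ dt _ conj] := refl.
have [|u uP] := conj (t^-1 * q)%g; first by apply: pstab1_det => //; rewrite dq.
by rewrite mulKVg => e; exists u.
Qed.

Lemma dihedral_kappa_reflection q x y z : q \in P -> rk q = 1%N -> dihedral_kappa (pi q x y) z = 0.
Proof.
move=> qP rkq; have [fx|moved] := eqVneq (cx (pi q x y) *m rC gam) (cx (pi q x y)).
  by apply: dihedral_kappa_fixed; exact: (fixed_by_pstab (gam_pstab rC gam) erefl fx).
have [u uP ->] := reflection_conj qP rkq moved.
by rewrite pi_conj pi_tE /dual_act -scalemxAl; exact: dihedral_kappa_act_L.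
Qed.

Lemma conj_t_inj : {in P0 &, injective (fun u => (u * t * u^-1)%g)}.
Proof.
move=> u v uP vP /=; have e g : g \in P0 -> (g * t * g^-1 = g * g * t)%g.
  by move=> gP; rewrite -mulgA -refl_swap // mulgA.
by rewrite !e // => /mulIg; exact: pstab1_sqr_inj.
Qed.

(** The pairs of reflections that contribute are those with b conjugate to t
    by a rotation. For the others, the value of pi_b is fixed by gam and by b,
    hence by the cofactor. *)
Lemma bracket_dihedral x y z : W gam x y z =
  (dihedral_kappa y z *: (x - act gam x) + dihedral_kappa z x *: (y - act gam y) + dihedral_kappa x y *: (z - act gam z)) *+ 2.
Proof.
apply: cx_inj; rewrite dihedral_kappa_bracket -cx_sum_terms; congr cx.
pose T := [set (u * t * u^-1)%g | u in P0].
rewrite bracketE (bigID (mem T)) /= [X in _ + X]big1 ?addr0; last first.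
  move=> q qT; apply: term_eq0 => x' y' z'.
  have rg : rk gam != 1%N by rewrite rk_gam.
  have [q1|q1] := eqVneq q 1%g.
    by apply: (pi_pi_support B_inner pi_poisson); left; rewrite q1 invg1 mulg1.
  have [rq|rq] := eqVneq (rk q) 1%N; last first.
    by apply: (pi_pi_support B_inner pi_poisson); right.
  have [a1|a1] := eqVneq (gam * q^-1)%g 1%g.
    by move: rg; have := a1; move/eqP; rewrite -eq_mulgV1 => /eqP ->; rewrite rq.
  have [ra|ra] := eqVneq (rk (gam * q^-1)%g) 1%N; last first.
    by apply: (pi_pi_support B_inner pi_poisson); left.
  have gE : gam = (gam * q^-1 * q)%g by rewrite mulgKV.
  have [_ qP] := pair_in_pstab rk_gam gE ra rq.
  have [fx|moved] := eqVneq (cx (pi q x' y') *m rC gam) (cx (pi q x' y')); last first.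
    have [u uP e] := reflection_conj qP rq moved.
    by case/imsetP: qT; exists u.
  apply: (pi_fixedl B_inner pi_poisson) => //; apply/rho_fixedE.
  have fq : cx (pi q x' y') *m rC q = cx (pi q x' y').
    by rewrite -cx_rho (pi_value B_inner pi_poisson).
  by rewrite (repr_mulg rC) mulmxA fx -{1}fq -mulmxA (repr_mulgV rC) mulmx1.
by rewrite big_imset //; exact: conj_t_inj.
Qed.

Lemma dihedral_kappa_linl y : linear (fun x => dihedral_kappa x y : R^o).
Proof.
move=> a x x'; rewrite /dihedral_kappa !lin_coordD !lin_coordZ.
have e (X Y : R[i]) : Im (a%:C%C * X + Y) = a * Im X + Im Y.
  by case: X Y => p q [p' q'] /=; ring.
rewrite !e; move: kappa_scale => c; rewrite /GRing.scale /=; ring.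
Qed.

Lemma dihedral_kappa_anti x y : dihedral_kappa x y = - dihedral_kappa y x.
Proof. by rewrite /dihedral_kappa; ring. Qed.

Lemma dihedral_kappa_correction : correction rC pi gam dihedral_kappa.
Proof.
split; [exact: dihedral_kappa_linl | exact: dihedral_kappa_anti | exact: bracket_dihedral |].
by move=> q x y z; exact: dihedral_kappa_reflection.
Qed.
End Bracket.

End Coordinates.
End Dihedral.

(** * Quantization *)

Section Assembly.
Variables (R : rcfType) (Gamma : finGroupType) (n : nat).
Variable rC : mx_representation R[i] [set: Gamma] n.
Hypothesis rC_inj : forall g, rC g = 1%:M -> g = 1%g.
Local Notation rho := (realify rC).
Variable B : 'M[R]_(n + n).
Hypothesis B_inner : invariant_inner_product rho B.
Variable pi : Gamma -> 'rV[R]_(n + n) -> 'rV[R]_(n + n) -> 'rV[R]_(n + n).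
Hypothesis pi_poisson : linear_poisson rho B pi.
Implicit Types (g h s t : Gamma) (x y z u w : 'rV[R]_(n + n)) (X Y : 'rV[R[i]]_n).
Local Notation act := (dual_act rho).
Local Notation rk := (fix_codim rC).
Local Notation W := (poisson_bracket rho pi).

(** Either the dihedral situation occurs, or all the values of pi_t are fixed
    by g = s t, hence by s, and the bracket vanishes. *)
Lemma exists_correction g : rk g = 2%N -> exists kap, correction rC pi g kap.
Proof.
move=> rg.
case: (classic (exists t x y, [/\ rk t = 1%N, rk (g * t^-1)%g = 1%N
    & pi t x y *m rho g != pi t x y])) => [[t [x0 [y0 [rt rs moved]]]]|none].
  have gE : g = (g * t^-1 * t)%g by rewrite mulgKV.
  set L := pi t x0 y0 in moved.
  have cent h : (h * t = t * h)%g -> cx L *m rC h = cx L.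
    by move=> c; rewrite -cx_rho (pi_centralised B_inner pi_poisson).
  have cmoved : cx L *m rC g != cx L.
    by apply: contra moved => /eqP e; apply/eqP/rho_fixedE.
  have [c1 [c2 [dec [bc1 hc1] [bc2 hc2] [Ec1 Ec2]]]] :=
    dihedral_decomposition rC_inj gE rg rs rt cent cmoved.
  have c20 : c2 != 0.
    by apply: contra_eq_neq hc2 => ->; rewrite mulmx0 eq_sym oner_neq0.
  have tdec := reflection_dec rC_inj gE rg rs rt cent cmoved dec.
  have [L1 piE] := reflection_form B_inner pi_poisson rt tdec c20.
  have om0 : area c2 x0 y0 != 0.
    by apply: contra moved => /eqP e; rewrite /L piE e scale0r mul0mx.
  have [w wP gw] := pstab1_sqrt rC_inj gE rg rs rt cent cmoved.
  have tE x y : pi t x y = ((area c2 x0 y0)^-1 * area c2 x y) *: L.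
    by rewrite /L (piE x0 y0) scalerA mulrAC mulVf // mul1r.
  by eexists; apply: (dihedral_kappa_correction rC_inj B_inner gE rg rs rt cent cmoved dec bc1 hc1 bc2 hc2 Ec1 Ec2 pi_poisson erefl tE wP gw).
exists (fun _ _ => 0); split=> [y|x y|x y z|q x y z _ _] //; first exact: linear_zerof.
  by rewrite oppr0.
rewrite !scale0r !addr0 mul0rn bracketE big1 // => q _; apply: term_eq0 => x' y' z'.
have [q1|q1] := eqVneq q 1%g.
  by apply: (pi_pi_support B_inner pi_poisson); left; rewrite q1 invg1 mulg1 rg; split=> //; apply: contra_eq_neq rg => ->; rewrite fix_codim1.
have [rq|rq] := eqVneq (rk q) 1%N; last first.
  by apply: (pi_pi_support B_inner pi_poisson); right.
have [a1|a1] := eqVneq (g * q^-1)%g 1%g.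
  by move/eqP: a1; rewrite -eq_mulgV1 => /eqP e; rewrite e rq in rg.
have [ra|ra] := eqVneq (rk (g * q^-1)%g) 1%N; last first.
  by apply: (pi_pi_support B_inner pi_poisson); left.
apply: (pi_fixedl B_inner pi_poisson) => //.
have fx : pi q x' y' *m rho g = pi q x' y'.
  by apply/eqP/negPn/negP => moved; apply: none; exists q, x', y'.
rewrite (repr_mulg rho) mulmxA fx -{1}(pi_value B_inner pi_poisson x' y' rq) -mulmxA.
by rewrite (repr_mulgV rho) mulmx1.
Qed.

Lemma fix_codimM g h : (rk (g * h)%g <= rk g + rk h)%N.
Proof.
have e : rC (g * h)%g - 1%:M = (rC g - 1%:M) *m rC h + (rC h - 1%:M).
  by rewrite (repr_mulg rC) mulmxBl mul1mx; zmod.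
rewrite /fix_codim e.
by apply: (leq_trans (mxrank_add _ _)); rewrite leq_add2r mxrankM_maxl.
Qed.

Lemma fix_codimV g : rk g^-1%g = rk g.
Proof.
suff le h : (rk h^-1%g <= rk h)%N by apply/eqP; rewrite eqn_leq le -{1}[g]invgK le.
have e : rC h^-1%g - 1%:M = - rC h^-1%g *m (rC h - 1%:M).
  by rewrite mulNmx mulmxBr mulmx1 (repr_mulVg rC) opprB.
rewrite /fix_codim e.
exact: mxrankM_maxr.
Qed.

Lemma fix_codimJ g h : rk (g * h * g^-1)%g = rk h.
Proof.
suff le k q : (rk (k * q * k^-1)%g <= rk q)%N.
  apply/eqP; rewrite eqn_leq le.
  by have := le g^-1%g (g * h * g^-1)%g; rewrite invgK !mulgA mulVg mul1g mulgKV.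
have e : rC (k * q * k^-1)%g - 1%:M = rC k *m (rC q - 1%:M) *m rC k^-1%g.
  by rewrite mulmxBr mulmx1 mulmxBl -!(repr_mulg rC) mulgV (repr_oneg rC).
rewrite /fix_codim e.
by apply: (leq_trans (mxrankM_maxl _ _)); exact: mxrankM_maxr.
Qed.

(** The rank of g - 1 over the reals is at least four, which leaves room for x
    with x - g x outside the span of y - g y and z - g z. *)
Lemma kappa_unique g (kap : 'rV[R]_(n + n) -> 'rV[R]_(n + n) -> R) : (1 < rk g)%N ->
  (forall x y z, kap y z *: (x - act g x) + kap z x *: (y - act g y)
      + kap x y *: (z - act g z) = 0) ->
  forall y z, kap y z = 0.
Proof.
move=> rg e y z; pose N := 1%:M - rho g^-1%g.
have sE u : u - act g u = u *m N by rewrite mulmxBr mulmx1.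
have rN : \rank N = (rk g + rk g)%N.
  by rewrite -(fix_codimV g) -rank_rho_sub1 /N -opprB mxrank_opp.
pose U := col_mx (y *m N) (z *m N).
have nsub : ~~ (N <= U)%MS.
  by apply/negP => /mxrankS le; have := leq_trans le (rank_leq_row _); rewrite rN; lia.
case/row_subPn: nsub => i; rewrite rowE; set w := delta_mx 0 i => nw.
have := e w y z; rewrite !sE -addrA => /eqP; rewrite addr_eq0 => /eqP E.
apply/eqP/negPn/negP => nz; case/negP: nw.
have := submx_refl U; rewrite !col_mx_sub => /andP[yU zU].
rewrite -(eqmx_scale _ nz) E.
by rewrite eqmx_opp !addmx_sub ?scalemx_sub.
Qed.

Lemma bracket_inv g h x y z :
  W (g * h * g^-1)%g (act g x) (act g y) (act g z) = act g (W h x y z).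
Proof.
rewrite !bracketE (linear_big _ _ _ (linear_act rC g)).
rewrite (reindex_inj (conjg_inj g^-1%g)) /=; apply: eq_bigr => q _.
have qE : (q ^ g^-1 = g * q * g^-1)%g by rewrite conjgE invgK mulgA.
have aE : (g * h * g^-1 * (q ^ g^-1)^-1 = g * (h * q^-1) * g^-1)%g.
  by rewrite qE !invMg invgK !mulgA mulgKV.
have zE u : act (q ^ g^-1)%g (act g u) = act g (act q u).
  by rewrite -!(actM rC) qE mulgKV.
rewrite aE /bracket_term !zE !qE !(pi_inv pi_poisson) -!(linear_D (linear_act rC g)).
by rewrite !(pi_inv pi_poisson) -!(linear_D (linear_act rC g)).
Qed.

Definition kappa g : 'rV[R]_(n + n) -> 'rV[R]_(n + n) -> R :=
  if rk g =P 2%N is ReflectT e then proj1_sig (constructive_indefinite_description _ (exists_correction e))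
  else fun _ _ => 0.

Lemma kappa_correction g : rk g = 2%N -> correction rC pi g (kappa g).
Proof.
by rewrite /kappa => rg; case: eqP => // e; case: constructive_indefinite_description.
Qed.

Lemma kappa0 g x y : rk g != 2%N -> kappa g x y = 0.
Proof. by rewrite /kappa; case: eqP. Qed.

Lemma kappa_linl g y : linear (fun x => kappa g x y : R^o).
Proof.
have [e|ne] := eqVneq (rk g) 2%N; first by case: (kappa_correction e).
by move=> a x x'; rewrite !kappa0 // scaler0 addr0.
Qed.

Lemma kappa_anti g x y : kappa g x y = - kappa g y x.
Proof.
have [e|ne] := eqVneq (rk g) 2%N; first by case: (kappa_correction e).
by rewrite !kappa0 // oppr0.
Qed.

(** The form transported by g solves the same equation, as the bracket is
    invariant. *)
Lemma kappa_inv g h x y : kappa (g * h * g^-1)%g (act g x) (act g y) = kappa h x y.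
Proof.
have [e|ne] := eqVneq (rk h) 2%N; last by rewrite !kappa0 // fix_codimJ.
have e' : rk (g * h * g^-1)%g = 2%N by rewrite fix_codimJ.
have [_ _ s1 _] := kappa_correction e; have [_ _ s2 _] := kappa_correction e'.
set k' := kappa (g * h * g^-1)%g in s2 *.
apply/eqP; rewrite -subr_eq0; apply/eqP.
apply: (@kappa_unique h (fun x y => k' (act g x) (act g y) - kappa h x y)) x y; first by rewrite e.
move=> x y z; have := s2 (act g x) (act g y) (act g z); rewrite bracket_inv s1.
have aE u : act g u - act (g * h * g^-1)%g (act g u) = act g (u - act h u).
  by rewrite (linear_B (linear_act rC g)) -!(actM rC) mulgKV.
have aL (a1 a2 a3 : R) (u1 u2 u3 : 'rV[R]_(n + n)) :
    (a1 *: act g u1 + a2 *: act g u2 + a3 *: act g u3) *+ 2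
    = act g ((a1 *: u1 + a2 *: u2 + a3 *: u3) *+ 2).
  by rewrite (linear_muln (linear_act rC g)) !(linear_D (linear_act rC g)) !(linear_Z (linear_act rC g)).
rewrite !aE aL.
move=> /(congr1 (act g^-1%g)); rewrite !(actK rC).
have two : (2%:R : R) != 0 by rewrite pnatr_eq0.
rewrite -!scaler_nat => e1; have e2 := scalerI two e1.
by rewrite !scalerBl; move/eqP: e2; rewrite -subr_eq0 => /eqP e2; rewrite -[RHS]oppr0 -e2; zmod.
Qed.

Lemma kappa_solves g : solves rC pi g (kappa g).
Proof.
have [e|ne] := eqVneq (rk g) 2%N; first by case: (kappa_correction e).
move=> x y z; rewrite !kappa0 // !scale0r !addr0 mul0rn.
have [->|g1] := eqVneq g 1%g; first exact: (bracket_one B_inner pi_poisson).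
have [rg|rg] := eqVneq (rk g) 1%N; first exact: (bracket_reflection rC_inj B_inner pi_poisson).
rewrite bracketE big1 // => q _; apply: term_eq0 => x' y' z'.
have rg0 := fix_codim_gt0 rC_inj g1; have rg3 : (2 < rk g)%N by lia.
have sup k : (k == 1%g) || (rk k == 1%N) \/ (k != 1%g /\ rk k != 1%N).
  by case: (k =P 1%g); case: (rk k =P 1%N); [left|left|left|right].
have le1 k : (k == 1%g) || (rk k == 1%N) -> (rk k <= 1)%N.
  by case/orP => /eqP ->; rewrite ?fix_codim1.
have [/le1 rq|?] := sup q; last by apply: (pi_pi_support B_inner pi_poisson); right.
have [/le1 ra|?] := sup (g * q^-1)%g; last by apply: (pi_pi_support B_inner pi_poisson); left.
have := fix_codimM (g * q^-1)%g q; rewrite mulgKV => le.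
by have := leq_trans rg3 (leq_trans le (leq_add ra rq)).
Qed.

(** If kappa_a(pi_q, -) contributes at a reflection g = a q, then q is a
    reflection in the pointwise stabilizer for a, and the correction was
    chosen to vanish on its values. In codimension at least two the real rank
    is at least four. *)
Lemma kappa_bracket g :
  (forall x y z, const_bracket (fun g => rho g^-1%g) pi kappa g x y z = 0)
  \/ (3 < \rank (rho g^-1%g - 1%:M)%R)%N.
Proof.
rewrite rank_rho_sub1 fix_codimV; case: (leqP (rk g) 1) => rg; last by right; lia.
left=> x y z; rewrite /const_bracket big1 // => a _; rewrite big1 // => q /eqP aq.
suff k0 x' y' z' : kappa a (pi q x' y') z' = 0 by rewrite !k0 !addr0.
have [ra|ra] := eqVneq (rk a) 2%N; last by rewrite kappa0.
have [q1|q1] := eqVneq q 1%g.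
  by move: rg; rewrite -aq q1 mulg1 ra.
have [rq|rq] := eqVneq (rk q) 1%N; last first.
  by rewrite (pi_support B_inner pi_poisson) // (linear_0 (kappa_linl _ _)).
have [g1|g1] := eqVneq g 1%g.
  by move: ra; have -> : a = q^-1%g; [apply: (mulIg q); rewrite aq g1 mulVg | rewrite fix_codimV rq].
have rg1 : rk g = 1%N by apply/eqP; rewrite eqn_leq rg (fix_codim_gt0 rC_inj).
have aE : a = (g * q^-1)%g by rewrite -aq mulgK.
have [_ qP] := pair_in_pstab ra aE rg1 (etrans (fix_codimV q) rq).
have [_ _ _ van] := kappa_correction ra; apply: van => //.
by rewrite -groupV.
Qed.

End Assembly.

Theorem theorem3p7 (R : realType) (Gamma : finGroupType) (n : nat)
    (rC : mx_representation R[i] [set: Gamma] n)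
    (rC_faithful : mx_faithful rC)
    (B : 'M[R]_(n + n))
    (B_inner : invariant_inner_product (realify rC) B)
    (pi : Gamma -> 'rV[R]_(n + n) -> 'rV[R]_(n + n) -> 'rV[R]_(n + n))
    (pi_poisson : linear_poisson (realify rC) B pi) :
  quantizable (realify rC) B (fun g x y => linear_form (pi g x y)).
Proof.
have rC_inj g : rC g = 1%:M -> g = 1%g.
  move=> e; apply/set1P; apply: (subsetP rC_faithful).
  by apply/rkerP; rewrite inE.
apply: (quantizable_of_PBW (kap := kappa rC_inj B_inner pi_poisson)).
- exact: (pi_linl pi_poisson).
- exact: (pi_anti pi_poisson).
- exact: (pi_inv pi_poisson).
- exact: kappa_linl.
- exact: kappa_anti.
- exact: kappa_inv.
- exact: (quad_condition B_inner pi_poisson).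
- exact: kappa_solves.
- exact: kappa_bracket.
- exact: (pr_pi B_inner pi_poisson).
Qed.
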